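(* Let $\mathbf W=\{W^n\}_{n=1}^\infty$ be a general channel with input alphabet $\mathcal X=\mathbb R$ and arbitrary output alphabet $\mathcal Y$, let $\mathbf c=\{c_n\}$ be a general cost function and $\Gamma\in\mathbb R$. Assume that $\mathbf W$ satisfies assumptions (A1) and (A2) below, and satisfies the strong converse property with input cost constraint $\Gamma$. Then for all $\varepsilon\ge0,\delta\ge0,\mu\ge0,\lambda\ge0$ with $\varepsilon<1$, $\mu+\lambda<1$, $\delta<1$, $$\sup_{\mathbf X\in\mathcal S_\Gamma}\underline I(\mathbf X;\mathbf Y)=C_s(\varepsilon,\Gamma|\mathbf W)=D(\mu,\lambda,\Gamma|\mathbf W)=S(\delta,\Gamma|\mathbf W)=\sup_{\mathbf X\in\mathcal S_\Gamma}\overline I(\mathbf X;\mathbf Y).$$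
   Context: A general channel $\mathbf W=\{W^n\}$ with input alphabet $\mathcal X$ and output alphabet $\mathcal Y$ is a sequence of transition probabilities: for each $n$ and $\mathbf x\in\mathcal X^n$, $W^n(\cdot|\mathbf x)$ is a probability measure on $\mathcal Y^n$, measurable in $\mathbf x$. A general cost function is a sequence of functions $c_n:\mathcal X^n\to\mathbb R$; put $\mathcal X^n(\Gamma)=\{\mathbf x\in\mathcal X^n:\frac1n c_n(\mathbf x)\le\Gamma\}$. $\mathcal S_\Gamma$ is the set of input processes $\mathbf X=\{X^n\}_{n\ge1}$ ($X^n$ an $\mathcal X^n$-valued random variable) with $\Pr\{X^n\in\mathcal X^n(\Gamma)\}=1$ for all $n$; $\mathbf Y=\{Y^n\}$ is the output process, $Y^n$ the output of $W^n$ for input $X^n$. For real random variables $Z_n$: $\text{p-}\liminf Z_n=\sup\{\alpha:\lim_n\Pr\{Z_n<\alpha\}=0\}$, $\text{p-}\limsup Z_n=\inf\{\beta:\lim_n\Pr\{Z_n>\beta\}=0\}$. $\underline I(\mathbf X;\mathbf Y)$ (resp. $\overline I(\mathbf X;\mathbf Y)$) is the p-liminf (resp. p-limsup) of $\frac1n\log\frac{W^n(Y^n|X^n)}{P_{Y^n}(Y^n)}$, where this ratio means the Radon–Nikodym derivative $\frac{dP_{X^nY^n}}{d(P_{X^n}\times P_{Y^n})}(X^n,Y^n)$. For a distribution $Q$ on $\mathcal X^n$, $QW^n(B)=\int W^n(B|\mathbf x)Q(d\mathbf x)$. Transmission codes: an $(n,M_n,\varepsilon_n,\Gamma)$ code is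 an encoder $\varphi_n:\{1,\dots,M_n\}\to\mathcal X^n$ with $\frac1nc_n(\varphi_n(i))\le\Gamma$ for all $i$, and a decoder $\psi_n:\mathcal Y^n\to\{1,\dots,M_n\}$, with $\varepsilon_n=\frac1{M_n}\sum_iW^n(\mathcal D_i^c|\varphi_n(i))$, $\mathcal D_i=\psi_n^{-1}(i)$. $R$ is $(\varepsilon,\Gamma)$-achievable if such codes exist with $\limsup\varepsilon_n\le\varepsilon$, $\liminf\frac1n\log M_n\ge R$; $C_s(\varepsilon,\Gamma|\mathbf W)$ is the supremum of such $R$, and $C_s(\Gamma|\mathbf W)=C_s(0,\Gamma|\mathbf W)$. The channel satisfies the strong converse property with input cost constraint $\Gamma$ if every sequence of $(n,M_n,\varepsilon_n,\Gamma)$ codes of rate $R>C_s(\Gamma|\mathbf W)$ (i.e. $\liminf\frac1n\log M_n> C_s(\Gamma|\mathbf W)$) has $\varepsilon_n\to1$. Identification codes: an $(n,N_n,\mu_n,\lambda_n,\Gamma)$ code consists of distributions $Q_1,\dots,Q_{N_n}$ on $\mathcal X^n$ with $Q_i(\mathcal X^n(\Gamma))=1$ and (not necessarily disjoint) sets $\mathcal D_1,\dots,\mathcal D_{N_n}\subset\mathcal Y^n$, with $\mu_n=\max_iQ_iW^n(\mathcal D_i^c)$, $\lambda_n=\max_{i\ne j}Q_jW^n(\mathcal D_i)$. $R$ is $(\mu,\lambda,\Gamma)$-achievable if such codes exist with $\limsup\mu_n\le\mu$, $\limsup\lambda_n\le\lambda$, $\liminf\frac1n\log\log N_n\ge R$;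 $D(\mu,\lambda,\Gamma|\mathbf W)$ is the supremum of such $R$. Resolvability: $d(P,P')=2\sup_B|P(B)-P'(B)|$ (variational distance); $U_M$ is uniform on $\{1,\dots,M\}$. For $\mathbf X\in\mathcal S_\Gamma$, $R$ is $(\delta,\Gamma)$-achievable for $\mathbf X$ if there are $M_n$ and maps $\varphi_n:\{1,\dots,M_n\}\to\mathcal X^n(\Gamma)$ such that, with $\tilde Y^n$ the output of $W^n$ for input $\varphi_n(U_{M_n})$, $\limsup d(P_{Y^n},P_{\tilde Y^n})\le\delta$ and $\limsup\frac1n\log M_n\le R$. $R$ is $(\delta,\Gamma)$-achievable if it is so for all $\mathbf X\in\mathcal S_\Gamma$; $S(\delta,\Gamma|\mathbf W)$ is the infimum of such $R$. (A1): there exist $n$-dimensional cubes $V_n(\Gamma)\subset\mathbb R^n$ of edge length $l_n(\Gamma)\ge2$ with $\limsup_n\frac1n\log\log l_n(\Gamma)=0$ and $\mathcal X^n(\Gamma)\subset V_n(\Gamma)$ for all $n$. (A2): letting $F_n(\mathbf x)=\left[\frac{\partial^2}{\partial v_i\partial v_j}D(W^n(\cdot|\mathbf v)\|W^n(\cdot|\mathbf x))\right]_{\mathbf v=\mathbf x}$ ($D$ the Kullback–Leibler divergence, twice differentiable in $\mathbf v$) and $\|F_n(\mathbf x)\|=\sup_{\mathbf v\ne\mathbf 0}\frac{\mathbf vF_n(\mathbf x)\mathbf v^T}{\mathbf v\mathbf v^T}$, one has $\limsup_n\frac1n\log\max\{1,\log\sup_{\mathbf x\in V_n(\Gamma)}\|F_n(\mathbf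 x)\|\}=0$. *)

(* Defs.v *)
From HB Require Import structures.
From mathcomp Require Import all_boot all_algebra.
From mathcomp Require Import all_classical all_reals all_analysis.
From mathcomp Require Import measurable_realfun.

Unset Implicit Arguments.
Unset Strict Implicit.
Unset Printing Implicit Defensive.

Import GRing.Theory Num.Theory.
Import numFieldNormedType.Exports.

Local Open Scope classical_set_scope.
Local Open Scope ring_scope.

Section Defs.
Variables (R : realType) (dY : measure_display) (Y : measurableType dY).

Definition channel := forall n : nat, R.-pker (n.-tuple R) ~> (n.-tuple Y).

Definition input_process := forall n : nat, probability (n.-tuple R) R.

Variables (W : channel) (c : forall n : nat, n.-tuple R -> R) (Gamma : R).

Definition cost_set (n : nat) : set (n.-tuple R) :=
  [set x | (n%:R)^-1 * c n x <= Gamma].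

(* Pr{X^n in X^n(Gamma)} = 1  (inner-measure reading: no measurability of c_n
   is assumed) *)
Definition full_on (n : nat) (Q : probability (n.-tuple R) R)
    (A : set (n.-tuple R)) : Prop :=
  exists B, [/\ measurable B, B `<=` A & Q B = 1%E].

Definition in_S_Gamma (P : input_process) : Prop :=
  forall n, (0 < n)%N -> full_on n (P n) (cost_set n).

Definition elog (x : \bar R) : \bar R :=
  match x with
  | +oo%E => +oo%E
  | r%:E => if 0 < r then (ln r)%:E else -oo%E
  | -oo%E => -oo%E
  end.

Definition outdist (n : nat) (Q : probability (n.-tuple R) R)
    (B : set (n.-tuple Y)) : \bar R :=
  (\int[Q]_x W n x B)%E.

Definition joint (P : input_process) (n : nat)
    (A : set (n.-tuple R * n.-tuple Y)) : \bar R :=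
  (\int[P n]_x W n x (xsection A x))%E.

(* integral of h over A with respect to the product P_{X^n} x P_{Y^n}
   (written as an iterated integral, using P_{Y^n} = P_{X^n} W^n) *)
Definition prod_int (P : input_process) (n : nat)
    (A : set (n.-tuple R * n.-tuple Y))
    (h : n.-tuple R * n.-tuple Y -> \bar R) : \bar R :=
  (\int[P n]_x \int[P n]_x' \int[W n x']_(y in xsection A x) h (x, y))%E.

(* f is the (generalized) Radon-Nikodym derivative
   dP_{X^nY^n} / d(P_{X^n} x P_{Y^n}): f = +oo exactly on a product-null set
   carrying the singular part (Lebesgue decomposition); when
   P_{X^nY^n} << P_{X^n} x P_{Y^n}, this is the usual RN derivative. *)
Definition info_density (P : input_process) (n : nat)
    (f : n.-tuple R * n.-tuple Y -> \bar R) : Prop :=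
  [/\ measurable_fun setT f,
      (forall z, 0 <= f z)%E,
      prod_int P n setT (fun z => (f z == +oo%E)%:R%:E) = 0%E &
      forall A, measurable A ->
        joint P n A = (prod_int P n A f + joint P n (A `&` [set z | f z = +oo%E]))%E].

Definition info_spec (n : nat) (f : n.-tuple R * n.-tuple Y -> \bar R) z :=
  ((n%:R)^-1%:E * elog (f z))%E.

Definition I_low (P : input_process) : \bar R :=
  ereal_sup [set a%:E | a in [set a : R |
    forall f : forall n, n.-tuple R * n.-tuple Y -> \bar R,
      (forall n, info_density P n (f n)) ->
      (fun n => joint P n [set z | (info_spec n (f n) z < a%:E)%E]) @ \oo
        --> 0%E]].

Definition I_up (P : input_process) : \bar R :=
  ereal_inf [set b%:E | b in [set b : R |
    forall f : forall n, n.-tuple R * n.-tuple Y -> \bar R,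
      (forall n, info_density P n (f n)) ->
      (fun n => joint P n [set z | (b%:E < info_spec n (f n) z)%E]) @ \oo
        --> 0%E]].

Definition sup_I_low : \bar R := ereal_sup [set I_low P | P in in_S_Gamma].
Definition sup_I_up : \bar R := ereal_sup [set I_up P | P in in_S_Gamma].

(* (n, M_n, eps_n, Gamma) codes for all n >= 1 (entries at n = 0 are unused) *)
Definition tcodes (M : nat -> nat) (enc : forall n, 'I_(M n) -> n.-tuple R)
    (dec : forall n, n.-tuple Y -> 'I_(M n)) : Prop :=
  forall n, (0 < n)%N ->
    [/\ (0 < M n)%N,
        forall i, cost_set n (enc n i) &
        forall i, measurable (dec n @^-1` [set i])].

Definition terr (M : nat -> nat) (enc : forall n, 'I_(M n) -> n.-tuple R)
    (dec : forall n, n.-tuple Y -> 'I_(M n)) (n : nat) : R :=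
  ((M n)%:R)^-1 * \sum_(i < M n) fine (W n (enc n i) (~` (dec n @^-1` [set i]))).

Definition trate (M : nat -> nat) (n : nat) : R := (n%:R)^-1 * ln ((M n)%:R).

Definition Cs_achievable (eps r : R) : Prop :=
  exists M enc dec, [/\ tcodes M enc dec,
    (limn_esup (fun n => (terr M enc dec n)%:E) <= eps%:E)%E &
    (r%:E <= limn_einf (fun n => (trate M n)%:E))%E].

Definition Cs (eps : R) : \bar R :=
  ereal_sup [set r%:E | r in Cs_achievable eps].

Definition strong_converse : Prop :=
  forall M enc dec, tcodes M enc dec ->
    (Cs 0 < limn_einf (fun n => (trate M n)%:E))%E ->
    terr M enc dec n @[n --> \oo] --> (1 : R).

Definition icodes (N : nat -> nat)
    (Q : forall n, 'I_(N n) -> probability (n.-tuple R) R)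
    (D : forall n, 'I_(N n) -> set (n.-tuple Y)) : Prop :=
  forall n, (0 < n)%N ->
    [/\ (0 < N n)%N,
        forall i, full_on n (Q n i) (cost_set n) &
        forall i, measurable (D n i)].

Definition imu (N : nat -> nat)
    (Q : forall n, 'I_(N n) -> probability (n.-tuple R) R)
    (D : forall n, 'I_(N n) -> set (n.-tuple Y)) (n : nat) : R :=
  \big[Num.max/0]_(i < N n) fine (outdist n (Q n i) (~` D n i)).

Definition ilambda (N : nat -> nat)
    (Q : forall n, 'I_(N n) -> probability (n.-tuple R) R)
    (D : forall n, 'I_(N n) -> set (n.-tuple Y)) (n : nat) : R :=
  \big[Num.max/0]_(i < N n) \big[Num.max/0]_(j < N n | j != i)
     fine (outdist n (Q n j) (D n i)).

Definition irate (N : nat -> nat) (n : nat) : R :=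
  (n%:R)^-1 * ln (ln ((N n)%:R)).

Definition D_achievable (mu lambda r : R) : Prop :=
  exists N Q D, [/\ icodes N Q D,
    (limn_esup (fun n => (imu N Q D n)%:E) <= mu%:E)%E,
    (limn_esup (fun n => (ilambda N Q D n)%:E) <= lambda%:E)%E &
    (r%:E <= limn_einf (fun n => (irate N n)%:E))%E].

Definition Dcap (mu lambda : R) : \bar R :=
  ereal_sup [set r%:E | r in D_achievable mu lambda].

Definition vdist (dT : measure_display)
    (T' : measurableType dT) (p q : set T' -> \bar R) : \bar R :=
  ereal_sup [set (2%:E * `|p B - q B|)%E | B in [set B : set T' | measurable B]].

(* output distribution of W^n for input phi(U_M) *)
Definition res_out (M : nat -> nat) (enc : forall n, 'I_(M n) -> n.-tuple R)
    (n : nat) (B : set (n.-tuple Y)) : \bar R :=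
  (((M n)%:R)^-1%:E * \sum_(i < M n) W n (enc n i) B)%E.

Definition res_achievable (delta r : R) (P : input_process) : Prop :=
  exists (M : nat -> nat) (enc : forall n, 'I_(M n) -> n.-tuple R),
    [/\ forall n, (0 < n)%N -> (0 < M n)%N /\ forall i, cost_set n (enc n i),
        (limn_esup (fun n => vdist _ _ (outdist n (P n)) (res_out M enc n))
           <= delta%:E)%E &
        (limn_esup (fun n => (trate M n)%:E) <= r%:E)%E].

Definition Sres (delta : R) : \bar R :=
  ereal_inf [set r%:E | r in [set r : R |
    forall P, in_S_Gamma P -> res_achievable delta r P]].

Definition t2rv (n : nat) (x : n.-tuple R) : 'rV[R]_n := \row_i tnth x i.
Definition rv2t (n : nat) (v : 'rV[R]_n) : n.-tuple R := [tuple v ord0 i | i < n].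

(* D(p || q) = \int log (dp/dq) dp if p << q, +oo otherwise *)
Definition is_RN_deriv (dT : measure_display)
    (T' : measurableType dT) (p q : {measure set T' -> \bar R}) (g : T' -> R) : Prop :=
  [/\ measurable_fun setT g, forall y, 0 <= g y &
      forall A, measurable A -> p A = (\int[q]_(y in A) (g y)%:E)%E].

Definition KL (dT : measure_display) (T' : measurableType dT)
    (p q : {measure set T' -> \bar R}) : \bar R :=
  ereal_inf [set (\int[p]_y (ln (g y))%:E)%E | g in is_RN_deriv _ _ p q].

Definition KLfun (n : nat) (x : n.-tuple R) : 'rV[R]_n -> \bar R :=
  fun v => KL _ _ (W n (rv2t n v)) (W n x).

Definition unitv (n : nat) (j : 'I_n) : 'rV[R]_n := delta_mx ord0 j.

Definition KL_twice_diff (n : nat) (x : n.-tuple R) : Prop :=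
  let g := fun v => fine (KLfun n x v) in
  [/\ \forall v \near t2rv n x, KLfun n x v \is a fin_num,
      \forall v \near t2rv n x, differentiable g v &
      forall j, differentiable (fun w => 'D_(unitv n j) g w) (t2rv n x)].

Definition hessian (n : nat) (x : n.-tuple R) : 'M[R]_n :=
  let g := fun v => fine (KLfun n x v) in
  \matrix_(i, j) 'D_(unitv n i) (fun w => 'D_(unitv n j) g w) (t2rv n x).

Definition mxnorm_rq (n : nat) (F : 'M[R]_n) : \bar R :=
  ereal_sup [set ((v *m F *m v^T) ord0 ord0 / (v *m v^T) ord0 ord0)%:E
            | v in [set v : 'rV[R]_n | v != 0]].

Definition cube (n : nat) (a : n.-tuple R) (l : R) : set (n.-tuple R) :=
  [set x | forall i, tnth a i <= tnth x i <= tnth a i + l].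

Definition A1_A2 : Prop :=
  exists (a : forall n, n.-tuple R) (l : nat -> R),
    [/\ forall n, 2 <= l n,
        limn_esup (fun n => ((n%:R)^-1 * ln (ln (l n)))%:E) = 0%E,
        forall n, (0 < n)%N -> cost_set n `<=` cube n (a n) (l n),
        forall n, (0 < n)%N -> forall x, KL_twice_diff n x &
        limn_esup (fun n => ((n%:R)^-1%:E *
           elog (maxe 1%E (elog (ereal_sup
             [set mxnorm_rq n (hessian n x) | x in cube n (a n) (l n)]))))%E) = 0%E].

End Defs.

(* Main.v *)
Require Import Defs.
From HB Require Import structures.
From mathcomp Require Import all_boot all_order all_algebra.
From mathcomp Require Import all_classical all_reals all_analysis.
From mathcomp Require Import measurable_realfun giry.
From mathcomp Require Import lra ring zify.

(** All five quantities are squeezed between sup I_low and Cs(0).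
    - Feinstein's lemma gives sup I_low <= Cs(0); the Verdu-Han bound, applied to the uniform input on
      the codewords, gives Cs(0) <= sup I_low. The strong converse gives Cs(eps) <= Cs(0), and also
      sup I_up <= Cs(0): if I_up exceeds Cs(0), Feinstein's lemma at a higher rate still leaves an
      error that is bounded away from 1 infinitely often.
    - sup I_low <= D(0,0): combining a transmission code of small maximal error with words over
      {1,...,2^k} that rarely agree (Gilbert-Varshamov) gives doubly exponentially many uniform
      distributions on codewords that are pairwise distinguishable.
    - S(0) <= sup I_up: by Pinsker's inequality and the second-order behaviour of the divergence, (A2)
      makes x |-> W^n(.|x) Lipschitz in variation on the cube of (A1). So the input can be quantized
      to a finite mixture, which is again in S_Gamma, and for such an input a greedy (derandomized)
      choice of codewords replaces the random coding of the soft covering lemma.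
    - D(mu,lambda) <= S(delta) when mu + lambda + delta < 1: all the distributions of an
      identification code are eventually approximated by codebooks of size e^{n(r+g)}, otherwise a
      single bad input process could be formed. The same Lipschitz property allows the codewords to be
      quantized, and counting the quantized codebooks bounds the number of messages. *)

Set Implicit Arguments.
Unset Strict Implicit.
Unset Printing Implicit Defensive.

Import Order.TTheory GRing.Theory Num.Theory.
Import numFieldNormedType.Exports.

Local Open Scope classical_set_scope.
Local Open Scope ring_scope.
Local Open Scope ereal_scope.

(** * Channels as kernels *)

(** Information densities are determined only almost everywhere, and the joint law need not be
    dominated by the product law, so for a general input nothing can be said about an individual
    codeword. At an atom x of the input everything becomes exact: off the set where it is infinite,
    f(x, .) is the density of W^n(.|x) with respect to the output law. Hence the Verdu-Han bound and
    the covering argument both use finitely supported inputs. Finite supports also settle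
    measurability: c_n is arbitrary, yet a finite subset of the cost set is measurable. Quantization
    is affordable because (A1) and (A2) give doubly exponential bounds with arbitrarily small
    exponent g. A word then falls in one of about exp(n e^{ng}) cells, a codebook of e^{nr} words
    has about exp(n e^{n(r+g)}) cell patterns, and the iterated logarithm in the identification rate
    sees only r. The bound of D by S asks for mu + lambda + delta < 1, more than the theorem grants.
    It is therefore applied only with delta = 0 or with mu = lambda = 0, and monotonicity covers the
    rest. *)

Section kernel_giry.
Context {d1 d2} {X : measurableType d1} {Z : measurableType d2} {R : realType}.
Variable k : R.-pker X ~> Z.

(** A copy of [k x] to which the structure of a probability is attached, so that results on
    probability measures apply to a single row of the kernel. *)
Definition kprob (x : X) : set Z -> \bar R := k x.

HB.instance Definition _ x := Measure.on (kprob x).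

Let kprob_setT x : kprob x setT = 1.
Proof. exact: prob_kernel. Qed.

HB.instance Definition _ x := Measure_isProbability.Build _ _ _ (kprob x) (kprob_setT x).

Definition kgiry (x : X) : giry Z R := kprob x.

Lemma measurable_kgiry : measurable_fun setT kgiry.
Proof. by apply: measurable_giry_codensity => // B mB; exact: measurable_kernel. Qed.

(** The output law as a bind of the Giry monad, which supplies both its measure structure and the
    iterated integral formula. *)
Definition kout (P : giry X R) : giry Z R := giry_bind P measurable_kgiry.

Lemma koutE P B : measurable B -> kout P B = \int[P]_x k x B.
Proof.
move=> mB; rewrite /kout /giry_bind /= /giry_join /=.
rewrite -[LHS]/(giry_int (giry_map measurable_kgiry P) (giry_ev ^~ B)).
by rewrite giry_int_map//; exact: measurable_giry_ev.
Qed.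

Lemma integral_kout (P : giry X R) (f : Z -> \bar R) : measurable_fun setT f -> (forall z, 0 <= f z) ->
  \int[kout P]_z f z = \int[P]_x \int[k x]_z f z.
Proof. by move=> mf f0; exact: giry_int_bind. Qed.

End kernel_giry.

Section semidirect.
Context {d1 d2} {X : measurableType d1} {Z : measurableType d2} {R : realType}.
Variables (g : X -> giry Z R) (mg : measurable_fun setT g).

Definition gkernel of measurable_fun setT g : X -> {measure set Z -> \bar R} := g.

Let gkernel_measurable U : measurable U -> measurable_fun setT (gkernel mg ^~ U).
Proof. by move=> mU; exact: measurableT_comp (measurable_giry_ev mU) mg. Qed.

HB.instance Definition _ := @isKernel.Build _ _ X Z R (gkernel mg) gkernel_measurable.

Let gkernel_subprob : ereal_sup [set gkernel mg x [set: Z] | x in [set: X]] <= 1.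
Proof. by apply: ge_ereal_sup => _ [x _ <-]; exact: sprobability_setT. Qed.

HB.instance Definition _ :=
  @Kernel_isSubProbability.Build _ _ X Z R (gkernel mg) gkernel_subprob.

(** The law of the pair (x, y) with x fixed and y drawn from [g x]. Averaging it over [P] yields the
    joint law, and the product law when [g] is constant. *)
Definition graphm (x : X) : giry (X * Z)%type R :=
  giry_map (@pair1_measurable _ _ X Z x) (g x).

Lemma graphmE x A : graphm x A = g x (xsection A x).
Proof. by rewrite /graphm /giry_map /pushforward /= xsectionE. Qed.

Lemma measurable_graphm : measurable_fun setT graphm.
Proof.
apply: measurable_giry_codensity => // A mA.
rewrite (_ : (fun x => _) = (fun x => gkernel mg x (xsection A x))); last first.
  by apply/funext => x; rewrite graphmE.
by apply: measurable_fun_xsection_finite_kernel; rewrite inE.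
Qed.

Definition semidirect (P : giry X R) : giry (X * Z)%type R := giry_bind P measurable_graphm.

Lemma semidirectE P A : measurable A -> semidirect P A = \int[P]_x g x (xsection A x).
Proof.
move=> mA; rewrite /semidirect /giry_bind /= /giry_join /=.
rewrite -[LHS]/(giry_int (giry_map measurable_graphm P) (giry_ev ^~ A)).
rewrite giry_int_map//; last exact: measurable_giry_ev.
by apply: eq_integral => x _; rewrite /= /giry_ev graphmE.
Qed.

Lemma integral_semidirect P (f : X * Z -> \bar R) : measurable_fun setT f ->
  (forall z, 0 <= f z) ->
  \int[semidirect P]_z f z = \int[P]_x \int[g x]_y f (x, y).
Proof.
move=> mf f0; rewrite -[LHS]/(giry_int _ _) giry_int_bind//.
by apply: eq_integral => x _; rewrite giry_int_map.
Qed.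

End semidirect.

Section change_of_density.
Context {d} {T : measurableType d} {R : realType}.
Variables (p q : {measure set T -> \bar R}) (g : T -> R).
Hypotheses (mg : measurable_fun setT g) (g0 : forall x, (0 <= g x)%R).
Hypothesis pE : forall A, measurable A -> p A = \int[q]_(x in A) (g x)%:E.

Let mEg : measurable_fun setT (fun x => (g x)%:E).
Proof. exact/measurable_EFinP. Qed.

Import HBNNSimple.

(** On simple functions this is [pE] applied to the level sets; monotone convergence does the
    rest. *)
Lemma ge0_integral_density (f : T -> \bar R) : measurable_fun setT f -> (forall x, 0 <= f x) ->
  \int[p]_x f x = \int[q]_x (f x * (g x)%:E).
Proof.
move=> mf f0; pose h := nnsfun_approx measurableT mf.
have mh n : measurable_fun [set: T] (EFin \o h n) by exact/measurable_EFinP.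
have -> : \int[p]_x f x = lim (\int[p]_x (EFin \o h n) x @[n --> \oo]).
  rewrite -monotone_convergence//.
  - by apply: eq_integral => x _; apply/esym/cvg_lim => //; exact: cvg_nnsfun_approx.
  - by move=> n x _; rewrite lee_fin.
  - by move=> x _ a b ab; rewrite lee_fin; exact/lefP/nd_nnsfun_approx.
have -> : \int[q]_x (f x * (g x)%:E) = lim (\int[q]_x ((EFin \o h n) x * (g x)%:E) @[n --> \oo]).
  rewrite -monotone_convergence//.
  - apply: eq_integral => x _; apply/esym/cvg_lim => //.
    by apply: cvgeZr => //; exact: cvg_nnsfun_approx.
  - by move=> n; apply: emeasurable_funM.
  - by move=> n x _; rewrite mule_ge0// lee_fin.
  - move=> x _ a b ab; apply: lee_wpmul2r; rewrite lee_fin//.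
    exact/lefP/nd_nnsfun_approx.
congr (lim (_ @ \oo)); apply/funext => n.
transitivity (\int[p]_x
   (\sum_(y \in range (h n)) (y * \1_(h n @^-1` [set y]) x)%:E)).
  by apply: eq_integral => t _; rewrite /= fimfunE -fsumEFin.
have indich m r : measurable_fun setT (fun x => (r * \1_(h m @^-1` [set r]) x)%:E).
  by apply: (measurable_comp measurableT) => //; exact: measurable_funM.
rewrite ge0_integral_fsum//; last by move=> m y _; exact: nnfun_muleindic_ge0.
transitivity (\int[q]_x (\sum_(y \in range (h n))
    (y * \1_(h n @^-1` [set y]) x)%:E * (g x)%:E)); last first.
  apply: eq_integral => x _.
  rewrite -ge0_mule_fsuml => [|y]; last exact: nnfun_muleindic_ge0.
  by rewrite fsumEFin // -(fimfunE _ x).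
rewrite ge0_integral_fsum//; last 2 first.
  - by move=> y; exact: emeasurable_funM.
  - by move=> m y _; apply: mule_ge0; [exact: nnfun_muleindic_ge0|rewrite lee_fin].
apply: eq_fsbigr => r; rewrite inE => -[t _ rt].
under eq_integral do rewrite EFinM.
under [RHS]eq_integral do rewrite EFinM -muleA.
have r0 : (0 <= r)%R by rewrite -rt.
rewrite ge0_integralZl//; last first.
  by apply/measurable_EFinP.
rewrite ge0_integralZl//.
- rewrite integral_indic// setIT pE//.
  rewrite [in LHS]integral_mkcond; congr (_ * _); apply: eq_integral => x _.
  by rewrite epatch_indic muleC.
- by apply: emeasurable_funM => //; exact/measurable_EFinP.
- by move=> x _; rewrite mule_ge0// lee_fin.
Qed.

End change_of_density.

(** * Lebesgue decomposition of the joint law *)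

Section lebesgue_decomposition.
Context {d} {T : measurableType d} {R : realType}.
Variables (J Q : {finite_measure set T -> \bar R}).

Definition gen_density (f : T -> \bar R) : Prop :=
  [/\ measurable_fun setT f, (forall z, 0 <= f z), Q [set z | f z = +oo] = 0 &
   forall A, measurable A ->
     J A = \int[Q]_(z in A) f z + J (A `&` [set z | f z = +oo])].

Definition sumJQ : set T -> \bar R := measure_add J Q.

HB.instance Definition _ := Measure.on sumJQ.

Let sumJQ_fin : fin_num_fun sumJQ.
Proof.
by move=> U mU; rewrite /sumJQ measure_addE fin_numD !fin_num_measure.
Qed.

HB.instance Definition _ := Measure_isFinite.Build _ _ _ sumJQ sumJQ_fin.

Lemma exists_RN (m : {finite_measure set T -> \bar R}) :
  (forall A, measurable A -> m A <= sumJQ A) ->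
  exists g : T -> R, [/\ measurable_fun setT g, (forall x, (0 <= g x)%R) &
    forall A, measurable A -> m A = \int[sumJQ]_(x in A) (g x)%:E].
Proof.
move=> mle.
have dom : m `<< sumJQ.
  apply/null_content_dominatesP => A mA A0; apply/eqP.
  by rewrite -measure_le0 -A0 mle.
have [g [g0 gfin gint gE]] := radon_nikodym_sigma_finite dom.
have gK x : g x = (fine (g x))%:E by rewrite fineK.
exists (fine \o g); split.
- apply/measurable_EFinP; rewrite (_ : _ \o _ = g); first exact: measurable_int gint.
  by apply/funext => x /=; rewrite -gK.
- by move=> x /=; rewrite fine_ge0.
- by move=> A mA; rewrite gE//; apply: eq_integral => x _ /=; rewrite gK.
Qed.

(** Both [J] and [Q] are dominated by their sum and have densities [g] and [h] with respect to it.
    The quotient g / h is the density sought where h > 0. The set where h = 0 is null for [Q] and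
    carries the singular part of [J], so the value there is [+oo]. *)
Lemma exists_gen_density : exists f, gen_density f.
Proof.
have [g [mg g0 gE]] : exists g : T -> R, [/\ measurable_fun setT g, (forall x, (0 <= g x)%R) &
    forall A, measurable A -> J A = \int[sumJQ]_(x in A) (g x)%:E].
  by apply: exists_RN => A mA; rewrite /sumJQ measure_addE leeDl.
have [h [mh h0 hE]] : exists g : T -> R, [/\ measurable_fun setT g, (forall x, (0 <= g x)%R) &
    forall A, measurable A -> Q A = \int[sumJQ]_(x in A) (g x)%:E].
  by apply: exists_RN => A mA; rewrite /sumJQ measure_addE leeDr.
pose N := [set x | h x = 0%R].
have mN : measurable N.
  by rewrite -[N]setTI; exact: (mh measurableT [set 0%R] (measurable_set1 _)).
pose k x := ((g x) * (h x)^-1)%R.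
have k0 x : (0 <= k x)%R by rewrite mulr_ge0// invr_ge0.
have mk : measurable_fun setT k.
  apply: measurable_funM => //.
  rewrite (_ : (fun x => _) = (fun x => h x `^ (-1))%R); last first.
    by apply/funext => x; rewrite powR_inv1.
  exact: measurableT_comp (measurable_powR _) mh.
pose f x := if h x == 0%R then +oo else (k x)%:E.
have fN : [set z | f z = +oo] = N.
  by apply/seteqP; split => x /=; rewrite /f /N /=; [case: eqP|move=> ->; rewrite eqxx].
have QN : Q N = 0.
  rewrite hE// integral0_eq// => x; rewrite /N /= => -> //.
have mf : measurable_fun setT f.
  apply: measurable_fun_ifT => //; last exact/measurable_EFinP.
  exact: measurable_fun_eqr.
have f0 x : 0 <= f x by rewrite /f; case: ifP => //; rewrite lee_fin.
exists f; split => //; first by rewrite fN.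
move=> A mA; rewrite fN.
have -> : \int[Q]_(z in A) f z = \int[Q]_(z in A) (k z)%:E.
  apply: ge0_ae_eq_integral => //.
  - exact/measurable_funTS.
  - exact/measurable_funTS/measurable_EFinP.
  - by move=> x _; rewrite lee_fin.
  - exists N; split => // x /= /not_implyP [Ax]; rewrite /f.
    by case: eqP.
have -> : \int[Q]_(z in A) (k z)%:E = J (A `&` ~` N).
  rewrite integral_mkcond (ge0_integral_density mh h0 hE)//; last 2 first.
  - by apply/(measurable_restrictT _ _).1 => //; exact/measurable_funTS/measurable_EFinP.
  - by move=> x; apply: erestrict_ge0 => y _; rewrite lee_fin.
  rewrite gE; last by apply: measurableI => //; exact: measurableC.
  rewrite [RHS]integral_mkcond; apply: eq_integral => x _.
  rewrite !patchE in_setI in_setC; case: (x \in A) => //=; last by rewrite mul0e.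
  rewrite -EFinM /k; case: ifPn; rewrite ?negbK ?notin_setE ?inE /N /=.
    by move=> /eqP hx; rewrite -mulrA mulVf ?mulr1.
  by move=> ->; rewrite mulr0.
rewrite addeC -measureU//.
- by rewrite -setIUr setUCr setIT.
- exact: measurableI.
- by apply: measurableI => //; exact: measurableC.
- by rewrite setIACA setICr setI0.
Qed.

End lebesgue_decomposition.

Section density_bounds.
Context {d} {T : measurableType d} {R : realType}.
Variables (J Q : {finite_measure set T -> \bar R}) (f : T -> \bar R).
Hypothesis fd : gen_density J Q f.

(** A finite bound on [A] excludes the singular part, which lives where [f] is infinite. *)
Lemma gen_density_le A (t : R) : measurable A -> (forall z, A z -> f z <= t%:E) ->
  J A <= t%:E * Q A.
Proof.
have [mf f0 _ fE] := fd.
move=> mA At; rewrite fE// (_ : A `&` _ = set0) ?measure0 ?adde0; last first.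
  by apply/seteqP; split => // x [Ax /= fx]; have := At _ Ax; rewrite fx leye_eq.
rewrite -integral_cst//; apply: ge0_le_integral => //.
exact: measurable_funTS.
Qed.

Lemma gen_density_ge A (t : R) : measurable A -> (0 <= t)%R ->
  (forall z, A z -> t%:E <= f z) -> t%:E * Q A <= J A.
Proof.
have [mf f0 _ fE] := fd.
move=> mA t0 At; rewrite fE// -integral_cst//.
rewrite (@le_trans _ _ (\int[Q]_(z in A) f z))// ?leeDl//.
apply: ge0_le_integral => //.
exact: measurable_funTS.
Qed.

End density_bounds.

Section joint_measures.
Context {d1 d2} {X : measurableType d1} {Z : measurableType d2} {R : realType}.
Variables (k : R.-pker X ~> Z) (P : probability X R).

Definition jointm : giry (X * Z)%type R := semidirect (measurable_kgiry k) P.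

(** Presents the product law as a semidirect product with constant rows, so that it shares the
    lemmas of the joint law. *)
Definition kout_cst (x : X) : giry Z R := kout k P.

Lemma measurable_kout_cst : measurable_fun setT kout_cst.
Proof. exact: measurable_cst. Qed.

Definition prodm : giry (X * Z)%type R := semidirect measurable_kout_cst P.

Lemma jointmE (A : set (X * Z)) : measurable A -> jointm A = \int[P]_x k x (xsection A x).
Proof. exact: semidirectE. Qed.

Lemma prodmE (A : set (X * Z)) : measurable A -> prodm A = \int[P]_x kout k P (xsection A x).
Proof. exact: semidirectE. Qed.

Lemma measurable_kout_xsection (A : set (X * Z)) : measurable A ->
  measurable_fun setT (fun x => kout k P (xsection A x)).
Proof.
move=> mA; rewrite (_ : (fun x => _) = (fun x => graphm kout_cst x A)).
  exact: measurableT_comp (measurable_giry_ev mA) (measurable_graphm measurable_kout_cst).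
by apply/funext => x; rewrite graphmE.
Qed.

Lemma measurable_k_xsection (A : set (X * Z)) : measurable A ->
  measurable_fun setT (fun x => k x (xsection A x)).
Proof.
move=> mA; rewrite (_ : (fun x => _) = (fun x => graphm (kgiry k) x A)).
  exact: measurableT_comp (measurable_giry_ev mA) (measurable_graphm (measurable_kgiry k)).
by apply/funext => x; rewrite graphmE.
Qed.

Lemma integral_prodm (A : set (X * Z)) (h : X * Z -> \bar R) : measurable A -> measurable_fun setT h ->
  (forall z, 0 <= h z) ->
  \int[prodm]_(z in A) h z =
  \int[P]_x \int[P]_x' \int[k x']_(y in xsection A x) h (x, y).
Proof.
move=> mA mh h0; rewrite integral_mkcond integral_semidirect//; last 2 first.
  by apply/(measurable_restrictT _ _).1 => //; exact/measurable_funTS.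
  by move=> x; apply: erestrict_ge0.
apply: eq_integral => x _.
rewrite integral_kout//; last 2 first.
- apply: measurableT_comp (@pair1_measurable _ _ X Z x).
  by apply/(measurable_restrictT _ _).1 => //; exact/measurable_funTS.
- by move=> x'; apply: erestrict_ge0.
apply: eq_integral => x' _.
rewrite [RHS]integral_mkcond; apply: eq_integral => y _.
by rewrite !patchE mem_xsection.
Qed.

Lemma kout_setT : kout k P setT = 1.
Proof.
rewrite koutE//; under eq_integral do rewrite prob_kernel.
by rewrite integral_cst// mul1e; exact: probability_setT.
Qed.

Lemma jointm_setT : jointm setT = 1.
Proof.
rewrite jointmE//.
under eq_integral do rewrite xsectionE preimage_setT prob_kernel.
by rewrite integral_cst// mul1e; exact: probability_setT.
Qed.

Lemma prodm_setT : prodm setT = 1.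
Proof.
rewrite prodmE//.
under eq_integral do rewrite xsectionE preimage_setT kout_setT.
by rewrite integral_cst// mul1e; exact: probability_setT.
Qed.

Lemma jointmX (A : set X) (B : set Z) : measurable A -> measurable B ->
  jointm (A `*` B) = \int[P]_(x in A) k x B.
Proof.
move=> mA mB; rewrite jointmE; last exact: measurableX.
rewrite [RHS]integral_mkcond; apply: eq_integral => x _.
rewrite patchE; case: ifPn => xA; first by rewrite in_xsectionX.
by rewrite notin_xsectionX// measure0.
Qed.

Lemma prodmX (A : set X) (B : set Z) : measurable A -> measurable B ->
  prodm (A `*` B) = P A * kout k P B.
Proof.
move=> mA mB; rewrite prodmE; last exact: measurableX.
rewrite muleC -integral_cst// [RHS]integral_mkcond; apply: eq_integral => x _.
rewrite patchE; case: ifPn => xA; first by rewrite in_xsectionX.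
by rewrite notin_xsectionX// measure0.
Qed.

End joint_measures.

Section defs_bridge.
Context {R : realType} {dY : measure_display} {Y : measurableType dY}.
Variable W : channel R dY Y.
Implicit Type P : input_process R.

Lemma joint_jointm P n A : measurable A -> joint R dY Y W P n A = jointm (W n) (P n) A.
Proof. by move=> mA; rewrite jointmE. Qed.

Lemma outdist_kout n (Q : probability (n.-tuple R) R) B : measurable B ->
  outdist R dY Y W n Q B = kout (W n) Q B.
Proof. by move=> mB; rewrite koutE. Qed.

Lemma prod_intE P n A h : measurable A -> measurable_fun setT h -> (forall z, 0 <= h z) ->
  prod_int R dY Y W P n A h = \int[prodm (W n) (P n)]_(z in A) h z.
Proof. by move=> mA mh h0; rewrite integral_prodm. Qed.

Lemma measurable_eqy {d} {T : measurableType d} (f : T -> \bar R) :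
  measurable_fun setT f -> measurable [set z | f z = +oo].
Proof. by move=> mf; rewrite -[X in measurable X]setTI; exact: (mf measurableT [set +oo]). Qed.

Lemma info_densityP P n f :
  info_density R dY Y W P n f <-> gen_density (jointm (W n) (P n)) (prodm (W n) (P n)) f.
Proof.
have aux : measurable_fun setT f ->
  prod_int R dY Y W P n setT (fun z => (f z == +oo%E)%:R%:E) = prodm (W n) (P n) [set z | f z = +oo].
  move=> mf; have mN := measurable_eqy mf.
  have -> : (fun z => (f z == +oo%E)%:R%:E) = (fun z => (\1_[set z | f z = +oo%E] z)%:E : \bar R).
    apply/funext => z; rewrite indicE (_ : (z \in _) = (f z == +oo))//.
    by apply/idP/eqP; rewrite inE.
  rewrite prod_intE//; last exact/measurable_EFinP/measurable_indic.
  by rewrite integral_indic// setIT.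
split => -[mf f0 N0 fE]; split => //.
- exact: etrans (esym (aux mf)) N0.
- move=> A mA; rewrite -[LHS]joint_jointm// fE// prod_intE// joint_jointm//.
  by apply: measurableI => //; exact: measurable_eqy.
- exact: etrans (aux mf) N0.
- move=> A mA; rewrite joint_jointm// fE// prod_intE// joint_jointm//.
  by apply: measurableI => //; exact: measurable_eqy.
Qed.

Lemma exists_info_density P n : exists f, info_density R dY Y W P n f.
Proof.
have [f fd] := exists_gen_density (jointm (W n) (P n)) (prodm (W n) (P n)).
by exists f; apply/info_densityP.
Qed.

End defs_bridge.

(** * Feinstein's lemma *)

Section feinstein.
Context {d1 d2} {X : measurableType d1} {Z : measurableType d2} {R : realType}.
Variables (k : R.-pker X ~> Z) (P : probability X R).

(** First-moment selection inside a set of full measure; [G] is what keeps the selected codewords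
    within the cost constraint. *)
Lemma exists_lt_of_integral_lt (h : X -> \bar R) (G : set X) (c : R) :
  measurable_fun setT h -> (forall x, 0 <= h x) -> measurable G -> P G = 1 ->
  \int[P]_x h x < c%:E -> exists2 x, G x & h x < c%:E.
Proof.
move=> mh h0 mG PG hc; apply: contrapT => nex.
have : c%:E <= \int[P]_x h x.
  rewrite (@le_trans _ _ (\int[P]_(x in G) h x))//; last first.
    by apply: ge0_subset_integral.
  rewrite -[leLHS]mule1 -PG -integral_cst//; apply: ge0_le_integral => //.
  - move=> x _; rewrite lee_fin.
    have : 0 <= \int[P]_x h x by exact: integral_ge0.
    by move=> /le_lt_trans /(_ hc); rewrite lte_fin => /ltW.
  - exact: measurable_funTS.
  - move=> x Gx; rewrite leNgt; apply/negP => hx; apply: nex; by exists x.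
by rewrite leNgt hc.
Qed.

Lemma xsectionC (T1 T2 : Type) (A : set (T1 * T2)) x : xsection (~` A) x = ~` xsection A x.
Proof. by rewrite !xsectionE. Qed.

Lemma measurable_xsection_setC (A : set (X * Z)) : measurable A ->
  measurable_fun setT (fun x => k x (~` xsection A x)).
Proof.
move=> mA; under eq_fun do rewrite -xsectionC.
exact/measurable_k_xsection/measurableC.
Qed.

Variable f : X * Z -> \bar R.
Hypothesis fd : gen_density (jointm k P) (prodm k P) f.
Variables (t : R) (t0 : (0 < t)%R).

Let A := [set z | t%:E < f z].

Let mA : measurable A.
Proof.
have [mf _ _ _] := fd.
by rewrite -[A]setTI; exact: emeasurable_fun_o_infty.
Qed.

Let E := [set x | (2 / t)%:E <= kout k P (xsection A x)].

Let mE : measurable E.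
Proof.
rewrite -[E]setTI; apply: emeasurable_fun_c_infty => //.
exact: measurable_kout_xsection.
Qed.

(** Change of measure on the part of [A] above [E] gives t (2 / t) P(E) <= P(E). The factor 2 in the
    definition of [E] makes this 2 P(E) <= P(E), so [E] is exactly null and can be removed from [G]
    at no cost. *)
Let PE : P E = 0.
Proof.
have mA' : measurable (A `&` (E `*` setT)) by apply: measurableI => //; exact: measurableX.
have h1 : t%:E * prodm k P (A `&` (E `*` setT)) <= jointm k P (A `&` (E `*` setT)).
  by apply: (gen_density_ge fd) => //; [exact: ltW|move=> z [/ltW]].
have h2 : jointm k P (A `&` (E `*` setT)) <= P E.
  rewrite (@le_trans _ _ (jointm k P (E `*` setT)))//.
    by apply: le_measure; rewrite ?inE//; exact: measurableX.
  by rewrite jointmX//; under eq_integral do rewrite prob_kernel; rewrite integral_cst// mul1e.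
have h3 : (2 / t)%:E * P E <= prodm k P (A `&` (E `*` setT)).
  rewrite prodmE// -integral_cst// integral_mkcond.
  apply: ge0_le_integral => //.
  - by move=> x _; apply: erestrict_ge0 => y _; rewrite lee_fin divr_ge0// ltW.
  - by apply/(measurable_restrictT _ _).1.
  - exact: measurable_kout_xsection.
  - move=> x _; rewrite patchE; case: ifPn => xE; last exact: measure_ge0.
    by rewrite xsectionI in_xsectionX// setIT; move: xE; rewrite inE.
have PEfin : P E \is a fin_num by exact: fin_num_measure.
have : 2%:E * P E <= P E.
  apply: le_trans h2; apply: le_trans h1.
  rewrite (_ : 2%:E = t%:E * (2 / t)%:E); last first.
    by rewrite -EFinM mulrC divfK// gt_eqF.
  by rewrite -muleA; apply: lee_wpmul2l => //; rewrite lee_fin ltW.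
rewrite -(fineK PEfin) -EFinM lee_fin => h.
have h' : (0 <= fine (P E))%R by rewrite fine_ge0.
by apply/eqP; rewrite eqe eq_le h' andbT; lra.
Qed.

Let B x := xsection A x.

Let mB x : measurable (B x).
Proof. exact: measurable_xsection. Qed.

Let used (e : nat -> X) m : set Z := \big[setU/set0]_(j < m) B (e j).

Let m_used e m : measurable (used e m).
Proof. exact: bigsetU_measurable. Qed.

(* Feinstein's maximal-code argument: codewords are picked one at a time among the [x] whose
   section [B x] has small output probability, so the region already used stays small. *)
Lemma feinstein (G : set X) (M : nat) (c : R) :
  measurable G -> P G = 1 ->
  jointm k P [set z | f z <= t%:E] + (2 * M.-1%:R / t)%:E < c%:E ->
  exists (enc : nat -> X) (D : nat -> set Z),
    [/\ forall i, (i < M)%N -> G (enc i), forall i, measurable (D i),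
        trivIset setT D & forall i, (i < M)%N -> k (enc i) (~` D i) < c%:E].
Proof.
move=> mG PG hc.
have [e He] : exists e : nat -> X, forall i, (i < M)%N ->
    [/\ G (e i), ~ E (e i) & k (e i) (~` (B (e i) `\` used e i)) < c%:E].
  suff : forall m, (m <= M)%N -> exists e : nat -> X, forall i, (i < m)%N ->
    [/\ G (e i), ~ E (e i) & k (e i) (~` (B (e i) `\` used e i)) < c%:E].
    by move=> /(_ M (leqnn _)).
  elim=> [_|m ih mM]; first by exists (fun _ => point).
  have [e He] := ih (ltnW mM).
  have kU : kout k P (used e m) <= (2 * m%:R / t)%:E.
    rewrite (@le_trans _ _ (\sum_(j < m) kout k P (B (e j))))//.
      by apply: (@content_subadditive _ _ _ (kout k P) _ (B \o e)) => // j _; exact: mB.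
    rewrite (@le_trans _ _ (\sum_(j < m) (2 / t)%:E))//.
      apply: lee_sum => j _; have [_ nE _] := He j (ltn_ord j).
      by rewrite ltW// ltNge; apply/negP.
    by rewrite sumEFin lee_fin sumr_const card_ord -[leLHS]mulr_natr mulrAC.
  (* The average of this sum under [P] is the joint probability of f <= t plus the output
     probability of the region already used. At most [M.-1] sections precede a pick, each of output
     mass below 2 / t, so the average is below [c]. *)
  have [x [Gx nEx] hx] : exists2 x, (G `\` E) x & k x (~` B x) + k x (used e m) < c%:E.
    apply: exists_lt_of_integral_lt => //.
    - apply: emeasurable_funD; last exact: measurable_kernel.
      exact: measurable_xsection_setC.
    - by move=> x; rewrite adde_ge0.
    - exact: measurableD.
    - have -> : P (G `\` E) = P G - P (G `&` E).
        by apply: measureD => //; rewrite -ge0_fin_numE// fin_num_measure.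
      rewrite (_ : P (G `&` E) = 0) ?sube0//; apply/eqP.
      rewrite -measure_le0 -PE; apply: le_measure; rewrite ?inE//; exact: measurableI.
    - rewrite ge0_integralD//; last 2 first.
      + exact: measurable_xsection_setC.
      + exact: measurable_kernel.
      apply: le_lt_trans hc; apply: leeD.
        rewrite (_ : [set z | _] = ~` A).
          rewrite jointmE; last exact: measurableC.
          by under [leRHS]eq_integral do rewrite xsectionC.
        by apply/seteqP; split => z /=; rewrite /A /=; [rewrite leNgt => /negP|move=> /negP; rewrite -leNgt].
      rewrite -koutE// (le_trans kU)// lee_fin ler_pM2r ?invr_gt0//.
      by rewrite ler_pM2l// ler_nat -ltnS (ltn_predK mM).
  pose e' i := if (i < m)%N then e i else x.
  have used_e' i : (i <= m)%N -> used e' i = used e i.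
    move=> im; apply: eq_bigr => j _; rewrite /e' ifT//.
    exact: leq_trans im.
  exists e' => i; rewrite ltnS leq_eqVlt => /orP[/eqP ->|im].
    rewrite used_e'// /e' ltnn; split => //.
    apply: le_lt_trans hx; rewrite setCD.
    apply: measureU2 => //; exact: measurableC.
  by rewrite used_e' ?(ltnW im)// /e' im; exact: He.
exists e, (fun i => B (e i) `\` used e i); split.
- by move=> i /He[].
- by move=> i; exact: measurableD.
- apply: ltn_trivIset => j i ij; apply/seteqP; split => // y [[By _] [_ nU]].
  by apply: nU; rewrite /used -(bigcup_mkord j (B \o e)); exists i.
- by move=> i /He[].
Qed.

End feinstein.

(** * Limits superior and information spectra *)

Section limsup_near.
Context {R : realType}.
Implicit Types (u : nat -> \bar R) (l e : R).

Lemma limn_esup_le_near u l e : limn_esup u <= l%:E -> (0 < e)%R ->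
  \forall n \near \oo, u n <= (l + e)%:E.
Proof.
move=> ul e0.
have : limn_esup u < (l + e)%:E by rewrite (le_lt_trans ul)// lte_fin ltrDl.
rewrite /limn_esup limf_esupE => /ereal_inf_lt[_ [V FV <-] VS].
apply: filterS FV => n Vn; rewrite (le_trans _ (ltW VS))//.
by apply: ereal_sup_ubound; exists n.
Qed.

Lemma limn_esup_le_intro u l : (forall e, (0 < e)%R -> \forall n \near \oo, u n <= (l + e)%:E) ->
  limn_esup u <= l%:E.
Proof.
move=> h; apply/lee_addgt0Pr => e e0; rewrite -EFinD.
rewrite /limn_esup limf_esupE; apply: ereal_inf_le.
exists (ereal_sup (u @` [set n | u n <= (l + e)%:E])); first by exists [set n | u n <= (l + e)%:E] => //; exact: h.
by apply: ge_ereal_sup => _ [n /= un <-].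
Qed.

Lemma limn_einf_ge_near u l e : l%:E <= limn_einf u -> (0 < e)%R ->
  \forall n \near \oo, (l - e)%:E <= u n.
Proof.
rewrite /limn_einf leeNr -EFinN => ul e0.
have := limn_esup_le_near ul e0; apply: filterS => n.
by rewrite leeNl -EFinN opprD !opprK.
Qed.

Lemma limn_einf_ge_intro u l : (forall e, (0 < e)%R -> \forall n \near \oo, (l - e)%:E <= u n) ->
  l%:E <= limn_einf u.
Proof.
move=> h; rewrite /limn_einf leeNr -EFinN; apply: limn_esup_le_intro => e e0.
have := h _ e0; apply: filterS => n.
by rewrite leeNl -EFinN opprD !opprK.
Qed.

End limsup_near.

Section info_spec_lemmas.
Context {R : realType} {dY : measure_display} {Y : measurableType dY}.

(** Moves thresholds from the normalized logarithm to the density itself, including the values 0 and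
    [+oo] of [f], where [elog] takes infinite values. *)
Lemma info_spec_lt n (f : n.-tuple R * n.-tuple Y -> \bar R) z (a : R) : (0 < n)%N -> 0 <= f z ->
  (info_spec R dY Y n f z < a%:E) = (f z < (expR (n%:R * a))%:E).
Proof.
move=> n0; have n0' : (0 < n%:R :> R)%R by rewrite ltr0n.
rewrite /info_spec /elog; case: (f z) => [r| |] //; last first.
  by move=> _; rewrite gt0_muley ?lte_fin ?invr_gt0// !ltNge !leey.
rewrite lee_fin => r0; case: ifPn => [rp|].
  rewrite -EFinM !lte_fin mulrC ltr_pdivrMr// mulrC.
  by rewrite -[in RHS](lnK rp) ltr_expR.
rewrite -leNgt => rn; rewrite gt0_muleNy ?lte_fin ?invr_gt0//.
have -> : r = 0%R by apply/eqP; rewrite eq_le r0 rn.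
by rewrite ltNyr expR_gt0.
Qed.

Lemma info_spec_gt n (f : n.-tuple R * n.-tuple Y -> \bar R) z (a : R) : (0 < n)%N -> 0 <= f z ->
  (a%:E < info_spec R dY Y n f z) = ((expR (n%:R * a))%:E < f z).
Proof.
move=> n0; have n0' : (0 < n%:R :> R)%R by rewrite ltr0n.
rewrite /info_spec /elog; case: (f z) => [r| |] //; last first.
  by move=> _; rewrite gt0_muley ?lte_fin ?invr_gt0// !ltry.
rewrite lee_fin => r0; case: ifPn => [rp|].
  rewrite -EFinM !lte_fin [ltRHS]mulrC ltr_pdivlMr// mulrC.
  by rewrite -[in RHS](lnK rp) ltr_expR.
rewrite -leNgt => rn; rewrite gt0_muleNy ?lte_fin ?invr_gt0//.
by rewrite ltNge leNye [RHS]ltNge (le_trans rn (expR_ge0 _)).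
Qed.

Lemma info_spec_lt_set n (f : n.-tuple R * n.-tuple Y -> \bar R) (a : R) : (0 < n)%N -> (forall z, 0 <= f z) ->
  [set z | info_spec R dY Y n f z < a%:E] = [set z | f z < (expR (n%:R * a))%:E].
Proof. by move=> n0 f0; apply/seteqP; split => z /=; rewrite info_spec_lt. Qed.

Lemma info_spec_gt_set n (f : n.-tuple R * n.-tuple Y -> \bar R) (a : R) : (0 < n)%N -> (forall z, 0 <= f z) ->
  [set z | a%:E < info_spec R dY Y n f z] = [set z | (expR (n%:R * a))%:E < f z].
Proof. by move=> n0 f0; apply/seteqP; split => z /=; rewrite info_spec_gt. Qed.

End info_spec_lemmas.

(** * Finitely supported inputs *)

Section mixture.
Context {d} {T : measurableType d} {R : realType}.
Variables (m : nat) (x : nat -> T) (p : nat -> {nonneg R}).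

Definition mixture of (\sum_(i < m) (p i)%:num = 1 :> R)%R : set T -> \bar R :=
  msum (fun i => mscale (p i) \d_(x i)) m.

Hypothesis p1 : (\sum_(i < m) (p i)%:num = 1 :> R)%R.

HB.instance Definition _ := Measure.on (mixture p1).

Let mixture_setT : mixture p1 setT = 1.
Proof.
rewrite /mixture /msum/= /mscale/=.
under eq_bigr do rewrite diracT mule1.
by rewrite sumEFin p1.
Qed.

HB.instance Definition _ := Measure_isProbability.Build _ _ _ (mixture p1) mixture_setT.

Lemma integral_mixture (h : T -> \bar R) : measurable_fun setT h -> (forall z, 0 <= h z) ->
  \int[mixture p1]_z h z = \sum_(i < m) (p i)%:num%:E * h (x i).
Proof.
move=> mh h0; rewrite /mixture ge0_integral_measure_sum//.
apply: eq_bigr => i _; rewrite ge0_integral_mscale// integral_dirac// diracT mul1e//.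
Qed.

End mixture.

Lemma exists_mixture {d} {T : measurableType d} {R : realType} m (x : 'I_m -> T) (p : 'I_m -> R) :
  (forall i, (0 <= p i)%R) -> (\sum_i p i = 1)%R ->
  exists Q : probability T R, forall h : T -> \bar R, measurable_fun setT h ->
    (forall z, 0 <= h z) -> \int[Q]_z h z = \sum_(i < m) (p i)%:E * h (x i).
Proof.
case: m x p => [|m] x p p0 p1; first by move: p1; rewrite big_ord0 => /esym/eqP; rewrite oner_eq0.
pose p' j : {nonneg R} := NngNum (p0 (inord j)).
have p'1 : (\sum_(i < m.+1) (p' i)%:num = 1 :> R)%R.
  by rewrite -p1; apply: eq_bigr => i _ /=; rewrite inord_val.
exists (mixture (x \o inord) p'1) => h mh h0; rewrite integral_mixture//.
by apply: eq_bigr => i _ /=; rewrite inord_val.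
Qed.

Lemma mixture_measure {d} {T : measurableType d} {R : realType} m (x : 'I_m -> T) (p : 'I_m -> R)
    (Q : probability T R) :
  (forall h : T -> \bar R, measurable_fun setT h ->
    (forall z, 0 <= h z) -> \int[Q]_z h z = \sum_(i < m) (p i)%:E * h (x i)) ->
  forall A, measurable A -> Q A = \sum_(i < m) (p i)%:E * (\1_A (x i))%:E.
Proof.
move=> QE A mA; transitivity (\int[Q]_z (\1_A z)%:E).
  by rewrite integral_indic// setIT.
apply: (QE (fun z => (\1_A z)%:E)); last by move=> z; rewrite lee_fin.
exact/measurable_EFinP/measurable_indic.
Qed.

Lemma measurable_tuple_set1 {R : realType} n (x : n.-tuple R) : measurable [set x].
Proof.
rewrite (_ : [set x] = \bigcap_(i in [set: 'I_n]) ((fun y : n.-tuple R => tnth y i) @^-1` [set tnth x i])).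
  apply: fin_bigcap_measurable => // i _; rewrite -[X in measurable X]setTI.
  exact: measurable_tnth.
apply/seteqP; split => y /=; first by move=> ->.
by move=> h; apply: eq_from_tnth => i; exact: h.
Qed.

Section mixture_in_set.
Context {R : realType} (n m : nat) (x : 'I_m -> n.-tuple R) (p : 'I_m -> R).
Variable Q : probability (n.-tuple R) R.
Hypothesis p0 : forall i, (0 <= p i)%R.
Hypothesis p1 : (\sum_i p i = 1)%R.
Hypothesis QE : forall h : n.-tuple R -> \bar R, measurable_fun setT h ->
    (forall z, 0 <= h z) -> \int[Q]_z h z = \sum_(i < m) (p i)%:E * h (x i).

(** The finite set of atoms serves as the measurable subset of full mass, whatever the regularity of
    [A]. *)
Lemma mixture_full_on (A : set (n.-tuple R)) : (forall i, A (x i)) -> full_on R n Q A.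
Proof.
move=> Ax; have mB : measurable (\bigcup_(i in [set: 'I_m]) [set x i]).
  by apply: fin_bigcup_measurable => // i _; exact: measurable_tuple_set1.
exists (\bigcup_(i in [set: 'I_m]) [set x i]); split => //.
- by move=> y [i _ ->].
- rewrite (mixture_measure QE)//.
  under eq_bigr => i _.
    by rewrite indicE mem_set ?mule1; [over|exists i].
  by rewrite sumEFin p1.
Qed.

(** Only an inequality, since the points [x i] may repeat. *)
Lemma mixture_atom i : (p i)%:E <= Q [set x i].
Proof.
rewrite (mixture_measure QE); last exact: measurable_tuple_set1.
rewrite (bigD1 i)//= indicE mem_set//= mule1 leeDl// sume_ge0// => j _.
by rewrite mule_ge0// lee_fin.
Qed.

End mixture_in_set.

(** * Transmission codes *)

Section asymptotics.
Context {R : realType}.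

Lemma near_expR_le (d e : R) : (d < 0)%R -> (0 < e)%R -> \forall n \near \oo, (expR (n%:R * d) <= e)%R.
Proof.
move=> d0 e0; near=> n; rewrite -[leRHS]lnK// ler_expR -ler_ndivrMr//.
by near: n; exact: nbhs_infty_ger.
Unshelve. all: by end_near. Qed.

Lemma near_inv_le (e : R) : (0 < e)%R -> \forall n \near \oo, (n%:R^-1 <= e :> R)%R.
Proof.
move=> e0; near=> n; rewrite -[leRHS]invrK lef_pV2 ?posrE ?invr_gt0//.
  by near: n; exact: nbhs_infty_ger.
by rewrite ltr0n; near: n; exact: nbhs_infty_gt.
Unshelve. all: by end_near. Qed.

Lemma cvg0_near (u : nat -> \bar R) (e : R) : u @ \oo --> 0 -> (0 < e)%R ->
  \forall n \near \oo, u n <= e%:E.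
Proof.
move=> u0 e0; have /fine_cvgP[ufin u0'] : u @ \oo --> (0%R)%:E by exact: u0.
have h := cvgr_le _ u0' _ e0.
near=> n; have un : u n \is a fin_num by near: n.
by rewrite -(fineK un) lee_fin; near: n; exact: h.
Unshelve. all: by end_near. Qed.

Lemma near_cvg0 (u : nat -> \bar R) : (forall n, 0 <= u n) ->
  (forall e, (0 < e)%R -> \forall n \near \oo, u n <= e%:E) -> u @ \oo --> 0.
Proof.
move=> u0 h; apply/fine_cvgP; split.
  by have := h 1%R ltr01; apply: filterS => n un; rewrite ge0_fin_numE// (le_lt_trans un)// ltry.
apply/cvgrPdist_le => e e0; have := h e e0; apply: filterS => n un.
rewrite sub0r normrN ger0_norm ?fine_ge0//.
by rewrite -lee_fin fineK// ge0_fin_numE// (le_lt_trans un)// ltry.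
Qed.

(** The successor makes the size positive and at least e^{na}, while its predecessor, the number
    that enters Feinstein's bound, is at most e^{na}. *)
Definition csize (a : R) (n : nat) : nat := (Num.truncn (expR (n%:R * a))).+1.

Lemma csize_ge a n : (expR (n%:R * a) <= (csize a n)%:R)%R.
Proof. by rewrite ltW// truncnS_gt. Qed.

Lemma csize_pred_le a n : ((csize a n).-1%:R <= expR (n%:R * a))%R.
Proof. by rewrite /csize /= truncn_le// expR_ge0. Qed.

Lemma trate_csize a n : (0 < n)%N -> (a <= trate R (csize a) n)%R.
Proof.
move=> n0; have n0' : (0 < n%:R :> R)%R by rewrite ltr0n.
rewrite /trate mulrC ler_pdivlMr// mulrC -[leLHS]expRK.
by rewrite ler_ln ?posrE ?expR_gt0 ?ltr0n ?csize_ge.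
Qed.

End asymptotics.

Section coding.
Context {R : realType} {dY : measure_display} {Y : measurableType dY}.
Variables (W : channel R dY Y) (c : forall n : nat, n.-tuple R -> R) (Gamma : R).

Local Notation J := (joint R dY Y W).
Local Notation ispec := (info_spec R dY Y).
Local Notation cset := (cost_set R c Gamma).

Lemma channel_fin n x B : measurable B -> W n x B \is a fin_num.
Proof. by move=> mB; apply: (fin_num_measure (kprob (W n) x)). Qed.

Lemma feinstein_code n (P : input_process R) f (b e : R) M : (0 < n)%N ->
  full_on R n (P n) (cset n) -> info_density R dY Y W P n f -> (0 < e)%R ->
  exists (enc : 'I_M.+1 -> n.-tuple R) (dec : n.-tuple Y -> 'I_M.+1),
    [/\ forall i, cset n (enc i), forall i, measurable (dec @^-1` [set i]) &
     forall i, W n (enc i) (~` (dec @^-1` [set i])) <=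
       J P n [set z | ispec n f z <= b%:E] + (2 * M%:R / expR (n%:R * b) + e)%:E].
Proof.
move=> n0 [G [mG Gc PG]] /[dup] fI /info_densityP fd e0.
have [mf f0 _ _] := fd.
pose S := [set z | ispec n f z <= b%:E].
have SE : S = [set z | f z <= (expR (n%:R * b))%:E].
  by apply/seteqP; split => z; rewrite /S /= !leNgt info_spec_gt.
have mS : measurable [set z | f z <= (expR (n%:R * b))%:E].
  by rewrite -[X in measurable X]setTI; exact: emeasurable_fun_infty_c.
have Jfin : J P n S \is a fin_num.
  by rewrite SE joint_jointm// fin_num_measure.
have [|enc [D [encG mD tD encE]]] := @feinstein _ _ _ _ _ (W n) (P n) f fd _ (expR_gt0 (n%:R * b)) G M.+1
  (fine (J P n S) + (2 * M%:R / expR (n%:R * b) + e))%R mG PG.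
  by rewrite -joint_jointm// -SE -[in X in X < _](fineK Jfin) -EFinD lte_fin ltrD2l ltrDl.
(* Outputs outside every [D i] are decoded as [ord0]. Every other message thus keeps exactly its
   region, and the region of [ord0] only grows, which cannot increase its error. *)
pose dec y : 'I_M.+1 := odflt ord0 [pick i : 'I_M.+1 | y \in D i].
have decP (i : 'I_M.+1) y : D i y -> dec y = i.
  move=> Dy; rewrite /dec; case: pickP => [j /=|/(_ i)]; last by rewrite mem_set.
  rewrite inE => Djy; apply/val_inj/(tD j i) => //.
  by exists y.
have decD (i : 'I_M.+1) : i != ord0 -> dec @^-1` [set i] = D i.
  move=> i0; apply/seteqP; split => y /=; last exact: decP.
  rewrite /dec; case: pickP => [j /= + <-|_ /= i0']; first by rewrite inE.
  by rewrite -i0' eqxx in i0.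
have mdec i : measurable (dec @^-1` [set i]).
  have [->|/decD ->//] := eqVneq i ord0.
  rewrite (_ : _ @^-1` _ = ~` (\bigcup_(j in [set j : 'I_M.+1 | j != ord0]) D j)).
    by apply: measurableC; exact: fin_bigcup_measurable.
  apply/seteqP; split => y /=.
    by move=> dy [j /= j0 /decP]; rewrite dy => /esym/eqP; rewrite (negbTE j0).
  move=> nD; apply/eqP; apply: contrapT => /negP d0; apply: nD.
  by exists (dec y) => //; rewrite -decD.
exists (enc \o val), dec; split => //.
- by move=> i; exact: Gc _ (encG _ (ltn_ord i)).
- move=> i; rewrite -(fineK Jfin) -EFinD; apply/ltW.
  apply: le_lt_trans (encE i (ltn_ord i)).
  apply: le_measure; rewrite ?inE.
  + exact: measurableC.
  + exact: measurableC.
  + by apply: subsetC => y; exact: decP.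
Qed.

End coding.

Lemma pmuleI {R : realDomainType} (p a b : \bar R) : p \is a fin_num -> 0 < p ->
  p * a = p * b -> a = b.
Proof.
by move=> pf p0 pab; apply/eqP; rewrite eq_le -(lee_pmul2l pf p0 a b) -(lee_pmul2l pf p0 b a) pab lexx.
Qed.

(** * Densities at atoms of the input *)

Section atoms.
Context {d1 d2} {X : measurableType d1} {Z : measurableType d2} {R : realType}.
Variables (k : R.-pker X ~> Z) (P : probability X R) (f : X * Z -> \bar R).
Hypothesis fd : gen_density (jointm k P) (prodm k P) f.
Variable x : X.
Hypotheses (mx : measurable [set x]) (Px : 0 < P [set x]).

Let jointm_atom B : measurable B -> jointm k P ([set x] `*` B) = P [set x] * k x B.
Proof.
move=> mB; rewrite jointmX// (eq_integral (cst (k x B))); last first.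
  by move=> z; rewrite inE /= => ->.
by rewrite integral_cst// muleC.
Qed.

Let Pfin : P [set x] \is a fin_num.
Proof. exact: fin_num_measure. Qed.

Lemma atom_le B (t : R) : measurable B -> (0 <= t)%R -> (forall y, B y -> f (x, y) <= t%:E) ->
  k x B <= t%:E * kout k P B.
Proof.
move=> mB t0 Bt; rewrite -(@lee_pmul2l _ (P [set x]))//.
rewrite -jointm_atom// muleCA -prodmX//.
apply: (gen_density_le fd); first exact: measurableX.
by move=> [z y] /= [-> By]; exact: Bt.
Qed.

(** Testing the decomposition of the joint law on rectangles above the single point [x] and dividing
    by its positive mass gives an identity at [x] itself, not just at almost every input. *)
Lemma atom_density B : measurable B ->
  k x B = \int[kout k P]_(y in B) f (x, y) + k x (B `&` [set y | f (x, y) = +oo]).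
Proof.
have [mf f0 _ fE] := fd.
move=> mB; have mA : measurable ([set x] `*` B) by exact: measurableX.
have mfx : measurable_fun setT (fun y => f (x, y)).
  exact: measurableT_comp mf (@pair1_measurable _ _ X Z x).
have mN := measurable_eqy mfx.
have : P [set x] * k x B = P [set x] * (\int[kout k P]_(y in B) f (x, y) + k x (B `&` [set y | f (x, y) = +oo])).
  rewrite -jointm_atom// fE//.
  rewrite ge0_muleDr//; last exact: integral_ge0.
  congr (_ + _).
    rewrite integral_mkcond integral_semidirect//; last 2 first.
      by apply/(measurable_restrictT _ _).1 => //; exact/measurable_funTS.
      by move=> z; apply: erestrict_ge0.
    transitivity (\int[P]_(x' in [set x]) \int[kout k P]_(y in B) f (x, y)).
      rewrite [RHS]integral_mkcond; apply: eq_integral => x' _.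
      rewrite patchE; case: ifPn; rewrite ?inE ?notin_setE /=.
        move=> ->; rewrite [RHS]integral_mkcond; apply: eq_integral => y _.
        by rewrite !patchE in_setX/= mem_set.
      move=> xx'; apply: integral0_eq => y _; rewrite patchE memNset// => -[].
      by [].
    by rewrite integral_cst// muleC.
  rewrite -jointm_atom//; last exact: measurableI.
  congr (jointm k P _); apply/seteqP; split => -[z y] /=.
    by move=> [[-> By] fy].
  by move=> [-> [By fy]].
exact: pmuleI.
Qed.

End atoms.

Section coding_theorems.
Context {R : realType} {dY : measure_display} {Y : measurableType dY}.
Variables (W : channel R dY Y) (c : forall n : nat, n.-tuple R -> R) (Gamma : R).

Local Notation J := (joint R dY Y W).
Local Notation ispec := (info_spec R dY Y).
Local Notation cset := (cost_set R c Gamma).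
Local Notation Cs := (Cs R dY Y W c Gamma).
Local Notation tcodes := (tcodes R dY Y c Gamma).
Local Notation terr := (terr R dY Y W).

(** Here [a] is the rate and [b] the threshold on the information spectrum. The exponential term
    vanishes when a < b, and [n%:R^-1] is the slack that replaces the strict inequality of
    Feinstein's lemma. *)
Lemma feinstein_codes P f a b : in_S_Gamma R c Gamma P ->
  (forall n, info_density R dY Y W P n (f n)) ->
  exists (enc : forall n, 'I_(csize a n) -> n.-tuple R) (dec : forall n, n.-tuple Y -> 'I_(csize a n)),
  tcodes (csize a) enc dec /\
  forall n, (0 < n)%N -> forall i, W n (enc n i) (~` (dec n @^-1` [set i])) <=
    J P n [set z | ispec n (f n) z <= b%:E] + (2 * expR (n%:R * (a - b)) + n%:R^-1)%:E.
Proof.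
move=> PS fI.
have H n : exists ed : ('I_(csize a n) -> n.-tuple R) * (n.-tuple Y -> 'I_(csize a n)),
  (0 < n)%N -> [/\ forall i, cset n (ed.1 i), forall i, measurable (ed.2 @^-1` [set i]) &
   forall i, W n (ed.1 i) (~` (ed.2 @^-1` [set i])) <=
    J P n [set z | ispec n (f n) z <= b%:E] + (2 * expR (n%:R * (a - b)) + n%:R^-1)%:E].
  have [n0|n0] := posnP n; first by exists (fun=> point, fun=> ord0); rewrite n0.
  have ni : (0 < n%:R^-1 :> R)%R by rewrite invr_gt0 ltr0n.
  have [enc [dec [h1 h2 h3]]] := feinstein_code b (csize a n).-1 n0 (PS n n0) (fI n) ni.
  exists (enc, dec) => _; split => // i; apply: (le_trans (h3 i)).
  rewrite leeD2l// lee_fin lerD2r -mulrA ler_pM2l//.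
  by rewrite mulrBr expRB ler_pM2r ?invr_gt0 ?expR_gt0// csize_pred_le.
exists (fun n => (sval (cid (H n))).1), (fun n => (sval (cid (H n))).2).
split=> n n0; case: cid => /= -[enc dec] /(_ n0)[h1 h2 h3] //; split.
Qed.

Lemma terr_le M enc dec n (e : R) : (0 < M n)%N ->
  (forall i, measurable (dec n @^-1` [set i])) ->
  (forall i, W n (enc n i) (~` (dec n @^-1` [set i])) <= e%:E) -> (terr M enc dec n <= e)%R.
Proof.
move=> M0 md h; rewrite /Defs.terr mulrC ler_pdivrMr ?ltr0n//.
rewrite (@le_trans _ _ (\sum_(i < M n) e)%R)//.
  apply: ler_sum => i _; rewrite -lee_fin fineK ?h//.
  by apply: channel_fin; exact: measurableC.
by rewrite sumr_const card_ord mulr_natr.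
Qed.

Lemma Cs_mono (e e' : R) : (e <= e')%R -> Cs e <= Cs e'.
Proof.
move=> ee'; apply: le_ereal_sup => _ [r [M [enc [dec [h1 h2 h3]]]] <-].
exists r => //; exists M, enc, dec; split => //.
by rewrite (le_trans h2)// lee_fin.
Qed.

Lemma measurable_info_le P n f (b : R) : (0 < n)%N -> info_density R dY Y W P n f ->
  measurable [set z | ispec n f z <= b%:E].
Proof.
move=> n0 [mf f0 _ _].
rewrite (_ : [set z | _] = [set z | f z <= (expR (n%:R * b))%:E]).
  by rewrite -[X in measurable X]setTI; exact: emeasurable_fun_infty_c.
by apply/seteqP; split => z /=; rewrite !leNgt info_spec_gt.
Qed.

Lemma measurable_info_lt P n f (b : R) : (0 < n)%N -> info_density R dY Y W P n f ->
  measurable [set z | ispec n f z < b%:E].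
Proof.
move=> n0 [mf f0 _ _]; rewrite info_spec_lt_set//.
by rewrite -[X in measurable X]setTI; exact: emeasurable_fun_infty_o.
Qed.

Lemma measurable_info_gt P n f (b : R) : (0 < n)%N -> info_density R dY Y W P n f ->
  measurable [set z | b%:E < ispec n f z].
Proof.
move=> n0 [mf f0 _ _]; rewrite info_spec_gt_set//.
by rewrite -[X in measurable X]setTI; exact: emeasurable_fun_o_infty.
Qed.

Lemma joint_le P n A B : measurable A -> measurable B -> A `<=` B -> J P n A <= J P n B.
Proof. by move=> mA mB AB; rewrite !joint_jointm//; apply: le_measure; rewrite ?inE. Qed.

Lemma exists_info_densities P :
  exists f : forall n, n.-tuple R * n.-tuple Y -> \bar R, forall n, info_density R dY Y W P n (f n).
Proof. by exists (fun n => sval (cid (exists_info_density W P n))) => n; case: cid. Qed.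

Lemma good_codes P (a r : R) : in_S_Gamma R c Gamma P ->
  (r < a)%R ->
  (forall f, (forall n, info_density R dY Y W P n (f n)) ->
      (fun n => J P n [set z | ispec n (f n) z < a%:E]) @ \oo --> 0) ->
  exists (enc : forall n, 'I_(csize r n) -> n.-tuple R) (dec : forall n, n.-tuple Y -> 'I_(csize r n)),
   tcodes (csize r) enc dec /\
   forall e, (0 < e)%R -> \forall n \near \oo, forall i,
     W n (enc n i) (~` (dec n @^-1` [set i])) <= e%:E.
Proof.
move=> PS ra ha; have [f fI] := exists_info_densities P.
(* A threshold above [r] makes the exponential term vanish; below [a], it keeps the spectral event
   inside the one that [ha] controls. *)
pose b := ((r + a) / 2)%R.
have rb : (r < b)%R by rewrite /b; lra.
have ba : (b < a)%R by rewrite /b; lra.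
have [enc [dec [tc he]]] := feinstein_codes r b PS fI.
exists enc, dec; split => // e' e0.
have e3 : (0 < e' / 3)%R by lra.
have e6 : (0 < e' / 6)%R by lra.
have rb0 : (r - b < 0)%R by lra.
have h1 := cvg0_near (ha _ fI) e3.
have h2 := near_expR_le rb0 e6.
have h3 := near_inv_le e3.
near=> n => i.
have n0 : (0 < n)%N by near: n; exact: nbhs_infty_gt.
apply: (le_trans (he n n0 i)).
apply: (@le_trans _ _ ((e' / 3)%:E + (2 * (e' / 6) + e' / 3)%:E)); last first.
  by rewrite -EFinD lee_fin; lra.
apply: leeD.
  apply: (@le_trans _ _ (J P n [set z | ispec n (f n) z < a%:E])); last by near: n.
  apply: joint_le.
  - exact: measurable_info_le (fI n).
  - exact: measurable_info_lt (fI n).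
  - by move=> z /= /le_lt_trans; apply; rewrite lte_fin.
rewrite lee_fin lerD// ?ler_pM2l//; by near: n.
Unshelve. all: by end_near. Qed.

Lemma sup_I_low_le_Cs : sup_I_low R dY Y W c Gamma <= Cs 0.
Proof.
apply: ge_ereal_sup => _ [P PS <-]; apply: ge_ereal_sup => _ [a ha <-].
apply/lee_subgt0Pr => e e0; rewrite -EFinB.
apply: ereal_sup_ubound; exists (a - e)%R => //.
have ae : (a - e < a)%R by lra.
have [enc [dec [tc he]]] := good_codes PS ae ha.
exists (csize (a - e)), enc, dec; split => //.
- apply: limn_esup_le_intro => e' e0'; rewrite add0r.
  have := he _ e0'; move=> h; near=> n.
  have n0 : (0 < n)%N by near: n; exact: nbhs_infty_gt.
  have [M0 _ mD] := tc n n0.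
  rewrite lee_fin; apply: terr_le => //.
  by near: n.
- apply: limn_einf_ge_intro => e' e0'; near=> n.
  have n0 : (0 < n)%N by near: n; exact: nbhs_infty_gt.
  rewrite lee_fin (le_trans _ (trate_csize _ n0))//; lra.
Unshelve. all: by end_near. Qed.

End coding_theorems.

Lemma lt_EFin_between {R : realType} (x y : \bar R) : x < y -> exists r : R, x < r%:E < y.
Proof.
case: x y => [x| |] [y| |] //=; rewrite ?lte_fin.
- by move=> xy; exists ((x + y) / 2)%R; rewrite !lte_fin; apply/andP; split; lra.
- by move=> _; exists (x + 1)%R; rewrite lte_fin ltrDl ltr01 ltry.
- by move=> _; exists (y - 1)%R; rewrite lte_fin ltNyr/= ltrBlDr ltrDl ltr01.
- by move=> _; exists 0%R; rewrite ltNyr ltry.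
Qed.

(** * Consequences of the strong converse *)

Section coding_converse.
Context {R : realType} {dY : measure_display} {Y : measurableType dY}.
Variables (W : channel R dY Y) (c : forall n : nat, n.-tuple R -> R) (Gamma : R).

Local Notation J := (joint R dY Y W).
Local Notation ispec := (info_spec R dY Y).
Local Notation cset := (cost_set R c Gamma).
Local Notation Cs := (Cs R dY Y W c Gamma).
Local Notation tcodes := (tcodes R dY Y c Gamma).
Local Notation terr := (terr R dY Y W).

Lemma limn_einf_trate_csize (a : R) : a%:E <= limn_einf (fun n => (trate R (csize a) n)%:E).
Proof.
apply: limn_einf_ge_intro => e' e0'; near=> n.
have n0 : (0 < n)%N by near: n; exact: nbhs_infty_gt.
rewrite lee_fin (le_trans _ (trate_csize _ n0))//; lra.
Unshelve. all: by end_near. Qed.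

Hypothesis sc : strong_converse R dY Y W c Gamma.

Lemma Cs_le_Cs0 (e : R) : (e < 1)%R -> Cs e <= Cs 0.
Proof.
move=> e1; apply: ge_ereal_sup => _ [r [M [enc [dec [tc he hr]]]] <-].
rewrite leNgt; apply/negP => C0r.
have cv : terr M enc dec n @[n --> \oo] --> (1 : R)%R.
  by apply: sc => //; exact: lt_le_trans hr.
have e'0 : (0 < (1 - e) / 4)%R by lra.
have e2 : ((1 + e) / 2 < 1)%R by lra.
have h1 := limn_esup_le_near he e'0.
have h2 := cvgr_gt _ cv _ e2.
near \oo => n.
have : (terr M enc dec n <= e + (1 - e) / 4)%R by rewrite -lee_fin; near: n.
have : ((1 + e) / 2 < terr M enc dec n)%R by near: n; exact: h2.
lra.
Unshelve. all: by end_near. Qed.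

Lemma jointm_compl n (P : input_process R) f b : (0 < n)%N -> info_density R dY Y W P n f ->
  J P n [set z | ispec n f z <= b%:E] + J P n [set z | b%:E < ispec n f z] = 1.
Proof.
move=> n0 fI.
have m1 := measurable_info_le b n0 fI; have m2 := measurable_info_gt b n0 fI.
rewrite !joint_jointm// -(jointm_setT (W n) (P n)) -measureU//.
  congr (jointm _ _ _); apply/seteqP; split => // z _ /=.
  by have [|] := leP (ispec n f z) b%:E; [left|right].
by apply/seteqP; split => // z [/= h]; rewrite ltNge h.
Qed.

(** For Cs(0) < r < b, Feinstein codes of rate [r] have error tending to 1, yet this error is at
    most the probability of the spectrum lying at or below [b], up to o(1). That probability
    therefore tends to 1, which makes [b] an admissible value in the infimum defining [I_up]. *)
Lemma sup_I_up_le_Cs : sup_I_up R dY Y W c Gamma <= Cs 0.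
Proof.
apply: ge_ereal_sup => _ [P PS <-]; rewrite leNgt; apply/negP => /lt_EFin_between[b /andP[Cb]].
apply/negP; rewrite -leNgt; apply: ereal_inf_lbound; exists b => //= f fI.
have [r /andP[Cr rb]] := lt_EFin_between Cb; rewrite lte_fin in rb.
have [enc [dec [tc he]]] := feinstein_codes r b PS fI.
have cv : terr (csize r) enc dec n @[n --> \oo] --> (1 : R)%R.
  by apply: sc => //; exact: lt_le_trans Cr (limn_einf_trate_csize r).
apply: near_cvg0 => [n|e e0]; first exact: integral_ge0.
have e3 : (0 < e / 3)%R by lra.
have e6 : (0 < e / 6)%R by lra.
have rb0 : (r - b < 0)%R by lra.
have e31 : (1 - e / 3 < 1)%R by lra.
have h1 := cvgr_ge _ cv _ e31.
have h2 := near_expR_le rb0 e6.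
have h3 := near_inv_le e3.
near=> n.
have n0 : (0 < n)%N by near: n; exact: nbhs_infty_gt.
have [M0 _ mD] := tc n n0.
have := jointm_compl b n0 (fI n).
set q := J P n [set z | b%:E < _]; set p := J P n [set z | _ <= b%:E] => pq1.
have qfin : q \is a fin_num by rewrite /q joint_jointm ?fin_num_measure//; exact: measurable_info_gt (fI n).
have pfin : p \is a fin_num by rewrite /p joint_jointm ?fin_num_measure//; exact: measurable_info_le (fI n).
have pq : (fine p + fine q = 1)%R by apply: EFin_inj; rewrite EFinD !fineK.
have : (terr (csize r) enc dec n <= fine p + (2 * expR (n%:R * (r - b)) + n%:R^-1))%R.
  apply: terr_le => // i; rewrite EFinD fineK//; exact: he.
have H1 : (1 - e / 3 <= terr (csize r) enc dec n)%R by near: n; exact: h1.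
have H2 : (expR (n%:R * (r - b)) <= e / 6)%R by near: n.
have H3 : (n%:R^-1 <= e / 3)%R by near: n.
rewrite -(fineK qfin) lee_fin; lra.
Unshelve. all: by end_near. Qed.

End coding_converse.

(** * The Verdu-Han converse *)

Section verdu_han.
Context {R : realType} {dY : measure_display} {Y : measurableType dY}.
Variables (W : channel R dY Y) (c : forall n : nat, n.-tuple R -> R) (Gamma : R).

Local Notation J := (joint R dY Y W).
Local Notation ispec := (info_spec R dY Y).

(* Verdu-Han: for [P] uniform on the codewords, an error-free decoding of [x] with
   [f (x, y) <= t] costs [W x (D_x) <= t * P_Y (D_x)], and the [P_Y (D_x)] sum to one. *)
Lemma verdu_han n (M : nat) (enc : 'I_M -> n.-tuple R) (dec : n.-tuple Y -> 'I_M)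
  (P : input_process R) f (t e : R) (S : set (n.-tuple R * n.-tuple Y)) : (0 < M)%N ->
  (forall i, measurable (dec @^-1` [set i])) ->
  (forall h : n.-tuple R -> \bar R, measurable_fun setT h ->
    (forall z, 0 <= h z) -> \int[P n]_z h z = \sum_(i < M) (M%:R^-1)%:E * h (enc i)) ->
  info_density R dY Y W P n f -> (0 <= t)%R -> measurable S ->
  (forall z, S z -> f z <= t%:E) ->
  (M%:R^-1 * \sum_(i < M) fine (W n (enc i) (~` (dec @^-1` [set i]))) <= e)%R ->
  J P n S <= (e + t / M%:R)%:E.
Proof.
move=> M0 mD PE /info_densityP fd t0 mS St he.
have Mi : (0 < M%:R^-1 :> R)%R by rewrite invr_gt0 ltr0n.
have mSx x : measurable (xsection S x) by exact: measurable_xsection.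
rewrite joint_jointm// jointmE// PE; last 2 first.
- exact: measurable_k_xsection.
- by move=> z; exact: measure_ge0.
have p1 : (\sum_(i < M) M%:R^-1 = 1 :> R)%R.
  by rewrite sumr_const card_ord -(@mulr_natr R) mulVf// pnatr_eq0 -lt0n.
have step i : W n (enc i) (xsection S (enc i)) <=
    W n (enc i) (~` (dec @^-1` [set i])) + t%:E * kout (W n) (P n) (dec @^-1` [set i]).
  rewrite (@le_trans _ _ (W n (enc i) (~` (dec @^-1` [set i]) `|` (xsection S (enc i) `&` dec @^-1` [set i]))))//.
    apply: le_measure; rewrite ?inE//.
    - by apply: measurableU; [exact: measurableC|exact: measurableI].
    - move=> y Sy; have [di|di] := pselect (dec y = i); [by right|by left].
  apply: (@le_trans _ _ (W n (enc i) (~` (dec @^-1` [set i])) + W n (enc i) (xsection S (enc i) `&` dec @^-1` [set i]))).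
    by apply: measureU2; [exact: measurableC|exact: measurableI].
  apply: leeD2l.
  apply: (@le_trans _ _ (t%:E * kout (W n) (P n) (xsection S (enc i) `&` dec @^-1` [set i]))).
    apply: (atom_le fd) => //.
    - exact: measurable_tuple_set1.
    - apply: lt_le_trans (@mixture_atom _ _ _ enc (fun=> M%:R^-1)%R (P n) _ PE i).
        by rewrite lte_fin.
      by move=> ?; exact: ltW.
    - exact: measurableI.
    - by move=> y [/=]; rewrite /xsection /= inE => /St.
  apply: lee_wpmul2l; first by rewrite lee_fin.
  by apply: le_measure; rewrite ?inE//; exact: measurableI.
apply: (@le_trans _ _ (\sum_(i < M) (M%:R^-1)%:E *
   (W n (enc i) (~` (dec @^-1` [set i])) + t%:E * kout (W n) (P n) (dec @^-1` [set i])))).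
  by apply: lee_sum => i _; apply: lee_wpmul2l => //; rewrite lee_fin ltW.
rewrite -ge0_sume_distrr//; last first.
  by move=> i _; rewrite adde_ge0// mule_ge0// lee_fin.
rewrite big_split/= -ge0_sume_distrr; last first.
  by move=> i _; exact: (measure_ge0 (kout (W n) (P n))).
have -> : \sum_(i < M) kout (W n) (P n) (dec @^-1` [set i]) = 1.
  have bigT : \big[setU/set0]_(i < M) (dec @^-1` [set i]) = setT.
    apply/seteqP; split => // y _; rewrite -bigcup_seq.
    by exists (dec y) => //=; rewrite mem_index_enum.
  rewrite -(kout_setT (W n) (P n)) -bigT measure_semi_additive_ord//; last by rewrite bigT.
  by move=> i j _ _ [y [/= <- <-]].
rewrite mule1.
have -> : \sum_(i < M) W n (enc i) (~` (dec @^-1` [set i])) =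
   (\sum_(i < M) fine (W n (enc i) (~` (dec @^-1` [set i]))))%:E.
  rewrite -sumEFin; apply: eq_bigr => i _; rewrite fineK//.
  by apply: channel_fin; exact: measurableC.
by rewrite -EFinD -EFinM lee_fin mulrDr lerD// mulrC.
Qed.

Lemma Cs_le_sup_I_low : Cs R dY Y W c Gamma 0 <= sup_I_low R dY Y W c Gamma.
Proof.
apply: ge_ereal_sup => _ [r [M [enc [dec [tc he hr]]]] <-].
apply/lee_subgt0Pr => e e0; rewrite -EFinB.
have H n : exists Q : probability (n.-tuple R) R, (0 < n)%N ->
    forall h : n.-tuple R -> \bar R, measurable_fun setT h ->
    (forall z, 0 <= h z) -> \int[Q]_z h z = \sum_(i < M n) ((M n)%:R^-1)%:E * h (enc n i).
  have [n0|n0] := posnP n.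
    by exists (dirac point : probability _ _); rewrite n0.
  have [M0 _ _] := tc n n0.
  have p0 (i : 'I_(M n)) : (0 <= (M n)%:R^-1 :> R)%R by rewrite invr_ge0.
  have p1 : (\sum_(i < M n) (M n)%:R^-1 = 1 :> R)%R.
    by rewrite sumr_const card_ord -(@mulr_natr R) mulVf// pnatr_eq0 -lt0n.
  by have [Q QE] := exists_mixture (enc n) p0 p1; exists Q.
pose P : input_process R := fun n => sval (cid (H n)).
have PE n : (0 < n)%N -> forall h : n.-tuple R -> \bar R, measurable_fun setT h ->
    (forall z, 0 <= h z) -> \int[P n]_z h z = \sum_(i < M n) ((M n)%:R^-1)%:E * h (enc n i).
  by rewrite /P; case: cid.
have PS : in_S_Gamma R c Gamma P.
  move=> n n0; have [M0 ec _] := tc n n0.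
  apply: (mixture_full_on _ (PE n n0)) => //.
  by rewrite sumr_const card_ord -(@mulr_natr R) mulVf// pnatr_eq0 -lt0n.
apply: (@le_trans _ _ (I_low R dY Y W P)); last by apply: ereal_sup_ubound; exists P.
(* The code rate is eventually at least r - e/2, so a threshold at r - e leaves the factor e^{-ne/2}
   in the Verdu-Han bound. *)
apply: ereal_sup_ubound; exists (r - e)%R => //= f fI.
apply: near_cvg0 => [n|e' e'0]; first exact: integral_ge0.
have e2 : (0 < e / 2)%R by lra.
have e'2 : (0 < e' / 4)%R by lra.
have e'3 : (0 < e' / 2)%R by lra.
have e2N : (- (e / 2) < 0)%R by lra.
have h1 := limn_esup_le_near he e'2.
have h2 := limn_einf_ge_near hr e2.
have h3 := near_expR_le e2N e'3.
near=> n.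
have n0 : (0 < n)%N by near: n; exact: nbhs_infty_gt.
have [M0 _ mD] := tc n n0.
have [mf f0 _ _] := fI n.
apply: (@le_trans _ _ (e' / 4 + expR (n%:R * (r - e)) / (M n)%:R)%:E).
  apply: (verdu_han _ _ (PE n n0) (fI n)) => //; first exact: measurable_info_lt (fI n).
    by move=> z /=; rewrite info_spec_lt// => /ltW.
  rewrite -lee_fin.
  have : (terr R dY Y W M enc dec n)%:E <= (0 + e' / 4)%:E by near: n.
  by rewrite add0r.
rewrite lee_fin.
have Mge : (expR (n%:R * (r - e / 2)) <= (M n)%:R)%R.
  have : (r - e / 2 <= trate R M n)%R by rewrite -lee_fin; near: n; exact: h2.
  rewrite /trate [leRHS]mulrC ler_pdivlMr ?ltr0n// [leLHS]mulrC => h.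
  by rewrite -[leRHS]lnK ?posrE ?ltr0n// ler_expR.
have : (expR (n%:R * (r - e)) / (M n)%:R <= e' / 2)%R.
  apply: (@le_trans _ _ (expR (n%:R * (r - e)) / expR (n%:R * (r - e / 2))))%R.
    by rewrite ler_pM2l ?expR_gt0// lef_pV2 ?posrE ?expR_gt0 ?ltr0n.
  rewrite -expRB -mulrBr (_ : (r - e - (r - e / 2) = - (e / 2))%R); last by lra.
  by near: n.
lra.
Unshelve. all: by end_near. Qed.

End verdu_han.

(** * Divergence and the smoothness of the channel *)

(** Only the smaller function is assumed integrable, because the integral of the log-density on the
    other side may be [+oo]. *)
Lemma le_integral_integrablel {d} {T : measurableType d} {R : realType} (mu : {measure set T -> \bar R})
    (f g : T -> \bar R) : mu.-integrable setT f -> measurable_fun setT g ->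
  (forall x, f x <= g x) -> \int[mu]_x f x <= \int[mu]_x g x.
Proof.
move=> intf mg fg; have mf := measurable_int _ intf.
rewrite integralE [leRHS]integralE; apply: leeB.
- apply: ge0_le_integral => //.
  + exact: measurable_funepos.
  + exact: measurable_funepos.
  + by move=> x _; apply: (@funepos_le _ _ setT) => [y _|]; rewrite ?inE.
- apply: ge0_le_integral => //.
  + exact: measurable_funeneg.
  + exact: measurable_funeneg.
  + by move=> x _; apply: (@funeneg_le _ _ setT) => [y _|]; rewrite ?inE.
Qed.

(** Follows from exp(-s) >= 1 - s > 0 and (1 - s)(1 + s + 2 s^2) = 1 + s^2 (1 - 2 s) >= 1. *)
Lemma expR_le_quad {R : realType} (s : R) : (- 1 / 2 <= s)%R -> (s <= 1 / 2)%R ->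
  (expR s <= 1 + s + 2 * s ^+ 2)%R.
Proof.
move=> s1 s2; have h := expR_ge1Dx (- s).
have e0 : (0 < 1 + - s)%R by lra.
have q0 : (0 < 1 + s + 2 * s ^+ 2)%R by have := sqr_ge0 s; lra.
suff : ((1 + s + 2 * s ^+ 2)^-1 <= expR (- s))%R.
  by rewrite expRN lef_pV2 ?posrE ?expR_gt0.
apply: le_trans h; rewrite -div1r ler_pdivrMr//.
have : (0 <= s ^+ 2 * (1 - 2 * s))%R by rewrite mulr_ge0 ?sqr_ge0//; lra.
suff -> : ((1 + - s) * (1 + s + 2 * s ^+ 2) = 1 + s ^+ 2 * (1 - 2 * s))%R by lra.
ring.
Qed.

Lemma integral_step {d} {T : measurableType d} {R : realType} (mu : {measure set T -> \bar R})
    (A B : set T) (a : R) : measurable A -> measurable B -> (0 <= a)%R ->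
  \int[mu]_y (a * \1_A y + \1_B y)%:E = a%:E * mu A + mu B.
Proof.
move=> mA mB a0.
have mEA : measurable_fun setT (fun y => (\1_A y)%:E : \bar R).
  exact/measurable_EFinP/measurable_indic.
have mEB : measurable_fun setT (fun y => (\1_B y)%:E : \bar R).
  exact/measurable_EFinP/measurable_indic.
have A0 y : setT y -> 0 <= (\1_A y : R)%:E by rewrite lee_fin.
have B0 y : setT y -> 0 <= (\1_B y : R)%:E by rewrite lee_fin.
have aA0 y : setT y -> 0 <= a%:E * (\1_A y : R)%:E by rewrite -EFinM lee_fin mulr_ge0.
under eq_integral do rewrite EFinD EFinM.
rewrite (ge0_integralD mu measurableT aA0 (measurable_funeM _ mEA) B0 mEB).
by rewrite (ge0_integralZl_EFin mu measurableT A0 mEA a0) !integral_indic// !setIT.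
Qed.

Section pinsker.
Context {d} {T : measurableType d} {R : realType}.
Variables (p q : probability T R).

(* [ln g >= h + 1 - exp h / g] with [h = s 1_B], integrated against [p]. *)
Lemma integral_ln_ge (g : T -> R) (B : set T) (s : R) : is_RN_deriv R d T p q g -> measurable B ->
  (-1 <= s)%R ->
  (s * fine (p B) - fine (q B) * (expR s - 1))%:E <= \int[p]_y (ln (g y))%:E.
Proof.
move=> [mg g0 pE] mB s1.
(* Where [g] vanishes, which is a null set for [p], the conventions ln 0 = 0 and 1 / 0 = 0 apply;
   cutting the comparison functions to [G] makes both sides zero there. *)
pose G := [set y | g y != 0%R].
have mG : measurable G.
  rewrite (_ : G = ~` (g @^-1` [set 0%R])).
    by apply: measurableC; rewrite -[X in measurable X]setTI; exact: mg.
  by apply/seteqP; split => y /= /eqP.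
have mGC : measurable (~` G) by exact: measurableC.
have pG : p (~` G) = 0.
  by rewrite pE// integral0_eq// => y /= /negP; rewrite negbK => /eqP ->.
have pI A : measurable A -> p (A `&` G) = p A.
  move=> mA; have -> : p A = p (A `\` G) + p (A `&` G) by exact: measureDI.
  rewrite (_ : p (A `\` G) = 0) ?add0e//; apply/eqP.
  rewrite -measure_le0 -pG; apply: le_measure; rewrite ?inE//.
  exact: measurableD.
(* On [G], [u] is h + 1 and [k] is exp h. Thus u - w is the minorant of ln g, and the integral of
   [w] against [p] becomes that of [k] against [q]. *)
pose u y : R := ((1 + s) * \1_(B `&` G) y + \1_(~` B `&` G) y)%R.
pose k y : R := (expR s * \1_(B `&` G) y + \1_(~` B `&` G) y)%R.
pose w y : R := (k y * (g y)^-1)%R.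
have mBG : measurable (B `&` G) by exact: measurableI.
have mBCG : measurable (~` B `&` G) by apply: measurableI => //; exact: measurableC.
have mu_ : measurable_fun setT u.
  by apply: measurable_funD; [apply: measurable_funM|] => //; exact: measurable_indic.
have mk : measurable_fun setT k.
  by apply: measurable_funD; [apply: measurable_funM|] => //; exact: measurable_indic.
have mginv : measurable_fun setT (fun x => (g x)^-1)%R.
  rewrite (_ : (fun x => _) = (fun x => g x `^ (-1))%R); last first.
    by apply/funext => x; rewrite powR_inv1.
  exact: measurableT_comp (measurable_powR _) mg.
have mw : measurable_fun setT w by exact: measurable_funM.
have u0 y : (0 <= u y)%R by rewrite /u addr_ge0 ?mulr_ge0//; lra.
have k0 y : (0 <= k y)%R by rewrite /k addr_ge0 ?mulr_ge0 ?expR_ge0.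
have w0 y : (0 <= w y)%R by rewrite /w mulr_ge0 ?invr_ge0.
have pfin A : measurable A -> p A = (fine (p A))%:E by move=> mA; rewrite fineK// fin_num_measure.
have qfin A : measurable A -> q A = (fine (q A))%:E by move=> mA; rewrite fineK// fin_num_measure.
have fC (r : probability T R) : fine (r (~` B)) = (1 - fine (r B))%R.
  rewrite probability_setC// fineB ?fin_num_measure//.
have iu : \int[p]_y (u y)%:E = (1 + s * fine (p B))%:E.
  transitivity ((1 + s)%:E * p B + p (~` B)).
    rewrite integral_step//; last by lra.
    by congr (_ * _ + _); apply: pI => //; exact: measurableC.
  rewrite (pfin B)// (pfin (~` B)); last exact: measurableC.
  by rewrite fC -EFinM -EFinD; congr EFin; ring.
have ik : \int[q]_y (k y)%:E <= (1 + fine (q B) * (expR s - 1))%:E.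
  rewrite integral_step ?expR_ge0//.
  apply: (@le_trans _ _ ((expR s)%:E * q B + q (~` B))).
    apply: leeD.
      apply: lee_wpmul2l; first by rewrite lee_fin expR_ge0.
      by apply: le_measure; rewrite ?inE.
    by apply: le_measure; rewrite ?inE//; exact: measurableC.
  rewrite (qfin B)// (qfin (~` B)); last exact: measurableC.
  by rewrite fC -EFinM -EFinD lee_fin le_eqVlt; apply/orP; left; apply/eqP; ring.
have iw : \int[p]_y (w y)%:E = \int[q]_y (k y)%:E.
  transitivity (\int[q]_y ((w y)%:E * (g y)%:E)).
    by apply: (ge0_integral_density mg g0 pE) => [|y]; [exact/measurable_EFinP|rewrite lee_fin].
  apply: eq_integral => y _; rewrite -EFinM /w; congr EFin.
  have [gy|gy] := eqVneq (g y) 0%R; last by rewrite -mulrA mulVf// mulr1.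
  rewrite gy mulr0 /k !indicE !memNset ?mulr0 ?addr0// => -[_]; rewrite /G /= gy eqxx//.
have intu : p.-integrable setT (EFin \o u).
  apply/integrableP; split; first exact/measurable_EFinP.
  under eq_integral do rewrite /= ger0_norm//.
  by rewrite iu ltry.
have intw : p.-integrable setT (EFin \o w).
  apply/integrableP; split; first exact/measurable_EFinP.
  under eq_integral do rewrite /= ger0_norm//.
  by rewrite iw (le_lt_trans ik)// ltry.
apply: (@le_trans _ _ (\int[p]_y ((u y)%:E - (w y)%:E))).
  rewrite integralB_EFin// iu iw.
  have kfin : \int[q]_y (k y)%:E \is a fin_num.
    by rewrite ge0_fin_numE ?(le_lt_trans ik) ?ltry//; apply: integral_ge0 => y _; rewrite lee_fin.
  by move: ik; rewrite -(fineK kfin) !lee_fin; lra.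
apply: le_integral_integrablel.
- exact: integrableB.
- exact/measurable_EFinP/measurableT_comp.
move=> y; rewrite -EFinB lee_fin /u /w /k !indicE.
have [gy|gy] := eqVneq (g y) 0%R.
  have ny A : (y \in A `&` G) = false by apply: memNset => -[_]; rewrite /G /= gy eqxx.
  by rewrite !ny gy !mulr0 !addr0 mul0r subr0 ln0.
have gp : (0 < g y)%R by rewrite lt_neqAle eq_sym gy g0.
have key h : (h + 1 - expR h / g y <= ln (g y))%R.
  have := expR_ge1Dx (h - ln (g y)); rewrite expRB lnK ?posrE//; lra.
have yG : y \in G by rewrite inE.
rewrite !in_setI in_setC yG !andbT; case: (y \in B) => /=.
  by rewrite !mulr1 !addr0 addrC; have := key s; lra.
by rewrite !mulr0 !add0r mul1r; have := key 0%R; rewrite expR0 div1r; lra.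
Qed.

(** A form of Pinsker's inequality on one event. With a = p(B) and b = q(B), the previous bound is
    at least s (a - b) - 2 s^2; s = (a - b) / 4 maximizes this and stays in the range of the
    quadratic bound for exp. *)
Lemma KL_ge (B : set T) : measurable B ->
  ((fine (p B) - fine (q B)) ^+ 2 / 8)%:E <= KL R d T p q.
Proof.
move=> mB; apply: le_ereal_inf_tmp => _ [g gRN <-].
have fin01 (r : probability T R) : (0 <= fine (r B) <= 1)%R.
  rewrite fine_ge0// -lee_fin fineK ?fin_num_measure//; exact: probability_le1.
have /andP[p0 p1] := fin01 p; have /andP[q0 q1] := fin01 q.
set a := fine (p B) in p0 p1 *; set b := fine (q B) in q0 q1 *.
have s1 : (-1 <= (a - b) / 4)%R by lra.
apply: le_trans (integral_ln_ge gRN mB s1); rewrite -/a -/b lee_fin.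
have h : (expR ((a - b) / 4) <= 1 + (a - b) / 4 + 2 * ((a - b) / 4) ^+ 2)%R.
  by apply: expR_le_quad; lra.
have h2 : (b * (expR ((a - b) / 4) - 1) <= b * ((a - b) / 4) + 2 * ((a - b) / 4) ^+ 2)%R.
  rewrite (@le_trans _ _ (b * ((a - b) / 4 + 2 * ((a - b) / 4) ^+ 2))%R)//.
    by rewrite ler_wpM2l//; lra.
  by rewrite mulrDr lerD2l ler_piMl// mulr_ge0// sqr_ge0.
have -> : ((a - b) ^+ 2 / 8 = (a - b) / 4 * a - (b * ((a - b) / 4) + 2 * ((a - b) / 4) ^+ 2))%R by field.
lra.
Qed.

Lemma KL_ge0 : 0 <= KL R d T p q.
Proof.
by apply: le_trans (KL_ge measurable0); rewrite lee_fin divr_ge0// sqr_ge0.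
Qed.

End pinsker.

Lemma KL_refl {d} {T : measurableType d} {R : realType} (p : probability T R) : KL R d T p p = 0.
Proof.
apply/eqP; rewrite eq_le KL_ge0 andbT.
apply: ereal_inf_lbound; exists (cst 1%R) => /=.
  by split => // A mA; rewrite -[LHS]mul1e -integral_cst.
by rewrite ln1 integral0_eq.
Qed.

Local Open Scope ring_scope.

Section second_order.
Context {R : realType} {n : nat}.
Variables (g : 'rV[R]_n -> R) (X u : 'rV[R]_n).
Hypotheses (g0 : forall v, 0 <= g v) (gX : g X = 0).
Hypothesis dg : \forall v \near X, differentiable g v.
Hypothesis d2g : forall j, differentiable (fun w => 'D_(unitv R n j) g w) X.

Let H : 'M[R]_n := \matrix_(i, j) 'D_(unitv R n i) (fun w => 'D_(unitv R n j) g w) X.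

Let line (t : R) : 'rV[R]_n := t *: u + X.

(** The derivative of [g] along [u], written through the partial derivatives because those are what
    [d2g] makes differentiable. *)
Let Phi (w : 'rV[R]_n) : R := \sum_(j < n) u ord0 j * 'D_(unitv R n j) g w.

Lemma derive_row_expand (f : 'rV[R]_n -> R) (w v : 'rV[R]_n) : differentiable f w ->
  'D_v f w = \sum_(j < n) v ord0 j * 'D_(unitv R n j) f w.
Proof.
move=> df; rewrite deriveE// [in LHS](row_sum_delta v) linear_sum.
by apply: eq_bigr => j _; rewrite linearZ/= deriveE.
Qed.

Let is_derive_line t : differentiable g (line t) ->
  is_derive t 1 (g \o line) (Phi (line t)).
Proof.
move=> df; have dd : derivable g (line t) u by exact: diff_derivable.
have E : (fun h : R => h^-1 *: (((g \o line) \o shift t) (h *: (1 : R)) - (g \o line) t)) =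
    (fun h : R => h^-1 *: ((g \o shift (line t)) (h *: u) - g (line t))).
  apply/funext => h /=; congr (_ *: (g _ - _)).
  by rewrite /line scalerDl addrA [h *: 1]mulr1.
split; first by rewrite /derivable E.
by rewrite /derive E -/(derive g (line t) u) derive_row_expand.
Qed.

Let line_cvg : line t @[t --> (0:R)] --> X.
Proof.
have -> : X = line 0 by rewrite /line scale0r add0r.
apply: cvgD; last exact: cvg_cst.
exact: (@scalel_continuous _ _ u 0).
Qed.

Let near_line : \forall t \near (0:R), differentiable g (line t).
Proof. exact: (line_cvg dg). Qed.

Let quad_formE : \sum_(j < n) u ord0 j * 'D_u (fun w => 'D_(unitv R n j) g w) X =
  (u *m H *m u^T) ord0 ord0.
Proof.
rewrite mxE; apply: eq_bigr => j _.
rewrite derive_row_expand// !mxE mulrC; congr (_ * _).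
by apply: eq_bigr => i _; rewrite mxE.
Qed.

Let is_derive_Phi : is_derive X u Phi ((u *m H *m u^T) ord0 ord0).
Proof.
rewrite -quad_formE.
have -> : Phi = \sum_(j < n) (u ord0 j \*: (fun w => 'D_(unitv R n j) g w)).
  by apply/funext => w; rewrite fct_sumE.
have h j : is_derive X u (u ord0 j \*: (fun w => 'D_(unitv R n j) g w))
    (u ord0 j *: 'D_u (fun w => 'D_(unitv R n j) g w) X).
  by apply: is_deriveZ; apply: derivableP; exact: diff_derivable.
exact: is_derive_sum h.
Qed.

(** The point [X] minimizes [g], so the first-order term vanishes and the Hessian governs growth
    along the ray. *)
Lemma second_order_bound (L : R) : 0 <= L -> (u *m H *m u^T) ord0 ord0 < L ->
  exists2 rho : R, 0 < rho & forall t, 0 <= t < rho -> g (t *: u + X) <= L * t ^+ 2.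
Proof.
move=> L0 HL.
have [r1 /= r10 hr1] := near_line.
have PhiX : Phi X = 0.
  have dP t : t \in `](- r1), r1[ -> derivable (g \o line) t 1.
    rewrite in_itv /= -ltr_norml => tr.
    have [] : is_derive t 1 (g \o line) (Phi (line t)) => //.
    by apply: is_derive_line; apply: hr1 => /=; rewrite sub0r normrN.
  have c0 : 0 \in `](- r1), r1[ by rewrite in_itv /= oppr_lt0 r10.
  have l0 : line 0 = X by rewrite /line scale0r add0r.
  have [_ d0] : is_derive (0:R) 1 (g \o line) 0.
    apply: (@derive1_at_min _ _ (- r1) r1) => //; first by lra.
    by move=> t _ /=; rewrite l0 gX.
  have [_ d1] : is_derive (0:R) 1 (g \o line) (Phi (line 0)).
    by apply: is_derive_line; apply: hr1 => /=; rewrite subrr normr0.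
  by rewrite -l0 -d1 d0.
have [Pd Pv] := is_derive_Phi.
have cv : h^-1 *: ((Phi \o shift X) (h *: u) - Phi X) @[h --> 0^'] --> (u *m H *m u^T) ord0 ord0.
  by rewrite -Pv; exact: Pd.
have [r2 /= r20 hr2] := cvgr_lt _ cv _ HL.
exists (Num.min r1 r2); first by rewrite lt_min r10 r20.
move=> t /andP[t0]; rewrite lt_min => /andP[tr1 tr2].
have [->|tn0] := eqVneq t 0; first by rewrite scale0r add0r gX expr0n mulr0.
have tp : 0 < t by rewrite lt_neqAle eq_sym tn0.
have dl s : s \in `]0, t[ -> is_derive s 1 (g \o line) (Phi (line s)).
  rewrite in_itv /= => /andP[s0 st]; apply: is_derive_line; apply: hr1 => /=.
  by rewrite sub0r normrN gtr0_norm// (lt_trans st).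
(* Second derivatives exist at [X] only, so Taylor's formula is replaced by the mean value theorem
   for [g] and the difference quotient of [Phi] at [X]: g = t Phi(s) <= t s L <= L t^2. *)
have [|s] := MVT tp dl.
  apply: derivable_within_continuous => s; rewrite in_itv/= => /andP[s0 st].
  have [] : is_derive s 1 (g \o line) (Phi (line s)) => //.
  apply: is_derive_line; apply: hr1 => /=.
  by rewrite sub0r normrN ger0_norm// (le_lt_trans st).
rewrite in_itv /= subr0 /line scale0r add0r gX subr0 => /andP[s0 st] ->.
have : s^-1 *: ((Phi \o shift X) (s *: u) - Phi X) < L.
  apply: hr2 => /=; last by rewrite gt_eqF.
  by rewrite sub0r normrN gtr0_norm// (lt_trans st).
rewrite PhiX subr0 /= /GRing.scale/= mulrC ltr_pdivrMr// => h.
by rewrite expr2 mulrA ler_pM2r// (le_trans (ltW h))// ler_wpM2l// ltW.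
Qed.

End second_order.

(** The radius depends on the point without uniformity, so the argument is real induction: the
    supremum of the [t] satisfying the bound satisfies it too, and could be increased if it were
    below 1. *)
Lemma local_lipschitz_global {R : realType} (F : R -> R) (C : R) :
  (forall t, 0 <= t <= 1 -> exists2 rho, 0 < rho & forall h, `|h| < rho -> `|F (t + h) - F t| <= C * `|h|) ->
  `|F 1 - F 0| <= C.
Proof.
move=> loc.
pose S := [set t : R | 0 <= t <= 1 /\ `|F t - F 0| <= C * t].
have S0 : S 0 by split; [lra|rewrite subrr normr0 mulr0].
have Ssup : has_sup S by split; [exists 0|exists 1 => t [/andP[]]].
have sup0 : 0 <= sup S by apply: ub_le_sup => //; exact: Ssup.2.
have sup1 : sup S <= 1 by apply: ge_sup => [|t [/andP[]]]; [exact: Ssup.1|].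
have [rho rho0 hrho] := loc (sup S) (introT andP (conj sup0 sup1)).
have Ssups : S (sup S).
  split; first exact/andP.
  have [t St tsup] := sup_adherent rho0 Ssup.
  have ts : t <= sup S by apply: ub_le_sup => //; exact: Ssup.2.
  have [_ Ft] := St.
  have := hrho (t - sup S); rewrite ler0_norm; last by lra.
  move=> /(_ ltac:(lra)); rewrite (addrC (sup S) (t - _)) subrK distrC => h.
  have := ler_normD (F (sup S) - F t) (F t - F 0).
  rewrite addrA subrK; lra.
have [s1|s1] := eqVneq (sup S) 1.
  by have [_] := Ssups; rewrite s1 mulr1.
have slt : sup S < 1 by rewrite lt_neqAle s1.
pose d := Num.min (rho / 2) (1 - sup S).
have d0 : 0 < d by rewrite lt_min; apply/andP; split; lra.
have d1 : d <= rho / 2 by rewrite ge_min lexx.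
have d2 : d <= 1 - sup S by rewrite ge_min lexx orbT.
have Sd : S (sup S + d).
  split; first by lra.
  have := hrho d; rewrite gtr0_norm// => /(_ ltac:(lra)) h.
  have [_ h2] := Ssups.
  have := ler_normD (F (sup S + d) - F (sup S)) (F (sup S) - F 0).
  rewrite addrA subrK; lra.
have : sup S + d <= sup S by apply: ub_le_sup => //; exact: Ssup.2.
lra.
Qed.

Section channel_lipschitz.
Context {R : realType} {dY : measure_display} {Y : measurableType dY}.
Variables (W : channel R dY Y) (n : nat) (a : n.-tuple R) (l K : R).
Hypothesis n0 : (0 < n)%N.
Hypothesis K0 : 0 <= K.
Hypothesis td : forall x, KL_twice_diff R dY Y W n x.
Hypothesis HK : forall x, cube R n a l x -> (mxnorm_rq R n (hessian R dY Y W n x) <= K%:E)%E.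

Lemma t2rvK : cancel (t2rv R n) (rv2t R n).
Proof. by move=> x; apply: eq_from_tnth => i; rewrite tnth_mktuple mxE. Qed.

Lemma rv2tK : cancel (rv2t R n) (t2rv R n).
Proof. by move=> v; apply/rowP => i; rewrite mxE tnth_mktuple. Qed.

Lemma rv_sqE (u : 'rV[R]_n) : (u *m u^T) ord0 ord0 = \sum_i (u ord0 i) ^+ 2.
Proof. by rewrite mxE; apply: eq_bigr => i _; rewrite mxE expr2. Qed.

Lemma hessian_le x (u : 'rV[R]_n) : cube R n a l x ->
  (u *m hessian R dY Y W n x *m u^T) ord0 ord0 <= K * (u *m u^T) ord0 ord0.
Proof.
move=> cx; have [->|u0] := eqVneq u 0; first by rewrite !mul0mx mxE mulr0.
have : 0 < (u *m u^T) ord0 ord0.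
  rewrite rv_sqE lt_neqAle eq_sym sumr_ge0 ?andbT; last by move=> i _; exact: sqr_ge0.
  apply: contra u0 => /eqP s0; apply/eqP/rowP => i; rewrite mxE.
  have u2 : u ord0 i ^+ 2 = 0 by apply: (psumr_eq0P _ s0) => // j _; exact: sqr_ge0.
  by apply/eqP; rewrite -sqrf_eq0; exact/eqP.
move=> up; rewrite -ler_pdivrMr// -lee_fin; apply: le_trans (HK cx).
by apply: ereal_sup_ubound; exists u.
Qed.

Lemma KLfun_refl x : KLfun R dY Y W n x (t2rv R n x) = 0%E.
Proof. by rewrite /KLfun t2rvK; exact: (KL_refl (kprob (W n) x)). Qed.

Lemma KLfun_ge x v B : measurable B ->
  (((fine (W n (rv2t R n v) B) - fine (W n x B)) ^+ 2 / 8)%:E <= KLfun R dY Y W n x v)%E.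
Proof. exact: (@KL_ge _ _ _ (kprob (W n) (rv2t R n v)) (kprob (W n) x)). Qed.

(** Pinsker converts the quadratic bound on the divergence into a linear bound on differences of
    probabilities. Unlike divergence, these obey the triangle inequality and can be summed along a
    segment. The one-sided expansion is used for [u] and for [- u]. *)
Lemma channel_local_lipschitz x (u : 'rV[R]_n) (L : R) B : cube R n a l x -> 0 <= L ->
  K * (u *m u^T) ord0 ord0 < L -> measurable B ->
  exists2 rho, 0 < rho & forall h, `|h| < rho ->
    `|fine (W n (rv2t R n (h *: u + t2rv R n x)) B) - fine (W n x B)| <= Num.sqrt (8 * L) * `|h|.
Proof.
move=> cx L0 KL mB.
pose g v := fine (KLfun R dY Y W n x v).
have [kfin dg d2g] := td x.
have g0 v : 0 <= g v by apply: fine_ge0; exact: (KL_ge0 (kprob (W n) _) (kprob (W n) x)).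
have gX : g (t2rv R n x) = 0 by rewrite /g KLfun_refl.
have h1 := le_lt_trans (hessian_le u cx) KL.
have h2 : ((- u) *m hessian R dY Y W n x *m (- u)^T) ord0 ord0 < L.
  by apply: le_lt_trans KL; rewrite (le_trans (hessian_le _ cx))// !linearN/= mulNmx opprK.
have [r1 r10 H1] := second_order_bound g0 gX dg d2g L0 h1.
have [r2 r20 H2] := second_order_bound g0 gX dg d2g L0 h2.
have lc : h *: u + t2rv R n x @[h --> (0:R)] --> t2rv R n x.
  rewrite -[X in _ --> X]add0r; apply: cvgD; last exact: cvg_cst.
  by rewrite -[X in _ --> X](scale0r u); exact: (@scalel_continuous _ _ u 0).
(* Since [fine] sends [+oo] to 0, a bound on [g] controls the divergence only where the latter is
   finite. *)
have [r3 /= r30 H3] : \forall h \near (0:R), KLfun R dY Y W n x (h *: u + t2rv R n x) \is a fin_num.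
  exact: (lc _ kfin).
exists (Num.min r1 (Num.min r2 r3)); first by rewrite !lt_min r10 r20 r30.
move=> h; rewrite !lt_min => /andP[hr1 /andP[hr2 hr3]].
have gh : g (h *: u + t2rv R n x) <= L * h ^+ 2.
  have [hp|hn] := leP 0 h; first by apply: H1; rewrite hp -(ger0_norm hp).
  rewrite -[h *: u]opprK -scaleNr -scalerN -sqrrN.
  by apply: H2; rewrite -(ltr0_norm hn) normr_ge0.
have fh : KLfun R dY Y W n x (h *: u + t2rv R n x) \is a fin_num.
  by apply: H3 => /=; rewrite sub0r normrN.
have := KLfun_ge x (h *: u + t2rv R n x) mB.
rewrite -(fineK fh) lee_fin -/(g _) => D.
rewrite -(@ler_pXn2r _ 2)// ?nnegrE ?mulr_ge0 ?sqrtr_ge0//.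
rewrite exprMn sqr_sqrtr ?mulr_ge0// !real_normK ?num_real//.
lra.
Qed.

(** Convexity of the cube: the Hessian bound is available along the whole segment, although its
    inner points may violate the cost constraint. *)
Lemma cube_segment x x' t : cube R n a l x -> cube R n a l x' -> 0 <= t <= 1 ->
  cube R n a l (rv2t R n (t *: (t2rv R n x' - t2rv R n x) + t2rv R n x)).
Proof.
move=> cx cx' /andP[t0 t1] i; rewrite tnth_mktuple !mxE.
have /andP[x1 x2] := cx i; have /andP[y1 y2] := cx' i.
have h1 : 0 <= t * (tnth x' i - tnth a i) by rewrite mulr_ge0//; lra.
have h2 : 0 <= (1 - t) * (tnth x i - tnth a i) by rewrite mulr_ge0//; lra.
have h3 : 0 <= t * (tnth a i + l - tnth x' i) by rewrite mulr_ge0//; lra.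
have h4 : 0 <= (1 - t) * (tnth a i + l - tnth x i) by rewrite mulr_ge0//; lra.
apply/andP; split; lra.
Qed.

Lemma channel_lipschitz x x' (L : R) B : cube R n a l x -> cube R n a l x' -> 0 <= L ->
  K * \sum_i (tnth x' i - tnth x i) ^+ 2 < L -> measurable B ->
  `|fine (W n x' B) - fine (W n x B)| <= Num.sqrt (8 * L).
Proof.
move=> cx cx' L0 KL mB.
pose u := t2rv R n x' - t2rv R n x.
pose pt t := rv2t R n (t *: u + t2rv R n x).
have p0 : pt 0 = x by rewrite /pt scale0r add0r t2rvK.
have p1 : pt 1 = x' by rewrite /pt scale1r subrK t2rvK.
have KLu : K * (u *m u^T) ord0 ord0 < L.
  apply: le_lt_trans KL; rewrite rv_sqE; under eq_bigr do rewrite !mxE.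
  by [].
rewrite -{1}p1 -{1}p0; apply: (local_lipschitz_global (F := fun t => fine (W n (pt t) B))).
move=> t t01; have ct : cube R n a l (pt t) by exact: cube_segment.
have [rho rho0 H] := channel_local_lipschitz ct L0 KLu mB.
exists rho => // h hr; have := H h hr.
by rewrite /pt rv2tK addrA -scalerDl [h + t]addrC.
Qed.

Section quantizer.
Variables (h : R) (h0 : 0 < h) (l0 : 0 <= l).

Definition qnum : nat := (Num.truncn (l / h)).+1.

Definition quant (x : n.-tuple R) : {ffun 'I_n -> 'I_qnum} :=
  [ffun i => inord (Num.truncn ((tnth x i - tnth a i) / h))].

Lemma quantE x i : cube R n a l x ->
  (quant x i)%:R * h <= tnth x i - tnth a i < (quant x i).+1%:R * h.
Proof.
move=> cx; have /andP[x1 x2] := cx i.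
have xh0 : 0 <= (tnth x i - tnth a i) / h by rewrite divr_ge0// ?subr_ge0// ltW.
have -> : quant x i = Num.truncn ((tnth x i - tnth a i) / h) :> nat.
  rewrite ffunE inordK// ltnS; apply: le_truncn.
  by rewrite ler_pM2r ?invr_gt0//; lra.
have /andP[t1 t2] := truncn_itv xh0.
by rewrite -ler_pdivlMr// t1 -ltr_pdivrMr.
Qed.

Lemma quant_close x x' i : cube R n a l x -> cube R n a l x' -> quant x = quant x' ->
  `|tnth x' i - tnth x i| <= h.
Proof.
move=> cx cx' qq; have /andP[h1 h2] := quantE i cx; have /andP[] := quantE i cx'.
rewrite -qq => h3 h4; move: h2 h4; rewrite -natr1 mulrDl mul1r => h2 h4.
by rewrite ler_norml; apply/andP; split; lra.
Qed.

Lemma measurable_cube : measurable (cube R n a l).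
Proof.
rewrite (_ : cube R n a l = \bigcap_(i in [set: 'I_n])
    ((fun x : n.-tuple R => tnth x i) @^-1` `[tnth a i, tnth a i + l]%classic)).
  apply: fin_bigcap_measurable => // i _; rewrite -[X in measurable X]setTI.
  exact: measurable_tnth.
apply/seteqP; split => x /=.
  by move=> cx i _; rewrite /= in_itv/=; exact: cx.
by move=> cx i; have := cx i I; rewrite /= in_itv.
Qed.

Lemma measurable_cell g : measurable [set x | cube R n a l x /\ quant x = g].
Proof.
rewrite (_ : [set x | _] = cube R n a l `&` \bigcap_(i in [set: 'I_n])
    ((fun x : n.-tuple R => tnth x i) @^-1` `[(g i)%:R * h + tnth a i, (g i).+1%:R * h + tnth a i[%classic)).
  apply: measurableI; first exact: measurable_cube.
  apply: fin_bigcap_measurable => // i _; rewrite -[X in measurable X]setTI.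
  exact: measurable_tnth.
apply/seteqP; split => x /= [cx].
  move=> qg; split => // i _; rewrite /= in_itv/= -qg.
  by have /andP[h1 h2] := quantE i cx; apply/andP; split; lra.
move=> H; split => //; apply/ffunP => i; apply/val_inj => /=.
have /andP[h1 h2] := quantE i cx.
have := H i I; rewrite /= in_itv/= => /andP[h3 h4].
have lt1 : (g i)%:R * h < (quant x i).+1%:R * h by lra.
have lt2 : (quant x i)%:R * h < (g i).+1%:R * h by lra.
move: lt1 lt2; rewrite !ltr_pM2r// !ltr_nat !ltnS => l1 l2.
by apply/eqP; rewrite eqn_leq l1 l2.
Qed.

Lemma quant_channel x x' (eta : R) B : cube R n a l x -> cube R n a l x' -> quant x = quant x' ->
  0 <= eta -> 8 * (K * (n%:R * h ^+ 2)) < eta ^+ 2 -> measurable B ->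
  `|fine (W n x' B) - fine (W n x B)| <= eta.
Proof.
move=> cx cx' qq e0 he mB.
have -> : eta = Num.sqrt (8 * (eta ^+ 2 / 8)) by rewrite mulrC divfK// sqrtr_sqr ger0_norm.
apply: channel_lipschitz => //; first by rewrite divr_ge0// sqr_ge0.
apply: (@le_lt_trans _ _ (K * (n%:R * h ^+ 2))); last by lra.
rewrite ler_wpM2l//.
rewrite (@le_trans _ _ (\sum_(i < n) h ^+ 2))//; last by rewrite sumr_const card_ord mulr_natl.
apply: ler_sum => i _; rewrite -real_normK ?num_real//.
by rewrite ler_pXn2r ?nnegrE//; [exact: quant_close|exact: ltW].
Qed.

End quantizer.

End channel_lipschitz.

(** * Soft covering *)

Local Open Scope ereal_scope.

(** The index found must have positive weight, because densities are controlled only at atoms of the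
    input. *)
Lemma exists_le_average {R : realType} m (p : 'I_m -> R) (Phi : 'I_m -> \bar R) (V : R) :
  (forall i, (0 <= p i)%R) -> (\sum_i p i = 1)%R -> (forall i, 0 <= Phi i) ->
  \sum_(i < m) (p i)%:E * Phi i <= V%:E -> exists2 i, (0 < p i)%R & Phi i <= V%:E.
Proof.
move=> p0 p1 Phi0 PV; apply: contrapT => nex.
have big i : (0 < p i)%R -> V%:E < Phi i.
  by move=> pi; rewrite ltNge; apply/negP => h; apply: nex; exists i.
(* Truncating at V + 1 makes the values real while those above V remain above V. *)
pose Q i := mine (Phi i) (V + 1)%:E.
have Q0 i : Q i \is a fin_num.
  rewrite /Q; have [h|h] := leP (Phi i) (V + 1)%:E => //.
  by rewrite ge0_fin_numE// (le_lt_trans h)// ltry.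
have QV i : (0 < p i)%R -> (V < fine (Q i))%R.
  by move=> pi; rewrite -lte_fin fineK// /Q lt_min big//= lte_fin ltrDl.
have : (\sum_(i < m) p i * fine (Q i) <= V)%R.
  rewrite -lee_fin; apply: le_trans PV; rewrite -sumEFin; apply: lee_sum => i _.
  rewrite EFinM fineK//; apply: lee_wpmul2l; first by rewrite lee_fin.
  by rewrite /Q ge_min lexx.
have -> : V = (\sum_(i < m) p i * V)%R by rewrite -mulr_suml p1 mul1r.
rewrite -subr_le0 -sumrB => h.
have t0 i : (0 <= p i * fine (Q i) - p i * V)%R.
  rewrite -mulrBr; have := p0 i; rewrite le_eqVlt => /orP[/eqP <-|pi]; first by rewrite mul0r.
  by rewrite mulr_ge0// subr_ge0 ltW// QV.
have z : (\sum_(i < m) (p i * fine (Q i) - p i * V) = 0)%R.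
  by apply/eqP; rewrite eq_le h sumr_ge0.
have pz i : p i = 0%R.
  have z1 : (p i * fine (Q i) - p i * V = 0)%R by apply: (psumr_eq0P _ z).
  have := p0 i; rewrite le_eqVlt => /orP[/eqP //|pi].
  move: z1; rewrite -mulrBr => /eqP; rewrite mulf_eq0 gt_eqF//= subr_eq0 gt_eqF//.
  exact: QV.
by move: p1; rewrite big1 => [/esym/eqP|i _]; [rewrite oner_eq0|exact: pz].
Qed.

Section real_integrands.
Context {d} {T : measurableType d} {R : realType}.
Variables (mu : {measure set T -> \bar R}) (D : set T) (mD : measurable D).

Let mE (g : T -> R) : measurable_fun setT g -> measurable_fun D (fun y => (g y)%:E).
Proof. by move=> mg; exact/measurable_funTS/measurable_EFinP. Qed.

Lemma integral_realZl (a : R) (g : T -> R) : (0 <= a)%R -> measurable_fun setT g ->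
  (forall y, 0 <= g y)%R ->
  \int[mu]_(y in D) (a * g y)%:E = a%:E * \int[mu]_(y in D) (g y)%:E.
Proof.
move=> a0 mg g0; under eq_integral do rewrite EFinM.
by apply: ge0_integralZl_EFin => //; [move=> y _; rewrite lee_fin|exact: mE].
Qed.

Lemma integral_realD (g h : T -> R) : measurable_fun setT g -> measurable_fun setT h ->
  (forall y, 0 <= g y)%R -> (forall y, 0 <= h y)%R ->
  \int[mu]_(y in D) (g y + h y)%:E = \int[mu]_(y in D) (g y)%:E + \int[mu]_(y in D) (h y)%:E.
Proof.
move=> mg mh g0 h0; under eq_integral do rewrite EFinD.
have g0' y : D y -> 0 <= (g y)%:E by rewrite lee_fin.
have h0' y : D y -> 0 <= (h y)%:E by rewrite lee_fin.
exact: (ge0_integralD mu mD g0' (mE mg) h0' (mE mh)).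
Qed.

Lemma integral_real_sum n (g : 'I_n -> T -> R) : (forall i, measurable_fun setT (g i)) ->
  (forall i y, 0 <= g i y)%R ->
  \int[mu]_(y in D) (\sum_i g i y)%:E = \sum_(i < n) \int[mu]_(y in D) (g i y)%:E.
Proof.
move=> mg g0; under eq_integral do rewrite -sumEFin.
apply: ge0_integral_sum => //; first by move=> i; exact: mE.
by move=> i y _; rewrite lee_fin.
Qed.

Lemma integral_real_le (g h : T -> R) : measurable_fun setT g -> measurable_fun setT h ->
  (forall y, 0 <= g y)%R -> (forall y, g y <= h y)%R ->
  \int[mu]_(y in D) (g y)%:E <= \int[mu]_(y in D) (h y)%:E.
Proof.
move=> mg mh g0 gh; apply: ge0_le_integral => //.
- by move=> y _; rewrite lee_fin.
- exact: mE.
- exact: mE.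
- by move=> y _; rewrite lee_fin.
Qed.

Lemma integral_real_ge0 (g : T -> R) : (forall y, 0 <= g y)%R -> 0 <= \int[mu]_(y in D) (g y)%:E.
Proof. by move=> g0; apply: integral_ge0 => y _; rewrite lee_fin. Qed.

End real_integrands.

Section soft_covering.
Context {d1 d2} {X : measurableType d1} {Z : measurableType d2} {R : realType}.
Variables (k : R.-pker X ~> Z) (P : probability X R) (f : X * Z -> \bar R).
Hypothesis fd : gen_density (jointm k P) (prodm k P) f.
Variables (m : nat) (x : 'I_m -> X) (p : 'I_m -> R).
Hypothesis p0 : forall i, (0 <= p i)%R.
Hypothesis p1 : (\sum_i p i = 1)%R.
Hypothesis mx : forall i, measurable [set x i].
Hypothesis PE : forall h : X -> \bar R, measurable_fun setT h ->
    (forall z, 0 <= h z) -> \int[P]_z h z = \sum_(i < m) (p i)%:E * h (x i).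
Variable t : R.
Hypothesis t0 : (0 < t)%R.

Let nu := kout k P.

Let C i := [set y | t%:E < f (x i, y)].

(** The density of [k (x i)] with respect to [nu], cut off above [t]. The cut discards the atypical
    and singular parts and bounds the second moment by [t] times the mean. *)
Let G i y : R := (fine (f (x i, y)) * \1_(~` C i) y)%R.

Let avg y : R := (\sum_i p i * G i y)%R.

Let mfx i : measurable_fun setT (fun y => f (x i, y)).
Proof.
have [mf _ _ _] := fd.
exact: measurableT_comp mf (@pair1_measurable _ _ X Z (x i)).
Qed.

Let mC i : measurable (C i).
Proof. by rewrite -[C i]setTI; exact: emeasurable_fun_o_infty. Qed.

Let mG i : measurable_fun setT (G i).
Proof.
apply: measurable_funM; first exact: measurableT_comp (mfx i).
by apply: measurable_indic; exact: measurableC.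
Qed.

Let G0 i y : (0 <= G i y)%R.
Proof. by have [_ f0 _ _] := fd; rewrite mulr_ge0// fine_ge0. Qed.

Let Gt i y : (G i y <= t)%R.
Proof.
have [_ f0 _ _] := fd; rewrite /G indicE; case: (boolP (y \in ~` C i)) => h; last by rewrite mulr0 ltW.
rewrite mulr1; move: h; rewrite inE /C /= => /negP; rewrite -leNgt => fy.
by rewrite -lee_fin fineK// ge0_fin_numE// (le_lt_trans fy)// ltry.
Qed.

Let mavg : measurable_fun setT avg.
Proof.
by apply: measurable_sum => i; apply: measurable_funM.
Qed.

Let avg0 y : (0 <= avg y)%R.
Proof. by apply: sumr_ge0 => i _; rewrite mulr_ge0. Qed.

Let px i : (0 < p i)%R -> 0 < P [set x i].
Proof.
move=> pi; apply: lt_le_trans (_ : (p i)%:E <= _); first by rewrite lte_fin.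
have -> : P [set x i] = \int[P]_z (\1_[set x i] z)%:E by rewrite integral_indic// setIT.
rewrite PE; last 2 first.
- exact/measurable_EFinP/measurable_indic.
- by move=> z; rewrite lee_fin.
rewrite (bigD1 i)//= indicE mem_set//= mule1 leeDl// sume_ge0// => j _.
by rewrite mule_ge0// lee_fin.
Qed.

Let kG i B : (0 < p i)%R -> measurable B ->
  k (x i) B = \int[nu]_(y in B) (G i y)%:E + k (x i) (B `&` C i).
Proof.
move=> pi mB; have [_ f0 _ _] := fd.
have mBC : measurable (B `\` C i) by exact: measurableD.
have -> : k (x i) B = k (x i) (B `\` C i) + k (x i) (B `&` C i) by exact: measureDI.
congr (_ + _); rewrite (atom_density fd (mx i) (px pi) mBC).
rewrite (_ : _ `&` _ = set0) ?measure0 ?adde0; last first.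
  by apply/seteqP; split => // y /= [[_ Cy] fy]; apply: Cy; rewrite /C /= fy ltry.
rewrite integral_mkcond [RHS]integral_mkcond; apply: eq_integral => y _.
rewrite !patchE in_setD; case: (y \in B) => //=.
rewrite /G indicE in_setC; case: (boolP (y \in C i)) => /= h; first by rewrite mulr0.
rewrite mulr1 fineK//; move: h; rewrite notin_setE /C /= => /negP; rewrite -leNgt => fy.
by rewrite ge0_fin_numE// (le_lt_trans fy)// ltry.
Qed.

Let intG i : (0 < p i)%R -> \int[nu]_y (G i y)%:E <= 1.
Proof.
by move=> pi; have := kG pi measurableT; rewrite prob_kernel => ->; rewrite leeDl.
Qed.

Let intavg : \int[nu]_y (avg y)%:E <= 1.
Proof.
rewrite /avg integral_real_sum//; last 2 first.
- by move=> i; exact: measurable_funM.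
- by move=> i y; rewrite mulr_ge0.
apply: (@le_trans _ _ (\sum_(i < m) (p i)%:E)); last by rewrite sumEFin p1.
apply: lee_sum => i _; rewrite integral_realZl//.
have := p0 i; rewrite le_eqVlt => /orP[/eqP <-|pi]; first by rewrite mul0e.
by rewrite -[leRHS]mule1; apply: lee_wpmul2l; [rewrite lee_fin|exact: intG].
Qed.

Let variance s y : (\sum_i p i * (s + (G i y - avg y)) ^+ 2 <= s ^+ 2 + t * avg y)%R.
Proof.
have -> : (\sum_i p i * (s + (G i y - avg y)) ^+ 2 =
    s ^+ 2 - avg y ^+ 2 + \sum_i p i * (G i y) ^+ 2)%R.
  have E (q g v : R) : (q * (s + (g - v)) ^+ 2 =
     q * (s - v) ^+ 2 + (2 * (s - v)) * (q * g) + q * g ^+ 2)%R by ring.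
  under eq_bigr do rewrite E.
  rewrite !big_split/= -mulr_suml p1 -mulr_sumr -/(avg y) mul1r.
  by congr (_ + _)%R; ring.
have h : (\sum_i p i * (G i y) ^+ 2 <= t * avg y)%R.
  rewrite /avg mulr_sumr; apply: ler_sum => i _.
  by rewrite expr2 mulrCA; apply: ler_wpM2r => //; rewrite mulr_ge0.
by have := sqr_ge0 (avg y); lra.
Qed.

(* Codewords are picked one at a time so that the left-hand side never exceeds its average: under
   [p] the fluctuations [G i - avg] are centered, so the cross terms vanish and each pick adds at
   most [t] to the squared norm. *)
Lemma greedy_codebook (c : R) (M : nat) : (0 <= c)%R ->
  exists e : nat -> 'I_m, (forall j, (j < M)%N -> (0 < p (e j))%R) /\
    \int[nu]_y ((\sum_(j < M) (G (e j) y - avg y)) ^+ 2)%:E +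
      c%:E * \sum_(j < M) k (x (e j)) (C (e j)) <=
    (M%:R * t)%:E + (c * M%:R)%:E * jointm k P [set z | t%:E < f z].
Proof.
move=> c0; have [mf f0 _ _] := fd.
have mA : measurable [set z | t%:E < f z].
  by rewrite -[X in measurable X]setTI; exact: emeasurable_fun_o_infty.
have JE : jointm k P [set z | t%:E < f z] = \sum_(i < m) (p i)%:E * k (x i) (C i).
  rewrite jointmE// PE; last 2 first.
  - exact: measurable_k_xsection.
  - by move=> z; exact: measure_ge0.
  by apply: eq_bigr => i _; rewrite xsectionE.
have Jfin : jointm k P [set z | t%:E < f z] \is a fin_num by exact: fin_num_measure.
set J := jointm _ _ _ in JE Jfin *.
elim: M => [|M [e [e0 ih]]].
  have [i _] : exists i : 'I_m, True.
    case: (m) p p1 => [q|m' _ _]; last by exists ord0.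
    by rewrite big_ord0 => /esym/eqP; rewrite oner_eq0.
  exists (fun=> i); split => //.
  rewrite mul0r mulr0 mul0e adde0 big_ord0 mule0 adde0.
  by rewrite integral0_eq// => y _; rewrite big_ord0 expr0n.
pose S y := (\sum_(j < M) (G (e j) y - avg y))%R.
have mS : measurable_fun setT S by apply: measurable_sum => i; apply: measurable_funB.
pose Phi i := \int[nu]_y ((S y + (G i y - avg y)) ^+ 2)%:E +
   c%:E * (\sum_(j < M) k (x (e j)) (C (e j)) + k (x i) (C i)).
have msq i : measurable_fun setT (fun y => (S y + (G i y - avg y)) ^+ 2)%R.
  by apply: measurable_funX; apply: measurable_funD => //; exact: measurable_funB.
(* Under [p] the average of [Phi] exceeds the previous value by at most t + c J: the variance
   integrates to at most [t] because the integral of [avg] is at most 1, and [J] is the mean of the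
   discarded masses. *)
have [i pi Phii] : exists2 i, (0 < p i)%R & Phi i <= (M.+1%:R * t + c * M.+1%:R * fine J)%:E.
  apply: exists_le_average => //.
    move=> i; apply: adde_ge0; first by apply: integral_ge0 => y _; rewrite lee_fin sqr_ge0.
    by rewrite mule_ge0 ?lee_fin// adde_ge0// sume_ge0.
  pose a := fine (\sum_(j < M) k (x (e j)) (C (e j))).
  have aE : \sum_(j < M) k (x (e j)) (C (e j)) = a%:E.
    rewrite /a fineK//; apply/sum_fin_numP => j _ _.
    exact: (fin_num_measure (kprob k (x (e j)))).
  pose kC i := fine (k (x i) (C i)).
  have kCE i : k (x i) (C i) = (kC i)%:E.
    by rewrite fineK//; exact: (fin_num_measure (kprob k (x i))).
  rewrite aE in ih.
  have S2fin : \int[nu]_y ((S y) ^+ 2)%:E \is a fin_num.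
    rewrite ge0_fin_numE; last by apply: integral_ge0 => y _; rewrite lee_fin sqr_ge0.
    apply: le_lt_trans (_ : (M%:R * t)%:E + (c * M%:R)%:E * J < +oo).
      by apply: le_trans ih; rewrite leeDl// -EFinM lee_fin mulr_ge0// fine_ge0// sume_ge0.
    by rewrite -(fineK Jfin) -EFinM -EFinD ltry.
  have stepa : \sum_(i < m) (p i)%:E * \int[nu]_y ((S y + (G i y - avg y)) ^+ 2)%:E <=
      (fine (\int[nu]_y ((S y) ^+ 2)%:E) + t)%:E.
    have -> : \sum_(i < m) (p i)%:E * \int[nu]_y ((S y + (G i y - avg y)) ^+ 2)%:E =
        \int[nu]_y (\sum_i p i * (S y + (G i y - avg y)) ^+ 2)%:E.
      rewrite integral_real_sum//; last 2 first.
      - by move=> i; exact: measurable_funM.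
      - by move=> i y; rewrite mulr_ge0// sqr_ge0.
      by apply: eq_bigr => i _; rewrite integral_realZl// => y; exact: sqr_ge0.
    apply: (@le_trans _ _ (\int[nu]_y ((S y) ^+ 2 + t * avg y)%:E)).
      apply: integral_real_le => //.
      - by apply: measurable_sum => i; exact: measurable_funM.
      - by apply: measurable_funD; [exact: measurable_funX|exact: measurable_funM].
      - by move=> y; rewrite sumr_ge0// => i _; rewrite mulr_ge0// sqr_ge0.
    rewrite integral_realD//; last 4 first.
    - exact: measurable_funX.
    - exact: measurable_funM.
    - by move=> y; exact: sqr_ge0.
    - by move=> y; rewrite mulr_ge0// ltW.
    rewrite integral_realZl//; last exact: ltW.
    rewrite [leRHS]EFinD fineK//; apply: leeD2l; rewrite -[leRHS]mule1; apply: lee_wpmul2l => //.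
    by rewrite lee_fin ltW.
  have -> : \sum_(i < m) (p i)%:E * Phi i =
     \sum_(i < m) (p i)%:E * \int[nu]_y ((S y + (G i y - avg y)) ^+ 2)%:E +
     (c * (a + \sum_i p i * kC i))%:E.
    rewrite (_ : (c * (a + \sum_i p i * kC i))%R = (\sum_i p i * (c * (a + kC i)))%R); last first.
      have E (q v : R) : (q * (c * (a + v)) = c * a * q + c * (q * v))%R by ring.
      under [RHS]eq_bigr do rewrite E.
      by rewrite big_split/= -!mulr_sumr p1; ring.
    rewrite -sumEFin -big_split/=; apply: eq_bigr => i _.
    rewrite /Phi aE kCE -EFinD -EFinM ge0_muleDr//.
      by apply: integral_real_ge0 => y; exact: sqr_ge0.
    by rewrite lee_fin mulr_ge0// addr_ge0// fine_ge0// sume_ge0.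
  have Jr : (\sum_i p i * kC i = fine J)%R.
    by rewrite JE; under [in RHS]eq_bigr do rewrite kCE -EFinM; rewrite sumEFin.
  move: ih; rewrite -(fineK S2fin) -(fineK Jfin) -!EFinM -!EFinD lee_fin => ih.
  apply: le_trans (leeD2r _ stepa) _; rewrite -EFinD lee_fin Jr -natr1.
  move: ih; set I2 := fine (integral _ _ _); lra.
exists (fun j => if (j < M)%N then e j else i); split.
  by move=> j; rewrite ltnS leq_eqVlt => /orP[/eqP ->|jM]; [rewrite ltnn|rewrite jM; exact: e0].
rewrite big_ord_recr/= ltnn.
have -> : \sum_(j < M) k (x (if (j < M)%N then e j else i)) (C (if (j < M)%N then e j else i)) =
   \sum_(j < M) k (x (e j)) (C (e j)) by apply: eq_bigr => j _; rewrite ltn_ord.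
rewrite (eq_integral (fun y => ((S y + (G i y - avg y)) ^+ 2)%:E)); last first.
  move=> y _; rewrite big_ord_recr/= ltnn; congr ((_ + _) ^+ 2)%:E.
  by apply: eq_bigr => j _; rewrite ltn_ord.
apply: (le_trans Phii).
by rewrite -[in leRHS](fineK Jfin) -EFinM -EFinD.
Qed.

(* AM-GM: [|v| <= eta / 2 + v^2 / (2 eta)]. *)
Lemma codebook_close (e : nat -> 'I_m) (M : nat) (eta : R) B : (0 < M)%N -> (0 < eta)%R ->
  (forall j, (j < M)%N -> (0 < p (e j))%R) ->
  \int[nu]_y ((\sum_(j < M) (G (e j) y - avg y)) ^+ 2)%:E +
      M%:R%:E * \sum_(j < M) k (x (e j)) (C (e j)) <= (M%:R ^+ 2 * eta ^+ 2)%:E ->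
  jointm k P [set z | t%:E < f z] <= (eta ^+ 2)%:E ->
  measurable B ->
  (`| fine (nu B) - M%:R^-1 * \sum_(j < M) fine (k (x (e j)) B)| <= eta + eta ^+ 2)%R.
Proof.
move=> M0 eta0 ep hs hJ mB; have [mf f0 _ _] := fd.
have Mp : (0 < M%:R :> R)%R by rewrite ltr0n.
have Mi : (0 <= M%:R^-1 :> R)%R by rewrite invr_ge0.
pose S y := (\sum_(j < M) (G (e j) y - avg y))%R.
have mS : measurable_fun setT S by apply: measurable_sum => i; apply: measurable_funB.
pose g1 y := (M%:R^-1 * \sum_(j < M) G (e j) y)%R.
have mg1 : measurable_fun setT g1 by apply: measurable_funM => //; exact: measurable_sum.
have g10 y : (0 <= g1 y)%R by rewrite mulr_ge0// sumr_ge0.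
(* An integrable majorant of the difference of the two truncated output densities; its integral is
   at most eta/2 + eta/2 by the bound on the squared norm. *)
pose w y := (eta / 2 + (2 * eta * M%:R ^+ 2)^-1 * (S y) ^+ 2)%R.
have cge0 : (0 <= (2 * eta * M%:R ^+ 2)^-1)%R.
  by rewrite invr_ge0 mulr_ge0 ?sqr_ge0// mulr_ge0// ltW.
have e2 : (0 <= eta / 2)%R by rewrite divr_ge0// ltW.
have w0 y : (0 <= w y)%R by rewrite addr_ge0// mulr_ge0// sqr_ge0.
have mw : measurable_fun setT w.
  by apply: measurable_funD => //; apply: measurable_funM => //; exact: measurable_funX.
have g1S y : (g1 y - avg y = M%:R^-1 * S y)%R.
  rewrite /g1 /S sumrB sumr_const card_ord mulrBr -[(avg y *+ M)%R]mulr_natl mulrA mulVf ?mul1r//.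
  by rewrite gt_eqF.
have amgm (v : R) : (`|v| <= eta / 2 + v ^+ 2 / (2 * eta))%R.
  have -> : (eta / 2 + v ^+ 2 / (2 * eta) = `|v| + (`|v| - eta) ^+ 2 / (2 * eta))%R.
    have -> : (v ^+ 2 = `|v| ^+ 2)%R by rewrite real_normK// num_real.
    by field; rewrite gt_eqF.
  by rewrite lerDl divr_ge0 ?sqr_ge0// mulr_ge0// ltW.
have wE y : (w y = eta / 2 + (M%:R^-1 * S y) ^+ 2 / (2 * eta))%R.
  by rewrite /w; field; rewrite !gt_eqF.
have g1w y : (g1 y <= avg y + w y)%R.
  have := amgm (M%:R^-1 * S y)%R; rewrite -wE -g1S ler_norml => /andP[_]; lra.
have g2w y : (avg y <= g1 y + w y)%R.
  have := amgm (M%:R^-1 * S y)%R; rewrite -wE -g1S ler_norml => /andP[]; lra.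
have close (g h : Z -> R) : measurable_fun setT g -> measurable_fun setT h ->
   (forall y, 0 <= g y)%R -> (forall y, 0 <= h y)%R -> (forall y, g y <= h y + w y)%R ->
   \int[nu]_(y in B) (g y)%:E <= \int[nu]_(y in B) (h y)%:E + \int[nu]_y (w y)%:E.
  move=> mg mh g_0 h_0 ghw.
  apply: (@le_trans _ _ (\int[nu]_(y in B) (h y + w y)%:E)).
    by apply: integral_real_le => //; exact: measurable_funD.
  rewrite integral_realD// leeD2l//; apply: ge0_subset_integral => //.
  - exact/measurable_EFinP.
  - by move=> y _; rewrite lee_fin.
have kfin i A : measurable A -> k (x i) A = (fine (k (x i) A))%:E.
  by move=> mA; rewrite fineK//; exact: (fin_num_measure (kprob k (x i))).
have mBC i : measurable (B `&` C i) by exact: measurableI.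
have kle i A A' : measurable A -> measurable A' -> A `<=` A' -> (fine (k (x i) A) <= fine (k (x i) A'))%R.
  by move=> mA mA' AA'; rewrite -lee_fin -!kfin//; apply: le_measure; rewrite ?inE.
pose a := (\sum_(j < M) fine (k (x (e j)) (C (e j))))%R.
have a0 : (0 <= a)%R by apply: sumr_ge0 => j _; exact: fine_ge0.
have aE : \sum_(j < M) k (x (e j)) (C (e j)) = a%:E.
  by rewrite /a -sumEFin; apply: eq_bigr => j _; exact: kfin.
have S20 : 0 <= \int[nu]_y ((S y) ^+ 2)%:E by apply: integral_ge0 => y _; rewrite lee_fin sqr_ge0.
have S2fin : \int[nu]_y ((S y) ^+ 2)%:E \is a fin_num.
  rewrite ge0_fin_numE//; apply: le_lt_trans (_ : (M%:R ^+ 2 * eta ^+ 2)%:E < +oo); last exact: ltry.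
  by apply: le_trans hs; rewrite leeDl// aE -EFinM lee_fin mulr_ge0.
pose s2 := fine (\int[nu]_y ((S y) ^+ 2)%:E).
have s20 : (0 <= s2)%R by exact: fine_ge0.
have hs' : (s2 + M%:R * a <= M%:R ^+ 2 * eta ^+ 2)%R.
  by rewrite -lee_fin EFinD EFinM fineK// -aE.
have intw : \int[nu]_y (w y)%:E = (eta / 2 + (2 * eta * M%:R ^+ 2)^-1 * s2)%:E.
  rewrite integral_realD//; last 2 first.
  - by apply: measurable_funM => //; exact: measurable_funX.
  - by move=> y; rewrite mulr_ge0// sqr_ge0.
  rewrite [X in _ + X]integral_realZl//; last 2 first.
  - exact: measurable_funX.
  - by move=> y; exact: sqr_ge0.
  have nuT : nu setT = 1 by exact: kout_setT.
  rewrite integral_cst//; transitivity ((eta / 2)%:E * nu setT + ((2 * eta * M%:R ^+ 2)^-1)%:E * s2%:E).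
    by rewrite /s2 fineK.
  by rewrite nuT mule1.
have nuB : nu B = \int[nu]_(y in B) (avg y)%:E + (\sum_i p i * fine (k (x i) (B `&` C i)))%:E.
  rewrite /nu koutE// PE; last 2 first.
  - exact: measurable_kernel.
  - by move=> z; exact: measure_ge0.
  rewrite -/nu /avg integral_real_sum//; last 2 first.
  - by move=> i; exact: measurable_funM.
  - by move=> i y; rewrite mulr_ge0.
  rewrite -sumEFin -big_split/=; apply: eq_bigr => i _.
  rewrite integral_realZl//.
  have := p0 i; rewrite le_eqVlt => /orP[/eqP <-|pi]; first by rewrite !mul0e mul0r adde0.
  rewrite EFinM -kfin// -ge0_muleDr//; last by apply: integral_ge0 => y _; rewrite lee_fin.
  by rewrite (kG pi mB).
have kB : (M%:R^-1 * \sum_(j < M) fine (k (x (e j)) B))%:E =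
   \int[nu]_(y in B) (g1 y)%:E + (M%:R^-1 * \sum_(j < M) fine (k (x (e j)) (B `&` C (e j))))%:E.
  rewrite /g1 integral_realZl//; last 2 first.
  - exact: measurable_sum.
  - by move=> y; exact: sumr_ge0.
  rewrite integral_real_sum//.
  rewrite !EFinM -!sumEFin -ge0_muleDr; last 2 first.
  - by apply: sume_ge0 => j _; apply: integral_ge0 => y _; rewrite lee_fin.
  - by apply: sume_ge0 => j _; rewrite lee_fin fine_ge0.
  congr (_ * _); rewrite -big_split/=; apply: eq_bigr => j _.
  by rewrite -!kfin// -(kG (ep _ (ltn_ord j)) mB).
have b2fin : \int[nu]_(y in B) (avg y)%:E \is a fin_num.
  rewrite ge0_fin_numE; last by apply: integral_ge0 => y _; rewrite lee_fin.
  apply: le_lt_trans (_ : nu B < +oo); last by rewrite -ge0_fin_numE// fin_num_measure.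
  rewrite [leRHS]nuB leeDl// lee_fin sumr_ge0// => i _; rewrite mulr_ge0// fine_ge0//.
have b1fin : \int[nu]_(y in B) (g1 y)%:E \is a fin_num.
  rewrite ge0_fin_numE; last by apply: integral_ge0 => y _; rewrite lee_fin.
  apply: le_lt_trans (_ : (M%:R^-1 * \sum_(j < M) fine (k (x (e j)) B))%:E < +oo); last exact: ltry.
  rewrite [leRHS]kB leeDl// lee_fin mulr_ge0// sumr_ge0// => i _; rewrite fine_ge0//.
have c1 := close _ _ mg1 mavg g10 avg0 g1w.
have c2 := close _ _ mavg mg1 avg0 g10 g2w.
pose b1 := fine (\int[nu]_(y in B) (g1 y)%:E).
pose b2 := fine (\int[nu]_(y in B) (avg y)%:E).
pose r1 := (M%:R^-1 * \sum_(j < M) fine (k (x (e j)) (B `&` C (e j))))%R.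
pose r2 := (\sum_i p i * fine (k (x i) (B `&` C i)))%R.
have E1 : (M%:R^-1 * \sum_(j < M) fine (k (x (e j)) B) = b1 + r1)%R.
  by apply: EFin_inj; rewrite kB EFinD fineK.
have E2 : (fine (nu B) = b2 + r2)%R by rewrite nuB fineD.
have C1 : (b1 <= b2 + (eta / 2 + (2 * eta * M%:R ^+ 2)^-1 * s2))%R.
  by rewrite -lee_fin EFinD !fineK// -intw.
have C2 : (b2 <= b1 + (eta / 2 + (2 * eta * M%:R ^+ 2)^-1 * s2))%R.
  by rewrite -lee_fin EFinD !fineK// -intw.
have W : ((2 * eta * M%:R ^+ 2)^-1 * s2 <= eta / 2)%R.
  rewrite mulrC ler_pdivrMr; last by rewrite !mulr_gt0 ?exprn_gt0.
  have -> : (eta / 2 * (2 * eta * M%:R ^+ 2) = M%:R ^+ 2 * eta ^+ 2)%R by field.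
  by apply: le_trans hs'; rewrite lerDl mulr_ge0// ltW.
have r10 : (0 <= r1)%R by rewrite mulr_ge0// sumr_ge0// => j _; exact: fine_ge0.
have r20 : (0 <= r2)%R by rewrite sumr_ge0// => j _; rewrite mulr_ge0// fine_ge0.
(* The factor M in front of the discarded masses in [hs] bounds their sum by M eta^2, hence their
   mean by eta^2. *)
have r1le : (r1 <= eta ^+ 2)%R.
  rewrite /r1 mulrC ler_pdivrMr//.
  apply: (@le_trans _ _ a).
    by apply: ler_sum => j _; apply: kle.
  rewrite -(@ler_pM2l _ M%:R)//.
  have -> : (M%:R * (eta ^+ 2 * M%:R) = M%:R ^+ 2 * eta ^+ 2)%R by ring.
  by apply: le_trans hs'; rewrite lerDr.
have mA : measurable [set z | t%:E < f z].
  by rewrite -[X in measurable X]setTI; exact: emeasurable_fun_o_infty.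
have r2le : (r2 <= eta ^+ 2)%R.
  rewrite -lee_fin; apply: le_trans hJ.
  rewrite jointmE// PE; last 2 first.
  - exact: measurable_k_xsection.
  - by move=> z; exact: measure_ge0.
  rewrite -sumEFin; apply: lee_sum => i _; rewrite EFinM; apply: lee_wpmul2l; first by rewrite lee_fin.
  rewrite (_ : xsection _ _ = C i); last by rewrite xsectionE.
  by rewrite (kfin i (C i))// lee_fin; exact: kle.
rewrite E1 E2 ler_norml; apply/andP; split; lra.
Qed.

End soft_covering.

(** * Quantization of the input *)

Section growth.
Context {R : realType} {dY : measure_display} {Y : measurableType dY}.
Variables (W : channel R dY Y) (c : forall n : nat, n.-tuple R -> R) (Gamma : R).

Lemma limn_esup_elog_near (u : nat -> \bar R) (gam : R) :
  limn_esup (fun n => (n%:R^-1)%:E * elog R (maxe 1 (elog R (u n)))) = 0 -> (0 < gam)%R ->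
  \forall n \near \oo, u n <= (expR (expR (n%:R * gam)))%:E.
Proof.
move=> u0 g0.
have h : limn_esup (fun n => (n%:R^-1)%:E * elog R (maxe 1 (elog R (u n)))) <= (0:R)%:E by rewrite u0.
have := limn_esup_le_near h g0; rewrite add0r => H.
near=> n.
have n0 : (0 < n)%N by near: n; exact: nbhs_infty_gt.
have np : (0 < n%:R :> R)%R by rewrite ltr0n.
have : (n%:R^-1)%:E * elog R (maxe 1 (elog R (u n))) <= gam%:E by near: n.
case un : (u n) => [r| |]; last by rewrite leNye.
- rewrite /elog; case: ifPn => [r0|]; last first.
    by rewrite -leNgt => r0 _; rewrite lee_fin (le_trans r0)// expR_ge0.
  rewrite /maxe/= lte_fin; case: ifPn => h1.
    have lr0 : (0 < ln r)%R by apply: lt_trans h1.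
    rewrite lr0 -EFinM lee_fin mulrC ler_pdivrMr// => h2.
    rewrite lee_fin -[leLHS]lnK ?posrE// ler_expR -[leLHS]lnK ?posrE// ler_expR.
    by rewrite mulrC.
  move=> _; rewrite lee_fin -[leLHS]lnK ?posrE// ler_expR.
  rewrite -leNgt in h1; apply: (le_trans h1).
  by rewrite -[leLHS]expR0 ler_expR mulr_ge0// ltW.
- rewrite /= /maxe/= ltry /=.
  by rewrite gt0_muley ?lte_fin ?invr_gt0// leye_eq.
Unshelve. all: by end_near. Qed.

(** The form in which (A1) and (A2) are used: for any exponent gam > 0 it holds for all large
    [n]. *)
Definition regular_at (a : forall n, n.-tuple R) (l : nat -> R) (gam : R) (n : nat) : Prop :=
  [/\ (0 < n)%N, (2 <= l n)%R, (l n <= expR (expR (n%:R * gam)))%R,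
      cost_set R c Gamma n `<=` cube R n (a n) (l n) &
      (forall x, KL_twice_diff R dY Y W n x) /\
      forall x, cube R n (a n) (l n) x ->
        mxnorm_rq R n (hessian R dY Y W n x) <= (expR (expR (n%:R * gam)))%:E].

Lemma A1_A2_regular : A1_A2 R dY Y W c Gamma ->
  exists a l, forall gam : R, (0 < gam)%R -> \forall n \near \oo, regular_at a l gam n.
Proof.
move=> [a [l [l2 A1 cc td A2]]]; exists a, l => gam g0.
have h1 := limn_esup_elog_near A2 g0.
have A1' : limn_esup (fun n => (n%:R^-1 * ln (ln (l n)))%:E) <= (0:R)%:E by rewrite A1.
have := limn_esup_le_near A1' g0; rewrite add0r => h2.
near=> n.
have n0 : (0 < n)%N by near: n; exact: nbhs_infty_gt.
have np : (0 < n%:R :> R)%R by rewrite ltr0n.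
split => //; [|exact: cc|split; first exact: td].
- have l0 : (0 < l n)%R by rewrite (lt_le_trans _ (l2 n)).
  rewrite -[leLHS]lnK ?posrE// ler_expR.
  have ll0 : (0 < ln (l n))%R by rewrite ln_gt0// (lt_le_trans _ (l2 n))// ltr1n.
  rewrite -[leLHS]lnK ?posrE// ler_expR [leRHS]mulrC -ler_pdivrMr// mulrC.
  by rewrite -lee_fin; near: n; exact: h2.
- move=> x cx; apply: le_trans (_ : ereal_sup [set mxnorm_rq R n (hessian R dY Y W n x) | x in cube R n (a n) (l n)] <= _).
    by apply: ereal_sup_ubound; exists x.
  by near: n; exact: h1.
Unshelve. all: by end_near. Qed.

End growth.

(** With q = n (K + 1) the claim reduces to 8 K n < 16 q^2, from q >= 1 and q >= K n. This choice of
    step keeps the number of cells free of square roots of K. *)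
Lemma quant_step {R : realType} (n K eta h : R) : (1 <= n)%R -> (0 < K)%R -> (0 < h)%R ->
  eta = (4 * (n * (K + 1)) * h)%R -> (8 * (K * (n * h ^+ 2)) < eta ^+ 2)%R.
Proof.
move=> n1 K0 h0 etaE; set q := (n * (K + 1))%R in etaE.
have q1 : (1 <= q)%R by rewrite /q; nra.
have Kq : (K * n <= q)%R by rewrite /q; nra.
have h2 : (0 < h ^+ 2)%R by rewrite exprn_gt0.
rewrite etaE (_ : (4 * q * h) ^+ 2 = 16 * q ^+ 2 * h ^+ 2)%R; last by ring.
have -> : (8 * (K * (n * h ^+ 2)) = 8 * (K * n) * h ^+ 2)%R by ring.
rewrite ltr_pM2r//.
have : (q <= q ^+ 2)%R by nra.
lra.
Qed.

Section quantization.
Context {R : realType} {dY : measure_display} {Y : measurableType dY}.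
Variables (W : channel R dY Y) (c : forall n : nat, n.-tuple R -> R) (Gamma : R).

Local Notation cset := (cost_set R c Gamma).

Definition mixture_rep n (Q : probability (n.-tuple R) R) (m : nat) (x : 'I_m -> n.-tuple R) (p : 'I_m -> R) :=
  [/\ forall i, (0 <= p i)%R, (\sum_i p i = 1)%R, forall i, cset n (x i) &
   forall h : n.-tuple R -> \bar R, measurable_fun setT h ->
    (forall z, 0 <= h z) -> \int[Q]_z h z = \sum_(i < m) (p i)%:E * h (x i)].

Lemma quantized_mixture n a l (K eta : R) (Q : probability (n.-tuple R) R) :
  (0 < n)%N -> (0 <= l)%R -> (0 < K)%R -> (0 < eta)%R -> full_on R n Q (cset n) ->
  cset n `<=` cube R n a l ->
  (forall x, KL_twice_diff R dY Y W n x) ->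
  (forall x, cube R n a l x -> mxnorm_rq R n (hessian R dY Y W n x) <= K%:E) ->
  exists (Q' : probability (n.-tuple R) R) (m : nat) (x : 'I_m -> n.-tuple R) (p : 'I_m -> R),
    mixture_rep Q' x p /\ forall B, measurable B ->
    (`|fine (kout (W n) Q B) - fine (kout (W n) Q' B)| <= eta)%R.
Proof.
move=> n0 l0 K0 e0 [B0 [mB0 B0c QB0]] cc td HK.
pose h := (eta / (4 * n%:R * (K + 1)))%R.
have np : (1 <= n%:R :> R)%R by rewrite ler1n.
have h0 : (0 < h)%R by rewrite divr_gt0// !mulr_gt0//; lra.
have etaE : eta = (4 * (n%:R * (K + 1)) * h)%R.
  by rewrite /h; field; apply/andP; split; rewrite gt_eqF//; lra.
clearbody h.
have hK : (8 * (K * (n%:R * h ^+ 2)) < eta ^+ 2)%R by exact: quant_step.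
have [x0 B0x0] : exists x, B0 x.
  apply: contrapT => /forallNP B00.
  have B0e : B0 = set0 by apply/seteqP; split => // x /B00.
  by move: QB0; rewrite B0e measure0 => /esym/eqP; rewrite onee_eq0.
pose T := {ffun 'I_n -> 'I_(qnum l h)}.
pose D (g : T) := [set x | cube R n a l x /\ quant a l h x = g] `&` B0.
have mD g : measurable (D g) by apply: measurableI => //; exact: measurable_cell.
(* Representatives are taken inside [B0], not at cell centres, so that they meet the cost
   constraint. An empty cell receives any point of [B0], with weight zero. *)
have /choice[x xP] : forall g : T, exists x, B0 x /\ (forall y, D g y -> D g x).
  move=> g; have [[y Dy]|nD] := pselect (exists y, D g y).
    by exists y; split => //; exact: Dy.2.
  by exists x0; split => // y Dy; exfalso; apply: nD; exists y.
pose m := #|T|.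
pose ev (i : 'I_m) : T := enum_val i.
pose p (i : 'I_m) := fine (Q (D (ev i))).
have pE i : Q (D (ev i)) = (p i)%:E by rewrite fineK// fin_num_measure.
have bigD : \big[setU/set0]_(i < m) D (ev i) = B0.
  apply/seteqP; split => [y|y By].
    by rewrite -bigcup_seq => -[i _ [_]].
  rewrite -bigcup_seq; exists (enum_rank (quant a l h y)) => /=; first by rewrite mem_index_enum.
  by rewrite /ev enum_rankK; split => //; split => //; exact/cc/B0c.
have p0 i : (0 <= p i)%R by exact: fine_ge0.
have p1 : (\sum_i p i = 1)%R.
  apply: EFin_inj; rewrite -sumEFin; under eq_bigr do rewrite -pE.
  rewrite -QB0 -bigD measure_semi_additive_ord//; last by rewrite bigD.
  move=> i j _ _ [y [[[_ qi] _] [[_ qj] _]]].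
  by have /enum_val_inj : ev i = ev j by rewrite -qi -qj.
have [Q' Q'E] := exists_mixture (x \o ev) p0 p1.
exists Q', m, (x \o ev), p; split.
  by split => // i /=; apply/B0c; have [] := xP (ev i).
have Wfin z B : measurable B -> W n z B = (fine (W n z B))%:E.
  by move=> mB; rewrite fineK//; exact: channel_fin.
have Wle1 z B : measurable B -> (fine (W n z B) <= 1)%R.
  by move=> mB; rewrite -lee_fin -Wfin//; exact: (@probability_le1 _ _ _ (kprob (W n) z)).
have half B : measurable B -> (fine (kout (W n) Q B) <= fine (kout (W n) Q' B) + eta)%R.
  move=> mB; rewrite -lee_fin EFinD !fineK ?fin_num_measure//.
  rewrite !koutE// Q'E; last 2 first.
  - exact: measurable_kernel.
  - by move=> z; exact: measure_ge0.
  under eq_integral do rewrite Wfin//.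
  pose v i := (fine (W n (x (ev i)) B) + eta)%R.
  have v0 i : (0 <= v i)%R by rewrite addr_ge0 ?fine_ge0// ltW.
  have mi (A : set (n.-tuple R)) : measurable A -> measurable_fun setT (\1_A : _ -> R).
    exact: measurable_indic.
  have mB0C : measurable (~` B0) by exact: measurableC.
  (* A step function dominating the error-shifted channel: on each cell the value at its
     representative plus eta, and 1 off [B0], which is null. *)
  apply: (@le_trans _ _ (\int[Q]_y (\sum_i v i * \1_(D (ev i)) y + \1_(~` B0) y)%:E)).
    apply: integral_real_le => //.
    - apply: (@measurableT_comp _ _ _ _ _ _ fine) => //.
      exact: measurable_kernel.
    - apply: measurable_funD; last exact: mi.
      by apply: measurable_sum => i; apply: measurable_funM => //; exact: mi.
    - move=> y; have [By|By] := pselect (B0 y); last first.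
        rewrite (@le_trans _ _ 1%R) ?Wle1//.
        rewrite [X in (_ <= _ + X)%R]indicE mem_set//= lerDr sumr_ge0// => i _.
        by rewrite mulr_ge0.
      have cy : cube R n a l y by exact/cc/B0c.
      pose i0 := enum_rank (quant a l h y).
      have Di0 : D (ev i0) y by split => //; split => //; rewrite /ev enum_rankK.
      rewrite [X in (_ <= _ + X)%R]indicE memNset ?addr0; last by move/(_ By).
      rewrite (bigD1 i0)//= indicE mem_set//= mulr1.
      apply: ler_wpDr; first by apply: sumr_ge0 => i _; rewrite mulr_ge0.
      have [[cx qx] _] := (xP (ev i0)).2 y Di0.
      have qxy : quant a l h (x (ev i0)) = quant a l h y by rewrite qx /ev enum_rankK.
      have := @quant_channel _ _ _ W n a l K (ltW K0) td HK h h0 _ _ eta B cx cy qxy (ltW e0) hK mB.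
      by rewrite ler_norml /v => /andP[_]; lra.
  have mD1 i : measurable_fun setT (\1_(D (ev i)) : _ -> R) by exact: mi.
  have mB1 : measurable_fun setT (\1_(~` B0) : _ -> R) by exact: mi.
  have mvD i : measurable_fun setT (fun y => v i * \1_(D (ev i)) y)%R.
    by apply: measurable_funM.
  have vD0 i y : (0 <= v i * \1_(D (ev i)) y)%R by rewrite mulr_ge0.
  rewrite integral_realD//; last 2 first.
  - exact: measurable_sum.
  - by move=> y; apply: sumr_ge0 => i _.
  rewrite integral_real_sum//.
  rewrite integral_indic// setIT.
  have QC0 : Q (~` B0) = 0 by rewrite probability_setC// QB0 subee.
  rewrite [X in _ + X <= _](_ : _ = 0) ?adde0; last exact: QC0.
  have -> : eta%:E = \sum_(i < m) (p i)%:E * eta%:E.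
    under eq_bigr do rewrite -EFinM.
    by rewrite sumEFin -mulr_suml p1 mul1r.
  rewrite -big_split/=; apply: lee_sum => i _.
  rewrite integral_realZl//.
  rewrite integral_indic// setIT [X in _ * X <= _](_ : _ = (p i)%:E); last exact: pE.
  rewrite Wfin// -!EFinM -EFinD lee_fin /v mulrC mulrDr//.
move=> B mB; rewrite ler_norml; apply/andP; split; last by have := half B mB; lra.
(* The lower bound is the upper bound for the complement. *)
have := half (~` B) (measurableC mB).
have C (r : giry (n.-tuple Y) R) : r setT = 1 -> fine (r (~` B)) = (1 - fine (r B))%R.
  move=> rT; have : r B + r (~` B) = 1.
    rewrite -rT -(setUCr B) measureU//; [exact: measurableC|exact: setICr].
  move=> /(congr1 fine); rewrite fineD ?fin_num_measure//; last exact: measurableC.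
  by move=> /= h1; lra.
rewrite !C ?kout_setT//; lra.
Qed.

End quantization.

(** * Resolvability *)

Section resolvability.
Context {R : realType} {dY : measure_display} {Y : measurableType dY}.
Variables (W : channel R dY Y) (c : forall n : nat, n.-tuple R -> R) (Gamma : R).

Local Notation J := (joint R dY Y W).
Local Notation ispec := (info_spec R dY Y).
Local Notation cset := (cost_set R c Gamma).

Lemma trate_csize_le (r : R) n : (0 <= r)%R -> (0 < n)%N ->
  (trate R (csize r) n <= r + ln 2 * n%:R^-1)%R.
Proof.
move=> r0 n0; have np : (0 < n%:R :> R)%R by rewrite ltr0n.
rewrite /trate [leLHS]mulrC ler_pdivrMr// mulrDl -mulrA mulVf ?gt_eqF// mulr1.
rewrite -[(r * n%:R)%R]expRK -lnM ?posrE ?expR_gt0//.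
rewrite ler_ln ?posrE ?mulr_gt0 ?expR_gt0 ?ltr0n//.
rewrite /csize -natr1.
have h1 : (1 <= expR (r * n%:R))%R by rewrite -[leLHS]expR0 ler_expR mulr_ge0.
have h2 : ((Num.truncn (expR (n%:R * r)))%:R <= expR (n%:R * r))%R by rewrite truncn_le expR_ge0.
move: h2; rewrite [(n%:R * r)%R]mulrC; lra.
Qed.

(** For b < 0 the right-hand side vanishes as [n] grows: the spectrum puts asymptotically no mass
    below a negative level. *)
Lemma joint_info_le P n f (b : R) : (0 < n)%N -> info_density R dY Y W P n f ->
  J P n [set z | ispec n f z <= b%:E] <= (expR (n%:R * b))%:E.
Proof.
move=> n0 /[dup] fI /info_densityP fd; have [mf f0 _ _] := fd.
rewrite joint_jointm; last exact: measurable_info_le fI.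
apply: le_trans (gen_density_le fd (measurable_info_le b n0 fI) (t := expR (n%:R * b)) _) _.
  by move=> z /=; rewrite !leNgt info_spec_gt.
rewrite -[leRHS]mule1; apply: lee_wpmul2l; first by rewrite lee_fin expR_ge0.
rewrite -(prodm_setT (W n) (P n)); apply: le_measure; rewrite ?inE//.
exact: measurable_info_le fI.
Qed.

Lemma resolvability_code n (P : input_process R) f m (x : 'I_m -> n.-tuple R) p (b : R) (M : nat) :
  (0 < n)%N -> (0 < M)%N -> info_density R dY Y W P n f ->
  mixture_rep c Gamma (P n) x p ->
  exists enc : nat -> n.-tuple R, (forall j, (j < M)%N -> cset n (enc j)) /\
  forall eta : R, (0 < eta)%R ->
    (expR (n%:R * b) / M%:R)%:E + J P n [set z | b%:E < ispec n f z] <= (eta ^+ 2)%:E ->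
    forall B, measurable B ->
    (`|fine (kout (W n) (P n) B) - M%:R^-1 * \sum_(j < M) fine (W n (enc j) B)| <= eta + eta ^+ 2)%R.
Proof.
move=> n0 M0 /[dup] fI /info_densityP fd [p0 p1 xc PE].
have [mf f0 _ _] := fd.
have mx i : measurable [set x i] by exact: measurable_tuple_set1.
have t0 : (0 < expR (n%:R * b))%R by exact: expR_gt0.
(* The weight c = M brings the squared norm and the discarded masses to the common scale M^2. The
   codebook is fixed before eta is. *)
have [e [ep he]] := greedy_codebook fd p0 p1 mx PE t0 M (c := M%:R) (ler0n _ _).
exists (x \o e); split => [j jM|eta eta0 h B mB]; first exact: xc.
have Mp : (0 < M%:R :> R)%R by rewrite ltr0n.
have mS := measurable_info_gt b n0 fI.
have Jfin : J P n [set z | b%:E < ispec n f z] \is a fin_num.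
  by rewrite joint_jointm// fin_num_measure.
have J0 : 0 <= J P n [set z | b%:E < ispec n f z] by exact: integral_ge0.
have SE := info_spec_gt_set b n0 f0.
have JE : J P n [set z | b%:E < ispec n f z] = jointm (W n) (P n) [set z | (expR (n%:R * b))%:E < f z].
  by rewrite joint_jointm// SE.
apply: (codebook_close fd p0 mx PE M0 eta0 ep _ _ mB).
  apply: (le_trans he); rewrite -JE.
  move: h; rewrite -(fineK Jfin) -!EFinM -!EFinD !lee_fin => h.
  rewrite (_ : M%:R * expR (n%:R * b) + M%:R * M%:R * fine (J P n _) =
    M%:R ^+ 2 * (expR (n%:R * b) / M%:R + fine (J P n [set z | (b%:E < ispec n f z)%E])))%R.
    by rewrite ler_wpM2l// sqr_ge0.
  by field; rewrite gt_eqF.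
rewrite -JE; apply: le_trans h; rewrite leeDr// lee_fin divr_ge0// ltW//.
Qed.

Hypothesis A12 : A1_A2 R dY Y W c Gamma.

Lemma Sres_le_sup_I_up : Sres R dY Y W c Gamma 0 <= sup_I_up R dY Y W c Gamma.
Proof.
rewrite leNgt; apply/negP => /lt_EFin_between[r /andP[Ir]].
apply/negP; rewrite -leNgt; apply: ereal_inf_lbound; exists r => //= P PS.
have [b /andP[Ib br]] := lt_EFin_between Ir; rewrite lte_fin in br.
have [a [l reg]] := A1_A2_regular A12.
(* The exponent 1 in [regular_at] is arbitrary: the number of atoms does not enter the covering
   bound. At the finitely many other blocklengths the input is kept. *)
have H n : exists Q : probability (n.-tuple R) R,
   ((0 < n)%N -> full_on R n Q (cset n)) /\
   (regular_at W c Gamma a l 1 n ->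
    (exists m (x : 'I_m -> n.-tuple R) p, mixture_rep c Gamma Q x p) /\
    forall B, measurable B -> (`|fine (kout (W n) (P n) B) - fine (kout (W n) Q B)| <= n%:R^-1)%R).
  have [rg|nrg] := pselect (regular_at W c Gamma a l 1 n); last first.
    by exists (P n); split => //; exact: PS.
  have [n0 l2 lle cc [td HK]] := rg.
  have l0 : (0 <= l n)%R by rewrite (le_trans _ l2).
  have ni : (0 < n%:R^-1 :> R)%R by rewrite invr_gt0 ltr0n.
  have [Q [m [x [p [Qx Qc]]]]] := quantized_mixture n0 l0 (expR_gt0 _) ni (PS n n0) cc td HK.
  exists Q; split; last by split => //; exists m, x, p.
  by move=> _; have [p0 p1 xc PE] := Qx; exact: (mixture_full_on p1 PE).
pose P' : input_process R := fun n => sval (cid (H n)).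
have P'1 n : (0 < n)%N -> full_on R n (P' n) (cset n) by rewrite /P'; case: cid => Q [].
have P'2 n : regular_at W c Gamma a l 1 n ->
    (exists m (x : 'I_m -> n.-tuple R) p, mixture_rep c Gamma (P' n) x p) /\
    forall B, measurable B -> (`|fine (kout (W n) (P n) B) - fine (kout (W n) (P' n) B)| <= n%:R^-1)%R.
  by rewrite /P'; case: cid => Q [].
have [f fI] := exists_info_densities W P'.
have Jcv : forall e, (0 < e)%R -> \forall n \near \oo, J P' n [set z | b%:E < ispec n (f n) z] <= e%:E.
  have : I_up R dY Y W P' < b%:E.
    by apply: le_lt_trans Ib; apply: ereal_sup_ubound; exists P'.
  move=> /ereal_inf_lt[_ [b' hb' <-]]; rewrite lte_fin => b'b e e0.
  have := cvg0_near (hb' f fI) e0; move=> h; near=> n.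
  have n0 : (0 < n)%N by near: n; exact: nbhs_infty_gt.
  apply: (@le_trans _ _ (J P' n [set z | b'%:E < ispec n (f n) z])); last by near: n.
  apply: joint_le.
  - exact: measurable_info_gt (fI n).
  - exact: measurable_info_gt (fI n).
  - by move=> z /=; apply: lt_trans; rewrite lte_fin.
(* Otherwise the spectrum would have small probability on both sides of [b]. Nonnegativity gives r
   >= 0, needed to bound the rate of [csize r] from above. *)
have b0 : (0 <= b)%R.
  rewrite leNgt; apply/negP => b0.
  have e3 : (0 < 1 / 3 :> R)%R by lra.
  have h1 := near_expR_le b0 e3.
  have h2 := Jcv _ e3.
  near \oo => n.
  have n0 : (0 < n)%N by near: n; exact: nbhs_infty_gt.
  have := jointm_compl b n0 (fI n).
  have a1 : J P' n [set z | ispec n (f n) z <= b%:E] <= (1 / 3)%:E.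
    by apply: (le_trans (joint_info_le b n0 (fI n))); rewrite lee_fin; near: n.
  have a2 : J P' n [set z | b%:E < ispec n (f n) z] <= (1 / 3)%:E by near: n.
  move=> E; have := leeD a1 a2; rewrite E -EFinD lee_fin; lra.
have r0 : (0 <= r)%R by lra.
have H2 n : exists enc : 'I_(csize r n) -> n.-tuple R,
   ((0 < n)%N -> forall i, cset n (enc i)) /\
   (regular_at W c Gamma a l 1 n -> forall eta : R, (0 < eta)%R ->
    (expR (n%:R * b) / (csize r n)%:R)%:E + J P' n [set z | b%:E < ispec n (f n) z] <= (eta ^+ 2)%:E ->
    forall B, measurable B ->
    (`|fine (kout (W n) (P' n) B) - (csize r n)%:R^-1 * \sum_(j < csize r n) fine (W n (enc j) B)| <= eta + eta ^+ 2)%R).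
  have [rg|nrg] := pselect (regular_at W c Gamma a l 1 n).
    have [[m [x [p Qx]]] _] := P'2 n rg.
    have [n0 _ _ _ _] := rg.
    have [enc [ec he]] := @resolvability_code n P' (f n) m x p b (csize r n) n0 (ltn0Sn _) (fI n) Qx.
    by exists (enc \o val); split => // _ i /=; exact: ec.
  have [n0|n0] := posnP n; first by exists (fun=> point); split => //; rewrite n0.
  have [B0 [mB0 B0c B01]] := PS n n0.
  have [x0 B0x0] : exists x, B0 x.
    apply: contrapT => /forallNP B00.
    have B0e : B0 = set0 by apply/seteqP; split => // x /B00.
    by move: B01; rewrite B0e measure0 => /esym/eqP; rewrite onee_eq0.
  by exists (fun=> x0); split => // _ _; exact: B0c.
pose enc n := sval (cid (H2 n)).
exists (csize r), enc; split.
- by move=> n n0; split => //; rewrite /enc; case: cid => e [he _] /=; exact: he.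
- apply: limn_esup_le_intro => e e0; rewrite add0r.
  (* The total is 2 (eta + eta^2 + 1/n), with eta + eta^2 <= 2 eta <= e/4 and 1/n <= e/4. *)
  pose eta := Num.min (1:R)%R (e / 8)%R.
  have eta0 : (0 < eta)%R by rewrite lt_min; apply/andP; split; lra.
  have eta1 : (eta <= 1)%R by rewrite ge_min lexx.
  have etae : (eta <= e / 8)%R by rewrite ge_min lexx orbT.
  have e20 : (0 < eta ^+ 2 / 2)%R by rewrite divr_gt0// exprn_gt0.
  have br0 : (b - r < 0)%R by lra.
  have h1 := reg _ ltr01.
  have h2 := near_expR_le br0 e20.
  have h3 := Jcv _ e20.
  have e4 : (0 < e / 4)%R by lra.
  have h4 := near_inv_le e4.
  near=> n.
  have rg : regular_at W c Gamma a l 1 n by near: n.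
  have [n0 _ _ _ _] := rg.
  have [_ he] : ((0 < n)%N -> forall i, cset n (enc n i)) /\ _ := svalP (cid (H2 n)).
  have cond : (expR (n%:R * b) / (csize r n)%:R)%:E + J P' n [set z | b%:E < ispec n (f n) z] <= (eta ^+ 2)%:E.
    apply: (@le_trans _ _ ((eta ^+ 2 / 2)%:E + (eta ^+ 2 / 2)%:E)); last by rewrite -EFinD lee_fin; lra.
    apply: leeD; last by near: n.
    rewrite lee_fin (@le_trans _ _ (expR (n%:R * (b - r))))%R//; last by near: n.
    rewrite mulrBr expRB ler_pM2l ?expR_gt0// lef_pV2 ?posrE ?expR_gt0 ?ltr0n//.
    exact: csize_ge.
  apply: ge_ereal_sup => _ [B mB <-].
  have c1 := he rg eta eta0 cond B mB.
  have [_ c2'] := P'2 n rg.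
  have c2 := c2' B mB.
  have hn : (n%:R^-1 <= e / 4)%R by near: n.
  have resE : res_out R dY Y W (csize r) enc n B =
     ((csize r n)%:R^-1 * \sum_(j < csize r n) fine (W n (enc n j) B))%:E.
    rewrite /res_out EFinM -sumEFin; congr (_ * _); apply: eq_bigr => j _.
    by rewrite fineK//; exact: channel_fin.
  rewrite resE outdist_kout// -[kout (W n) (P n) B]fineK ?fin_num_measure//.
  rewrite -EFinB /= -EFinM lee_fin.
  have tri := ler_distD (fine (kout (W n) (P' n) B)) (fine (kout (W n) (P n) B))
    ((csize r n)%:R^-1 * \sum_(j < csize r n) fine (W n (enc n j) B))%R.
  have eta2 : (eta ^+ 2 <= eta)%R by rewrite expr2 ler_piMl// ltW.
  lra.
- apply: limn_esup_le_intro => e e0.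
  have h : (0 < e / ln 2)%R by rewrite divr_gt0// ln_gt0// ltr1n.
  have h1 := near_inv_le h.
  near=> n.
  have n0 : (0 < n)%N by near: n; exact: nbhs_infty_gt.
  rewrite lee_fin (le_trans (trate_csize_le r0 n0))// lerD2l mulrC -ler_pdivlMr; last by rewrite ln_gt0// ltr1n.
  by near: n.
Unshelve. all: by end_near. Qed.

End resolvability.

(** * Identification: converse part *)

Local Open Scope ring_scope.

Lemma near_linear_le_expR {R : realType} (C g : R) : 0 < g ->
  \forall n \near \oo, C * n%:R + 1 <= expR (n%:R * g).
Proof.
move=> g0; near=> n.
have h1 : 1 + n%:R * g / 2 <= expR (n%:R * g / 2) by exact: expR_ge1Dx.
have h2 : (1 + n%:R * g / 2) ^+ 2 <= expR (n%:R * g).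
  have -> : expR (n%:R * g) = expR (n%:R * g / 2) ^+ 2 by rewrite expr2 -expRD; congr expR; field.
  have h0 : 0 <= 1 + n%:R * g / 2 by rewrite addr_ge0// divr_ge0// mulr_ge0// ltW.
  by apply: lerXn2r; rewrite ?nnegrE ?expR_ge0.
apply: le_trans h2.
have hn : 4 * C / g ^+ 2 <= n%:R by near: n; exact: nbhs_infty_ger.
have h3 : 4 * C <= n%:R * g ^+ 2 by rewrite -ler_pdivrMr// exprn_gt0.
have n0 : 0 <= n%:R :> R by [].
have h4 : 4 * C * n%:R <= n%:R * g ^+ 2 * n%:R by rewrite ler_wpM2r.
have h5 : 0 <= n%:R * g by rewrite mulr_ge0// ltW.
have -> : (1 + n%:R * g / 2) ^+ 2 = 1 + n%:R * g + n%:R * g ^+ 2 * n%:R / 4 by field.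
lra.
Unshelve. all: by end_near. Qed.

Section id_converse.
Context {R : realType} {dY : measure_display} {Y : measurableType dY}.
Variables (W : channel R dY Y) (c : forall n : nat, n.-tuple R -> R) (Gamma : R).

Local Notation cset := (cost_set R c Gamma).

(** Here [v] bounds single-event differences, half the variational distance. Indexing codewords by
    [nat] lets codebooks of different sizes be compared. *)
Definition approximable (n : nat) (Q : probability (n.-tuple R) R) (rho v : R) : Prop :=
  exists (M : nat) (enc : nat -> n.-tuple R),
    [/\ (0 < M)%N, M%:R <= rho, forall j, (j < M)%N -> cset n (enc j) &
     forall B, measurable B ->
      `|fine (kout (W n) Q B) - M%:R^-1 * \sum_(j < M) fine (W n (enc j) B)| <= v].

(* If infinitely many [Q n i] were not approximable, these would form one bad input process. *)
Lemma eventually_approximable (delta r g : R) (N : nat -> nat)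
    (Q : forall n, 'I_(N n) -> probability (n.-tuple R) R) :
  (forall P, in_S_Gamma R c Gamma P -> res_achievable R dY Y W c Gamma delta r P) ->
  (forall n, (0 < n)%N -> (0 < N n)%N /\ forall i, full_on R n (Q n i) (cset n)) ->
  0 < g -> \forall n \near \oo, forall i,
    approximable (Q n i) (expR (n%:R * (r + g))) ((delta + g) / 2).
Proof.
move=> ra Qc g0.
have H n : exists P : probability (n.-tuple R) R, (0 < n)%N -> full_on R n P (cset n) /\
    (approximable P (expR (n%:R * (r + g))) ((delta + g) / 2) ->
     forall i, approximable (Q n i) (expR (n%:R * (r + g))) ((delta + g) / 2)).
  have [n0|n0] := posnP n; first by exists (dirac point : probability _ _); rewrite n0.
  have [N0 Qf] := Qc n n0.
  have [[i nA]|nA] := pselect (exists i, ~ approximable (Q n i) (expR (n%:R * (r + g))) ((delta + g) / 2)).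
    by exists (Q n i).
  exists (Q n (Ordinal N0)) => _; split => // _ i; apply: contrapT => h; apply: nA; by exists i.
pose P : input_process R := fun n => sval (cid (H n)).
have PH n : (0 < n)%N -> full_on R n (P n) (cset n) /\
    (approximable (P n) (expR (n%:R * (r + g))) ((delta + g) / 2) ->
     forall i, approximable (Q n i) (expR (n%:R * (r + g))) ((delta + g) / 2)).
  by rewrite /P; case: cid.
have PS : in_S_Gamma R c Gamma P by move=> n /PH[].
have [M [enc [ME hv hr]]] := ra P PS.
have h1 := limn_esup_le_near hv g0.
have h2 := limn_esup_le_near hr g0.
near=> n.
have n0 : (0 < n)%N by near: n; exact: nbhs_infty_gt.
have np : 0 < n%:R :> R by rewrite ltr0n.
have [M0 ec] := ME n n0.
apply: (PH n n0).2.
pose enc' j := if insub j is Some i then enc n i else point.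
have encE (i : 'I_(M n)) : enc' i = enc n i by rewrite /enc' valK.
exists (M n), enc'; split => //.
- have : trate R M n <= r + g by rewrite -lee_fin; near: n; exact: h2.
  rewrite /trate mulrC ler_pdivrMr// => h.
  by rewrite -[leLHS]lnK ?posrE ?ltr0n// ler_expR mulrC.
- by move=> j jM; rewrite -[j]/(val (Ordinal jM)) encE; exact: ec.
- move=> B mB.
  have hB : (vdist R _ _ (outdist R dY Y W n (P n)) (res_out R dY Y W M enc n) <= (delta + g)%:E)%E.
    by near: n; exact: h1.
  have : (2%:E * `|outdist R dY Y W n (P n) B - res_out R dY Y W M enc n B| <= (delta + g)%:E)%E.
    by apply: le_trans hB; apply: ereal_sup_ubound; exists B.
  have resE : res_out R dY Y W M enc n B = ((M n)%:R^-1 * \sum_(j < M n) fine (W n (enc' j) B))%:E.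
    rewrite /res_out EFinM -sumEFin; congr (_ * _)%E; apply: eq_bigr => j _.
    by rewrite encE fineK//; exact: channel_fin.
  rewrite resE outdist_kout// -[kout (W n) (P n) B]fineK ?fin_num_measure//.
  by rewrite -EFinB /= -EFinM lee_fin; lra.
Unshelve. all: by end_near. Qed.

(* Two distributions whose approximating codebooks fall in the same cells are too close to identify. *)
Lemma id_code_card n (a : n.-tuple R) (l K rho v eta mu la : R) (N : nat)
  (Q : 'I_N -> probability (n.-tuple R) R) (D : 'I_N -> set (n.-tuple Y)) :
  (0 < n)%N -> 0 <= l -> 0 < K -> 0 < eta ->
  cset n `<=` cube R n a l -> (forall x, KL_twice_diff R dY Y W n x) ->
  (forall x, cube R n a l x -> (mxnorm_rq R n (hessian R dY Y W n x) <= K%:E)%E) ->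
  (forall i, approximable (Q i) rho v) ->
  (forall i, measurable (D i)) ->
  (forall i, fine (kout (W n) (Q i) (~` D i)) <= mu) ->
  (forall i j, j != i -> fine (kout (W n) (Q j) (D i)) <= la) ->
  mu + la + 2 * v + eta < 1 ->
  (N <= (Num.truncn rho).+1 * ((Num.truncn (4 * n%:R * (K + 1) * l / eta)).+1 ^ n) ^ Num.truncn rho)%N.
Proof.
move=> n0 l0 K0 e0 cc td HK app mD hmu hla small.
pose h := eta / (4 * n%:R * (K + 1)).
have np : 1 <= n%:R :> R by rewrite ler1n.
have h0 : 0 < h by rewrite divr_gt0// !mulr_gt0//; lra.
have lh : l / h = 4 * n%:R * (K + 1) * l / eta.
  by rewrite /h; field; rewrite !gt_eqF//; lra.
have etaE : eta = 4 * (n%:R * (K + 1)) * h.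
  by rewrite /h; field; apply/andP; split; rewrite gt_eqF//; lra.
clearbody h.
have hK : 8 * (K * (n%:R * h ^+ 2)) < eta ^+ 2 by exact: quant_step.
rewrite -lh -/(qnum l h).
set Mx := Num.truncn rho.
pose M i := sval (cid (app i)).
have encE i := svalP (cid (app i)).
pose enc i := sval (cid (encE i)).
have encP i : [/\ (0 < M i)%N, (M i)%:R <= rho, forall j, (j < M i)%N -> cset n (enc i j) &
     forall B, measurable B ->
      `|fine (kout (W n) (Q i) B) - (M i)%:R^-1 * \sum_(j < M i) fine (W n (enc i j) B)| <= v].
  exact: svalP (cid (encE i)).
have MMx i : (M i <= Mx)%N.
  have [M0 Mr _ _] := encP i; rewrite /Mx truncn_ge_nat//.
  by apply: le_trans Mr.
(* Slots from [M i] on hold cells of arbitrary points; only the first [M i] slots are compared. *)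
pose key i : 'I_Mx.+1 * {ffun 'I_Mx -> {ffun 'I_n -> 'I_(qnum l h)}} :=
  (inord (M i), [ffun j : 'I_Mx => quant a l h (enc i j)]).
have key_inj : injective key.
  move=> i i' [/(congr1 val) /=]; rewrite !inordK ?ltnS ?MMx// => MM /ffunP kk.
  apply/eqP; apply: contrapT => /negP ii'.
  have [M0 _ ec eB] := encP i; have [_ _ ec' eB'] := encP i'.
  have Bi := eB _ (mD i); have Bi' := eB' _ (mD i).
  rewrite -MM in Bi' ec'.
  have q : `|(M i)%:R^-1 * \sum_(j < M i) fine (W n (enc i j) (D i)) -
             (M i)%:R^-1 * \sum_(j < M i) fine (W n (enc i' j) (D i))| <= eta.
    rewrite -mulrBr -sumrB normrM ger0_norm ?invr_ge0// mulrC ler_pdivrMr ?ltr0n//.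
    apply: le_trans (ler_norm_sum _ _ _) _.
    rewrite (@le_trans _ _ (\sum_(j < M i) eta))//; last by rewrite sumr_const card_ord mulr_natr.
    apply: ler_sum => j _.
    have jM : (j < Mx)%N by exact: leq_trans (MMx i).
    have := kk (Ordinal jM); rewrite !ffunE /= => qq.
    apply: (quant_channel (ltW K0) td HK h0 _ _ (esym qq) (ltW e0) hK (mD i)).
      by apply/cc/ec'.
    by apply/cc/ec.
  (* Equal keys would give 1 - mu <= Q_i W(D_i) <= Q_i' W(D_i) + 2 v + eta <= la + 2 v + eta,
     against [small]. *)
  have mui := hmu i; have lai := hla i i'; rewrite eq_sym in lai.
  have {}lai := lai ii'.
  have C : fine (kout (W n) (Q i) (~` D i)) = 1 - fine (kout (W n) (Q i) (D i)).
    have : (kout (W n) (Q i) (D i) + kout (W n) (Q i) (~` D i) = 1)%E.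
      rewrite -(kout_setT (W n) (Q i)) -(setUCr (D i)) measureU//; [exact: measurableC|exact: setICr].
    move=> /(congr1 fine); rewrite fineD ?fin_num_measure//; last exact: measurableC.
    by move=> /= h1; lra.
  move: Bi Bi' q; rewrite !ler_norml => /andP[_ b1] /andP[b2 _] /andP[_ b3].
  lra.
have := leq_card key key_inj.
by rewrite card_ord card_prod card_ord !card_ffun !card_ord.
Qed.

Hypothesis A12 : A1_A2 R dY Y W c Gamma.

Lemma Dcap_le_Sres (mu la delta : R) : mu + la + delta < 1 ->
  (Dcap R dY Y W c Gamma mu la <= Sres R dY Y W c Gamma delta)%E.
Proof.
move=> small; apply: ge_ereal_sup => _ [r' [N [Q [D [ic hmu hla hr]]]] <-].
apply: le_ereal_inf_tmp => _ [r ra <-]; rewrite lee_fin leNgt; apply/negP => rr'.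
(* Both uses lose 4 g: the error budget becomes mu + la + delta + 4 g, and the rates end as r' - g
   <= r + 3 g. *)
pose g := Num.min ((r' - r) / 8) ((1 - (mu + la + delta)) / 8).
have g0 : 0 < g by rewrite lt_min; apply/andP; split; lra.
have g1 : g <= (r' - r) / 8 by rewrite ge_min lexx.
have g2 : g <= (1 - (mu + la + delta)) / 8 by rewrite ge_min lexx orbT.
have Qc n : (0 < n)%N -> (0 < N n)%N /\ forall i, full_on R n (Q n i) (cset n) by move=> /ic[].
have [a [l reg]] := A1_A2_regular A12.
have h1 := eventually_approximable ra Qc g0.
have h2 := reg _ g0.
have h3 := limn_esup_le_near hmu g0.
have h4 := limn_esup_le_near hla g0.
have h5 := limn_einf_ge_near hr g0.
have h6 := near_linear_le_expR (8 / g) g0.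
have h7 := near_linear_le_expR 3 g0.
near \oo => n.
have rg : regular_at W c Gamma a l g n by near: n.
have [n0 l2 lle cc [td HK]] := rg.
have np : 0 < n%:R :> R by rewrite ltr0n.
have [N0 Qf mD] := ic n n0.
have app : forall i, approximable (Q n i) (expR (n%:R * (r + g))) ((delta + g) / 2) by near: n; exact: h1.
have rg0 : 0 <= n%:R * (r + g).
  have [M [_ [M0 Mle _ _]]] := app (Ordinal N0).
  by rewrite -ler_expR expR0 (le_trans _ Mle)// ler1n.
have rg1 : 0 <= r + g by rewrite -(pmulr_rge0 _ np).
set E := expR (expR (n%:R * g)) in lle HK.
have E0 : 0 < E by exact: expR_gt0.
have l0 : 0 <= l n by rewrite (le_trans _ l2).
have mui i : fine (kout (W n) (Q n i) (~` D n i)) <= mu + g.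
  have : imu R dY Y W N Q D n <= mu + g by rewrite -lee_fin; near: n; exact: h3.
  apply: le_trans; rewrite -outdist_kout; last exact: measurableC.
  exact: (le_bigmax _ (fun i => fine (outdist R dY Y W n (Q n i) (~` D n i)))).
have lai i j : j != i -> fine (kout (W n) (Q n j) (D n i)) <= la + g.
  move=> ji.
  have : ilambda R dY Y W N Q D n <= la + g by rewrite -lee_fin; near: n; exact: h4.
  apply: le_trans; rewrite -outdist_kout//.
  apply: le_trans (le_bigmax _ (fun i => \big[Num.max/0]_(j < N n | j != i) fine (outdist R dY Y W n (Q n j) (D n i))) i).
  exact: (@le_bigmax_cond _ _ _ _ _ (fun j => j != i) (fun j => fine (outdist R dY Y W n (Q n j) (D n i)))).
have small' : (mu + g) + (la + g) + 2 * ((delta + g) / 2) + g < 1 by lra.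
have card := id_code_card n0 l0 E0 g0 cc td HK app mD mui lai small'.
set Mx := Num.truncn _ in card; set L := (Num.truncn _).+1 in card.
have Mxle : Mx%:R <= expR (n%:R * (r + g)) by rewrite truncn_le expR_ge0.
have L0 : 0 < L%:R :> R by rewrite ltr0n.
(* The cell count per axis is at most E^3: one factor for the edge length, one for the Hessian
   bound, one for the terms in n and 1/g. *)
have lnL : ln (L%:R : R) <= 3 * expR (n%:R * g).
  have E1 : 1 <= E by rewrite -[leLHS]expR0 ler_expR expR_ge0.
  have nE : 8 / g * n%:R + 1 <= E.
    have : 8 / g * n%:R + 1 <= expR (n%:R * g) by near: n.
    move=> /le_trans; apply; have := expR_ge1Dx (expR (n%:R * g)); rewrite -/E; lra.
  have LE : L%:R <= E ^+ 3.
    rewrite /L -natr1; apply: (@le_trans _ _ (4 * n%:R * (E + 1) * l n / g + 1)).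
      by rewrite lerD2r truncn_le divr_ge0 ?mulr_ge0// ?ltW//; lra.
    have b1 : (E + 1) * l n <= 2 * E ^+ 2.
      apply: (@le_trans _ _ ((E + 1) * E)); first by rewrite ler_wpM2l//; lra.
      rewrite expr2; nra.
    have -> : 4 * n%:R * (E + 1) * l n / g = 4 / g * n%:R * ((E + 1) * l n) by field; rewrite gt_eqF.
    apply: (@le_trans _ _ (4 / g * n%:R * (2 * E ^+ 2) + 1)).
      by rewrite lerD2r ler_wpM2l// mulr_ge0// divr_ge0// ltW.
    have -> : 4 / g * n%:R * (2 * E ^+ 2) = E ^+ 2 * (8 / g * n%:R) by field; rewrite gt_eqF.
    have e2 : 1 <= E ^+ 2 by exact: exprn_ege1.
    apply: (@le_trans _ _ (E ^+ 2 * (8 / g * n%:R + 1))); first by rewrite mulrDr mulr1 lerD2l.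
    by rewrite (exprSr E 2) ler_wpM2l// (le_trans ler01).
  apply: (@le_trans _ _ (ln (E ^+ 3))); first by rewrite ler_ln ?posrE// exprn_gt0.
  by rewrite lnXn// /E expRK [leRHS]mulr_natl.
(* The three [g] come from the codebook size, from ln L, and from absorbing 3 n + 1. *)
have lnN : ln ((N n)%:R : R) <= expR (n%:R * (r + 3 * g)).
  have N0' : 0 < (N n)%:R :> R by rewrite ltr0n.
  have L0' : (0 < L)%N by [].
  apply: (@le_trans _ _ (ln ((Mx.+1 * (L ^ n) ^ Mx)%:R : R))).
    by rewrite ler_ln ?posrE// ?ler_nat// ltr0n muln_gt0 !expn_gt0 L0'.
  rewrite natrM !natrX lnM ?posrE ?exprn_gt0// !lnXn// ?exprn_gt0//.
  have lnM1 : ln (Mx.+1%:R : R) <= Mx%:R.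
    by rewrite -natr1 addrC; apply: le_ln1Dx; rewrite (lt_le_trans (ltrN10 R)).
  rewrite -[ln L%:R *+ n *+ Mx]mulrnA -[ln L%:R *+ _]mulr_natr natrM.
  have eg1 : 1 <= expR (n%:R * g) by rewrite -[leLHS]expR0 ler_expR mulr_ge0// ltW.
  have h8 : 3 * n%:R + 1 <= expR (n%:R * g) by near: n; exact: h7.
  have n0r : 0 <= n%:R :> R by exact: ltW.
  have Mx0 : 0 <= Mx%:R :> R by [].
  have s1 : ln (L%:R : R) * (n%:R * Mx%:R) <= 3 * expR (n%:R * g) * (n%:R * Mx%:R).
    by rewrite ler_wpM2r// mulr_ge0.
  have s2 : Mx%:R <= Mx%:R * expR (n%:R * g) by rewrite ler_peMr.
  apply: (@le_trans _ _ (Mx%:R * expR (n%:R * g) * (3 * n%:R + 1))).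
    have -> : Mx%:R * expR (n%:R * g) * (3 * n%:R + 1) =
       Mx%:R * expR (n%:R * g) + 3 * expR (n%:R * g) * (n%:R * Mx%:R) by ring.
    lra.
  have -> : expR (n%:R * (r + 3 * g)) = expR (n%:R * (r + g)) * expR (n%:R * g) * expR (n%:R * g).
    by rewrite -!expRD; congr expR; ring.
  have m0 : 0 <= Mx%:R * expR (n%:R * g) by rewrite mulr_ge0 ?expR_ge0.
  have m1 : Mx%:R * expR (n%:R * g) <= expR (n%:R * (r + g)) * expR (n%:R * g).
    by rewrite ler_pM2r ?expR_gt0.
  have m2 : 0 <= 3 * n%:R + 1 :> R by lra.
  exact: ler_pM.
have lnlnN : n%:R * (r' - g) <= ln (ln ((N n)%:R : R)).
  have : r' - g <= irate R N n by rewrite -lee_fin; near: n; exact: h5.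
  by rewrite /irate mulrC ler_pdivlMr// mulrC.
have pos : 0 < n%:R * (r' - g) by rewrite mulr_gt0//; lra.
(* If ln N were nonpositive its logarithm would be 0 by convention, while [lnlnN] makes it
   positive. *)
have lnN0 : 0 < ln ((N n)%:R : R).
  rewrite ltNge; apply/negP => /ln0 e; move: lnlnN; rewrite e; lra.
have : expR (n%:R * (r' - g)) <= expR (n%:R * (r + 3 * g)).
  by apply: le_trans lnN; rewrite -[leRHS]lnK ?posrE// ler_expR.
rewrite ler_expR ler_pM2l//; lra.
Unshelve. all: by end_near. Qed.

End id_converse.

(** * Identification: direct part *)

Local Open Scope nat_scope.

Lemma card_bigcup_le (I T : finType) (A : pred I) (F : I -> {set T}) :
  #|(\bigcup_(i | A i) F i)%SET| <= \sum_(i | A i) #|F i|.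
Proof.
elim/big_rec2: _ => [|i m B _ Bm]; first by rewrite cards0.
by rewrite (leq_trans (leq_card_setU _ _).1)// leq_add2l.
Qed.

(** * Words that rarely agree *)

Section gilbert_varshamov.
Variables (s q : nat).
Hypothesis q0 : 0 < q.

Local Notation word := {ffun 'I_s -> 'I_q}.

Definition agree (f g : word) : {set 'I_s} := [set a | f a == g a]%SET.

Lemma card_agree_on (g : word) (A : {set 'I_s}) :
  #|[set f : word | A \subset agree f g]%SET| = q ^ (s - #|A|).
Proof.
have -> : #|[set f : word | A \subset agree f g]%SET| =
    #|family (fun a => if a \in A then pred1 (g a) else predT)|.
  apply: eq_card => f; rewrite inE; apply/fintype.subsetP/familyP => h a.
    by case: ifP => // aA; have := h a aA; rewrite inE.
  by move=> aA; rewrite inE; have := h a; rewrite aA.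
rewrite card_family foldrE big_map big_enum /=.
rewrite (bigID (mem A))/= big1 ?mul1n; last first.
  by move=> a aA; rewrite aA card1.
rewrite (eq_bigr (fun=> q)); last by move=> a /negbTE ->; rewrite card_ord.
rewrite prod_nat_const; congr (_ ^ _).
have -> : #|(fun a : 'I_s => a \notin A)| = #|(~: A)%SET|.
  by apply: eq_card => a; rewrite !inE.
apply: (@addnI #|A|); rewrite cardsC card_ord subnKC//.
by rewrite -[leqRHS]card_ord max_card.
Qed.

(** Union bound over the sets of positions of size at least [t], of which there are at most 2^s. *)
Lemma card_agree_ball (g : word) t :
  #|[set f : word | t <= #|agree f g|]%SET| <= 2 ^ s * q ^ (s - t).
Proof.
have sub : [set f : word | t <= #|agree f g|]%SET \subset
    (\bigcup_(A : {set 'I_s} | t <= #|A|) [set f : word | A \subset agree f g])%SET.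
  apply/fintype.subsetP => f; rewrite inE => h; apply/finset.bigcupP; exists (agree f g) => //.
  by rewrite inE.
apply: leq_trans (subset_leq_card sub) _.
apply: leq_trans (card_bigcup_le _ _) _.
apply: (@leq_trans (\sum_(A : {set 'I_s} | t <= #|A|) q ^ (s - t))).
  by apply: leq_sum => A tA; rewrite card_agree_on leq_pexp2l// leq_sub2l.
rewrite sum_nat_const leq_mul2r; apply/orP; right.
by apply: leq_trans (max_card _) _; rewrite -cardsT -powersetT card_powerset cardsT card_ord.
Qed.

(** In a largest separated set no word can be added, so the agreement balls around its elements
    cover all words. *)
Lemma gilbert_varshamov t : t <= s ->
  exists C : {set word}, {in C &, forall f g, f != g -> #|agree f g| < t} /\
   q ^ s <= #|C| * (2 ^ s * q ^ (s - t)).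
Proof.
move=> ts.
pose good (C : {set word}) := [forall f in C, forall g in C, (f != g) ==> (#|agree f g| < t)].
have good0 : good finset.set0 by apply/forall_inP => f; rewrite inE.
case: (@arg_maxnP _ finset.set0 good (fun C : {set word} => #|C|) good0) => C gC maxC.
exists C; split.
  by move=> f g fC gC' fg; move/forall_inP: gC => /(_ f fC) /forall_inP /(_ g gC') /implyP; apply.
have cover : [set: word]%SET \subset (\bigcup_(g in C) [set f : word | t <= #|agree f g|])%SET.
  apply/fintype.subsetP => f _; apply/finset.bigcupP.
  have [fC|fC] := boolP (f \in C).
    exists f => //; rewrite inE (_ : agree f f = [set: 'I_s]%SET) ?cardsT ?card_ord//.
    by apply/finset.setP => a; rewrite !inE eqxx.
  have [[g gC' h]|nex] := pselect (exists2 g, g \in C & t <= #|agree f g|).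
    by exists g => //; rewrite inE.
  exfalso.
  have sym g1 g2 : agree g1 g2 = agree g2 g1 by apply/finset.setP => a; rewrite !inE eq_sym.
  have far g : g \in C -> #|agree f g| < t.
    by move=> gC'; rewrite ltnNge; apply/negP => h; apply: nex; exists g.
  have good' : good (f |: C)%SET.
    apply/forall_inP => g1 g1C; apply/forall_inP => g2 g2C; apply/implyP => g12.
    move: g1C g2C g12; rewrite !finset.in_setU1 => /orP[/eqP ->|g1C] /orP[/eqP ->|g2C] g12.
    - by rewrite eqxx in g12.
    - exact: far.
    - by rewrite sym; exact: far.
    - by move/forall_inP: gC => /(_ g1 g1C) /forall_inP /(_ g2 g2C) /implyP; apply.
  by have := maxC _ good'; rewrite /= cardsU1 fC add1n ltnn.
have := subset_leq_card cover; rewrite cardsT card_ffun !card_ord => /leq_trans; apply.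
apply: leq_trans (card_bigcup_le _ _) _.
by rewrite -sum_nat_const; apply: leq_sum => g _; exact: card_agree_ball.
Qed.

End gilbert_varshamov.

(** The parameters are tuned so that (2^k)^(2u) = 2^s 2^s with s = k u: one factor pays for the
    union bound, the other is the number of words left. *)
Lemma separated_words (k u : nat) : 1 < k ->
  exists F : 'I_(2 ^ (k * u)) -> {ffun 'I_(k * u) -> 'I_(2 ^ k)},
    forall i j, i != j -> #|agree (F i) (F j)| < 2 * u.
Proof.
move=> k1.
have [C [Cd Cc]] := @gilbert_varshamov (k * u) (2 ^ k) (expn_gt0 2 k) (2 * u) (leq_mul k1 (leqnn u)).
have cC : 2 ^ (k * u) <= #|C|.
  move: Cc; set s := k * u.
  have -> : (2 ^ k) ^ s = (2 ^ k) ^ (2 * u) * (2 ^ k) ^ (s - 2 * u).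
    by rewrite -expnD subnKC// leq_mul.
  rewrite mulnA leq_pmul2r ?expn_gt0//.
  have -> : (2 ^ k) ^ (2 * u) = 2 ^ s * 2 ^ s.
    by rewrite -expnM -expnD; congr (_ ^ _); rewrite /s; lia.
  by rewrite leq_pmul2r ?expn_gt0.
exists (fun i => enum_val (widen_ord cC i)) => i j ij.
apply: Cd; [exact: enum_valP|exact: enum_valP|].
by apply: contra ij => /eqP/enum_val_inj /(congr1 val) /= h; apply/eqP/val_inj.
Qed.

Section id_direct.
Context {R : realType} {dY : measure_display} {Y : measurableType dY}.
Variables (W : channel R dY Y) (c : forall n : nat, n.-tuple R -> R) (Gamma : R).

Local Open Scope ring_scope.

Local Notation cset := (cost_set R c Gamma).
Local Notation out := (outdist R dY Y W).

(** The Ahlswede-Dueck construction. Codewords are indexed by pairs (position, letter), and message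
    [i] is sent as a uniformly chosen point of the graph of the word [F i]. Two such graphs share
    fewer than 2 u of their k u points, the fraction 2 / k. *)
Lemma id_code_of_code n M k (enc : 'I_M -> n.-tuple R) (dec : n.-tuple Y -> 'I_M) :
  let u := (M %/ (k * 2 ^ k))%N in
  (1 < k)%N -> (0 < u)%N ->
  (forall i, cset n (enc i)) -> (forall i, measurable (dec @^-1` [set i])) ->
  exists (Q : 'I_(2 ^ (k * u)) -> probability (n.-tuple R) R) (D : 'I_(2 ^ (k * u)) -> set (n.-tuple Y)),
  [/\ forall i, full_on R n (Q i) (cset n), forall i, measurable (D i) &
   forall e, 0 <= e -> (forall i, (W n (enc i) (~` (dec @^-1` [set i])) <= e%:E)%E) ->
     (forall i, fine (out n (Q i) (~` D i)) <= e) /\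
     (forall i j, j != i -> fine (out n (Q j) (D i)) <= 2 / k%:R + e)].
Proof.
move=> u k1 u0 encc mdec.
have [F Fsep] := @separated_words k u k1.
set s := (k * u)%N in F Fsep *.
have s0 : (0 < s)%N by rewrite muln_gt0 u0 (ltnW k1).
have cM : (#|{: 'I_s * 'I_(2 ^ k)}| <= M)%N.
  rewrite card_prod !card_ord (leq_trans _ (leq_trunc_div M (k * 2 ^ k)))//.
  by rewrite -/u /s; lia.
pose io a b : 'I_M := widen_ord cM (enum_rank (a, b)).
have io_inj a b a' b' : io a b = io a' b' -> (a, b) = (a', b').
  by move=> /(congr1 val) /= /val_inj /enum_rank_inj.
have s0' : 0 < s%:R :> R by rewrite ltr0n.
have QP i : exists Q : probability (n.-tuple R) R, forall h : n.-tuple R -> \bar R, measurable_fun setT h ->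
    (forall z, 0 <= h z)%E -> (\int[Q]_z h z = \sum_(a < s) (s%:R^-1)%:E * h (enc (io a (F i a))))%E.
  apply: (@exists_mixture _ _ _ s (fun a => enc (io a (F i a))) (fun=> s%:R^-1)).
  - by move=> a; rewrite invr_ge0.
  - by rewrite sumr_const card_ord -[LHS]mulr_natr mulVf// gt_eqF.
pose Q i := sval (cid (QP i)).
have QE i := svalP (cid (QP i)).
pose D i := \bigcup_(a in [set: 'I_s]) (dec @^-1` [set io a (F i a)]).
have mD i : measurable (D i) by apply: fin_bigcup_measurable.
have outE i B : measurable B -> fine (out n (Q i) B) = s%:R^-1 * \sum_(a < s) fine (W n (enc (io a (F i a))) B).
  move=> mB; rewrite /outdist QE//; last exact: measurable_kernel.
  rewrite -sum_fine; last by move=> a _; rewrite fin_numM// channel_fin.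
  by rewrite mulr_sumr; apply: eq_bigr => a _; rewrite fineM// channel_fin.
exists Q, D; split => //.
  move=> i; apply: (@mixture_full_on R n s (fun a => enc (io a (F i a))) (fun=> s%:R^-1) (Q i) _ (QE i)).
    by rewrite sumr_const card_ord -[LHS]mulr_natr mulVf// gt_eqF.
  by move=> a; exact: encc.
move=> e e0 he; split.
  move=> i; rewrite outE; last exact: measurableC.
  rewrite mulrC ler_pdivrMr// (@le_trans _ _ (\sum_(a < s) e))//; last by rewrite sumr_const card_ord mulr_natr.
  apply: ler_sum => a _; rewrite -lee_fin fineK; last by apply: channel_fin; exact: measurableC.
  apply: le_trans (he (io a (F i a))); apply: le_measure; rewrite ?inE.
  - exact: measurableC.
  - exact: measurableC.
  - by apply: subsetC => y /= dy; exists a.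
move=> i j ji; rewrite outE// mulrC ler_pdivrMr//.
(* At an agreement the probability is bounded by 1. Elsewhere the codeword sent is not among those
   making up [D i], so landing there is a decoding error. *)
apply: (@le_trans _ _ (\sum_(a < s) ((a \in agree (F j) (F i))%:R + e))).
  apply: ler_sum => a _; rewrite -lee_fin fineK; last exact: channel_fin.
  rewrite inE; case: eqP => [_|ne].
    by rewrite (le_trans (probability_le1 (kprob (W n) _) (mD i)))// lee_fin lerDl.
  rewrite add0r; apply: le_trans (he (io a (F j a))); apply: le_measure; rewrite ?inE//.
    exact: measurableC.
  move=> y [b _ /= ->] /io_inj [ba]; rewrite ba.
  by move/esym.
rewrite big_split/= sumr_const card_ord -natr_sum.
have -> : (\sum_(a < s) (a \in agree (F j) (F i)) = #|agree (F j) (F i)|)%N.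
  by rewrite -sum1_card [RHS]big_mkcond.
have : (#|agree (F j) (F i)| <= 2 * u)%N by apply/ltnW/Fsep.
rewrite -(ler_nat R) natrM => h.
have kE : (2 / k%:R) * s%:R = 2 * u%:R :> R.
  by rewrite /s natrM mulrA divfK// pnatr_eq0 -lt0n ltnW.
by rewrite mulrDl kE -mulr_natr; lra.
Qed.

Lemma out_setC0 n (Q : probability (n.-tuple R) R) : fine (out n Q (~` setT)) = 0.
Proof.
rewrite /outdist setCT; under eq_integral do rewrite measure0.
by rewrite integral0.
Qed.

(** For 2 / k to vanish [k] must grow, but the alphabet costs a factor 2^k of the codebook, so [k]
    is about n d. Of the surplus rate 2 d, one d pays for 2^k <= e^{nd+2} and the other absorbs [k]
    and the constant e^2. *)
Lemma id_rate_bound n (r d : R) (k u : nat) : (0 < n)%N -> 0 < r -> 0 < d ->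
  k = (Num.truncn (n%:R * d)).+2 -> u = (csize (r + 2 * d)%R n %/ (k * 2 ^ k))%N ->
  expR 2 * (d + 3) * n%:R + 1 <= expR (n%:R * d) ->
  expR (n%:R * r) <= (k * u)%:R.
Proof.
move=> n0 r0 d0 kE uE h.
have np : 1 <= n%:R :> R by rewrite ler1n.
have nd0 : 0 <= n%:R * d by rewrite mulr_ge0// ltW.
have kle : k%:R <= n%:R * d + 2.
  rewrite kE -addn2 natrD lerD2r.
  by rewrite truncn_le.
have k2 : (2 ^ k)%:R <= expR (n%:R * d + 2) :> R.
  rewrite natrX (@le_trans _ _ (expR 1 ^+ k))//.
    rewrite lerXn2r ?nnegrE ?expR_ge0//.
    by have := @expR_ge1Dx R 1; lra.
  by rewrite -expRM_natl ler_expR mulr1.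
have k20 : 0 < (2 ^ k)%:R :> R by rewrite ltr0n expn_gt0.
have mod : (csize (r + 2 * d) n)%:R <= (k * u)%:R * (2 ^ k)%:R + k%:R * (2 ^ k)%:R :> R.
  rewrite -!natrM -natrD ler_nat uE [leqLHS](divn_eq _ (k * 2 ^ k)).
  have : (csize (r + 2 * d) n %% (k * 2 ^ k) < k * 2 ^ k)%N by rewrite ltn_mod muln_gt0 kE/= expn_gt0.
  by lia.
have low := csize_ge (r + 2 * d) n.
have e1 : expR (n%:R * (r + 2 * d)) = expR (n%:R * r) * (expR (n%:R * d) * expR (n%:R * d)).
  by rewrite -!expRD; congr expR; ring.
have er : 1 <= expR (n%:R * r).
  by rewrite -expR0 ler_expR mulr_ge0// ltW.
have key : (expR (n%:R * r) + k%:R) * (2 ^ k)%:R <= expR (n%:R * (r + 2 * d)).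
  rewrite e1; rewrite expRD in k2.
  have C0 : 0 < expR 2 :> R by exact: expR_gt0.
  have B0 : 0 < expR (n%:R * d) by exact: expR_gt0.
  have kC : (1 + k%:R) * expR 2 <= expR (n%:R * d).
    apply: le_trans h; rewrite mulrC -mulrA (@le_trans _ _ (expR 2 * ((d + 3) * n%:R)))//; last lra.
    by rewrite ler_pM2l// mulrDl; nra.
  have kA : (expR (n%:R * r) + k%:R) * expR 2 <= expR (n%:R * r) * expR (n%:R * d).
    apply: (@le_trans _ _ (expR (n%:R * r) * ((1 + k%:R) * expR 2))); last by rewrite ler_pM2l// expR_gt0.
    rewrite mulrA ler_pM2r// mulrDr mulr1 lerD2l.
    by rewrite ler_peMl.
  apply: (@le_trans _ _ ((expR (n%:R * r) + k%:R) * (expR (n%:R * d) * expR 2))).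
    by rewrite ler_wpM2l// addr_ge0 ?expR_ge0.
  rewrite mulrCA [leRHS]mulrCA; exact: ler_wpM2l (ltW B0) _ _ kA.
have : (expR (n%:R * r) + k%:R) * (2 ^ k)%:R <= ((k * u)%:R + k%:R) * (2 ^ k)%:R.
  by rewrite [leRHS]mulrDl; lra.
by rewrite ler_pM2r// lerD2r.
Qed.

Lemma sup_I_low_le_Dcap :
  (sup_I_low R dY Y W c Gamma <= Dcap R dY Y W c Gamma 0 0)%E.
Proof.
apply: ge_ereal_sup => _ [P PS <-]; apply: ge_ereal_sup => _ [a ha <-].
apply/lee_subgt0Pr => g g0; rewrite -EFinB.
apply: ereal_sup_ubound; exists (a - g) => //.
(* The transmission code needs rate r + 2 d < a. *)
set r := a - g; pose d := g / 3.
have d0 : 0 < d by rewrite /d; lra.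
have ra : r + 2 * d < a by rewrite /r /d; lra.
have [enc [dec [tc he]]] := good_codes PS ra ha.
pose k n := (Num.truncn (n%:R * d)).+2.
pose u n := (csize (r + 2 * d) n %/ (k n * 2 ^ k n))%N.
pose T n N := (('I_N -> probability (n.-tuple R) R) * ('I_N -> set (n.-tuple Y)))%type.
have H n : exists NQD : {N : nat & T n N},
  let Q := (projT2 NQD).1 in let D := (projT2 NQD).2 in (0 < n)%N ->
  [/\ projT1 NQD = if (0 < r) && (0 < u n)%N then (2 ^ (k n * u n))%N else 1%N,
      forall i, full_on R n (Q i) (cset n), forall i, measurable (D i) &
      forall e, 0 <= e -> (forall i, (W n (enc n i) (~` (dec n @^-1` [set i])) <= e%:E)%E) ->
        (forall i, fine (out n (Q i) (~` D i)) <= e) /\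
        (forall i j, j != i -> fine (out n (Q j) (D i)) <= 2 / (k n)%:R + e)].
  have [|_] := boolP ((0 < r) && (0 < u n)%N).
    move=> /andP[_ u0].
    have [n0|n0] := posnP n; first by exists (existT (T n) 0%N ((fun=> P n), (fun=> setT))); rewrite n0.
    have [_ encc mdec] := tc n n0.
    have [Q [D [h1 h2 h3]]] := id_code_of_code (isT : (1 < k n)%N) u0 encc mdec.
    by exists (existT (T n) (2 ^ (k n * u n))%N (Q, D)).
  (* A single message decoded by the whole space makes no error. Its rate is 0, by ln 0 = 0, which
     suffices for r <= 0; for r > 0 this case occurs at finitely many [n] only. *)
  exists (existT (T n) 1%N ((fun=> P n), (fun=> setT))) => /= n0; split => //.
  - by move=> _; exact: PS.
  - move=> e e0 _; split => [i|i j]; first by rewrite out_setC0.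
    by rewrite !ord1 eqxx.
pose N n := projT1 (sval (cid (H n))).
pose Q n := (projT2 (sval (cid (H n)))).1 : 'I_(N n) -> _.
pose D n := (projT2 (sval (cid (H n)))).2 : 'I_(N n) -> _.
have HP n : (0 < n)%N -> [/\ N n = if (0 < r) && (0 < u n)%N then (2 ^ (k n * u n))%N else 1%N,
      forall i, full_on R n (Q n i) (cset n), forall i, measurable (D n i) &
      forall e, 0 <= e -> (forall i, (W n (enc n i) (~` (dec n @^-1` [set i])) <= e%:E)%E) ->
        (forall i, fine (out n (Q n i) (~` D n i)) <= e) /\
        (forall i j, j != i -> fine (out n (Q n j) (D n i)) <= 2 / (k n)%:R + e)].
  exact: svalP (cid (H n)).
clearbody Q D; exists N, Q, D; split.
- move=> n n0; have [NE h1 h2 _] := HP n n0; split => //.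
  by rewrite NE; case: ifP => // _; rewrite expn_gt0.
- apply: limn_esup_le_intro => e e0; have h := he _ e0; near=> n.
  have n0 : (0 < n)%N by near: n; exact: nbhs_infty_gt.
  have [_ _ _ /(_ e (ltW e0))[|hm _]] := HP n n0; first by near: n.
  by rewrite add0r lee_fin; apply: bigmax_le; [exact: ltW|move=> i _; exact: hm].
- apply: limn_esup_le_intro => e e0.
  have e2 : 0 < e / 2 by lra.
  have ed : 0 < e * d / 4 by rewrite divr_gt0// mulr_gt0.
  have h := he _ e2; have h' := near_inv_le ed; near=> n.
  have n0 : (0 < n)%N by near: n; exact: nbhs_infty_gt.
  have [_ _ _ /(_ (e / 2) (ltW e2))[|_ hl]] := HP n n0; first by near: n.
  have np : 0 < n%:R :> R by rewrite ltr0n.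
  have ke : 2 / (k n)%:R <= e / 2.
    have kd : n%:R * d <= (k n)%:R.
      by rewrite ltW// (lt_trans (truncnS_gt _))// ltr_nat.
    have : n%:R^-1 <= e * d / 4 by near: n.
    rewrite -[leLHS]mul1r ler_pdivrMr// => hn.
    by rewrite ler_pdivrMr ?ltr0n//; nra.
  rewrite add0r lee_fin; apply: bigmax_le; first exact: ltW.
  move=> i _; apply: bigmax_le; first exact: ltW.
  by move=> j ji; apply: le_trans (hl i j ji) _; lra.
- have [r0|r0] := lerP r 0.
    apply: limn_einf_ge_intro => e e0; near=> n.
    have n0 : (0 < n)%N by near: n; exact: nbhs_infty_gt.
    have [NE _ _ _] := HP n n0.
    by rewrite /irate NE ltNge r0 /= ln1 ln0// mulr0 lee_fin; lra.
  apply: limn_einf_ge_intro => e e0.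
  (* From N = 2^(k u), ln ln N = ln (k u) + ln (ln 2); the constant [L] bounds the loss from the
     negative last term. *)
  pose L : R := `|ln (ln 2)| + 1.
  have L0 : 0 < L by rewrite /L ltr_pwDr.
  have eL : 0 < e / L by rewrite divr_gt0.
  have h := near_linear_le_expR (expR 2 * (d + 3)) d0.
  have h' := near_inv_le eL; near=> n.
  have n0 : (0 < n)%N by near: n; exact: nbhs_infty_gt.
  have np : 0 < n%:R :> R by rewrite ltr0n.
  have [NE _ _ _] := HP n n0.
  have ku : expR (n%:R * r) <= (k n * u n)%:R.
    by apply: (id_rate_bound n0 r0 d0 erefl erefl); near: n; exact: h.
  have ku0 : (0 < k n * u n)%N by rewrite -(ltr0n R) (lt_le_trans _ ku)// expR_gt0.
  have u0 : (0 < u n)%N by move: ku0; rewrite muln_gt0 => /andP[].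
  have l2 : 0 < ln 2 :> R by rewrite ln_gt0// ltr1n.
  rewrite lee_fin /irate NE r0 u0 /= natrX lnXn ?ltr0n// -[ln 2 *+ _]mulr_natl lnM ?posrE ?ltr0n//.
  rewrite mulrC ler_pdivlMr//.
  have k1 : r * n%:R <= ln (k n * u n)%:R.
    by rewrite mulrC -[leLHS]expRK ler_ln ?posrE ?expR_gt0 ?ltr0n.
  have k2 : L <= e * n%:R.
    have : n%:R^-1 <= e / L by near: n.
    rewrite -[leLHS]mul1r ler_pdivrMr// mulrAC ler_pdivlMr// mul1r.
    by [].
  have k3 : - L <= ln (ln 2) by rewrite /L; have := ler_norm (- ln (ln 2 : R)); rewrite normrN; lra.
  by rewrite mulrBl; lra.
Unshelve. all: by end_near. Qed.

Lemma Dcap_mono (mu la mu' la' : R) : mu <= mu' -> la <= la' ->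
  (Dcap R dY Y W c Gamma mu la <= Dcap R dY Y W c Gamma mu' la')%E.
Proof.
move=> mm ll; apply: le_ereal_sup => _ [r [N [Q [D [ic h1 h2 h3]]]] <-].
by exists r => //; exists N, Q, D; split => //; [rewrite (le_trans h1)|rewrite (le_trans h2)].
Qed.

Lemma Sres_mono (delta delta' : R) : delta <= delta' ->
  (Sres R dY Y W c Gamma delta' <= Sres R dY Y W c Gamma delta)%E.
Proof.
move=> dd; apply: le_ereal_inf => _ [r ra <-]; exists r => // P PS.
by have [M [enc [h1 h2 h3]]] := ra P PS; exists M, enc; split; rewrite ?(le_trans h2).
Qed.

End id_direct.

(** * Closing the chain of inequalities *)

Unset Implicit Arguments.
Local Open Scope classical_set_scope.
Local Open Scope ring_scope.

Theorem theorem6p2 (R : realType) (dY : measure_display) (Y : measurableType dY)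
  (W : channel R dY Y) (c : forall n : nat, n.-tuple R -> R) (Gamma : R) :
  A1_A2 R dY Y W c Gamma ->
  strong_converse R dY Y W c Gamma ->
  forall eps delta mu lambda : R,
    0 <= eps -> eps < 1 ->
    0 <= delta -> delta < 1 ->
    0 <= mu -> 0 <= lambda -> mu + lambda < 1 ->
    [/\ sup_I_low R dY Y W c Gamma = Cs R dY Y W c Gamma eps,
        Cs R dY Y W c Gamma eps = Dcap R dY Y W c Gamma mu lambda,
        Dcap R dY Y W c Gamma mu lambda = Sres R dY Y W c Gamma delta &
        Sres R dY Y W c Gamma delta = sup_I_up R dY Y W c Gamma].
Proof.
move=> A12 sc eps delta mu lambda e0 e1 d0 d1 m0 l0 ml.
set L := sup_I_low R dY Y W c Gamma.
have LC : (L <= Cs R dY Y W c Gamma 0)%E by exact: sup_I_low_le_Cs.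
have CL : (Cs R dY Y W c Gamma 0 <= L)%E by exact: Cs_le_sup_I_low.
have UL : (sup_I_up R dY Y W c Gamma <= L)%E.
  by apply: le_trans CL; exact: sup_I_up_le_Cs.
have S0U : (Sres R dY Y W c Gamma 0 <= sup_I_up R dY Y W c Gamma)%E by exact: Sres_le_sup_I_up.
have LD : (L <= Dcap R dY Y W c Gamma 0 0)%E by exact: sup_I_low_le_Dcap.
(* With both errors zero the whole margin goes to [delta]. *)
have DS : (Dcap R dY Y W c Gamma 0 0 <= Sres R dY Y W c Gamma delta)%E.
  by apply: Dcap_le_Sres => //; rewrite !add0r.
have SS : (Sres R dY Y W c Gamma delta <= Sres R dY Y W c Gamma 0)%E by exact: Sres_mono.
have CE : Cs R dY Y W c Gamma eps = L.
  apply/eqP; rewrite eq_le (le_trans (Cs_le_Cs0 sc e1) CL)/=.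
  by apply: le_trans LC _; exact: Cs_mono.
(* Here delta = 0 instead, and the whole margin goes to the two errors. *)
have DE : Dcap R dY Y W c Gamma mu lambda = L.
  apply/eqP; rewrite eq_le (le_trans LD (Dcap_mono _ _ _ m0 l0)) andbT.
  apply: le_trans (le_trans S0U UL).
  by apply: Dcap_le_Sres => //; rewrite addr0.
have SE : Sres R dY Y W c Gamma delta = L.
  by apply/eqP; rewrite eq_le (le_trans SS (le_trans S0U UL)) (le_trans LD DS).
have UE : sup_I_up R dY Y W c Gamma = L.
  by apply/eqP; rewrite eq_le UL (le_trans (le_trans LD DS) (le_trans SS S0U)).
by rewrite CE DE SE UE.
Qed.
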